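(* There exists a constant $C>0$ such that for all dominant weights $\mu\in\Lambda^+$ of $G=\mathrm{SU}(3)$ and all $H\in\mathfrak{t}$ such that $\exp H$ is non-central in $G$, $$\frac{|\chi(\mu,H)|}{d_\mu}\leq C\, c(H)^{-1}\,(\overline{\mu}\,\underline{\mu})^{-1}.$$
   Context: $G=\mathrm{SU}(3)$, $T$ is a maximal torus of $G$ with Lie algebra $\mathfrak{t}$, and $\mathfrak{t}^*$ is the real dual of $\mathfrak{t}$. Roots and weights are regarded as elements of $i\mathfrak{t}^*$ (so $\alpha(H)/i\in\mathbb{R}$ for a root $\alpha$ and $H\in\mathfrak{t}$). $\Phi^+\subset i\mathfrak{t}^*$ is a fixed positive root system (it has three elements), $\rho$ is the half sum of the positive roots, $\langle\cdot,\cdot\rangle$ is a fixed Weyl-group-invariant inner product on $i\mathfrak{t}^*$, and $\Lambda^+\subset i\mathfrak{t}^*$ is the set of dominant weights. For $\mu\in\Lambda^+$, $\chi_\mu:G\to\mathbb{C}$ is the character of the irreducible representation of $G$ with highest weight $\mu$, $\chi(\mu,H):=\chi_\mu(\exp H)$ for $H\in\mathfrak{t}$, and $d_\mu=\chi(\mu,0)$ is the dimension of that representation. $\overline{\mu}$ and $\underline{\mu}$ denote the maximum and the minimum of $\{\langle\mu+\rho,\alpha\rangle:\alpha\in\Phi^+\}$, respectively. For $H\in\mathfrak{t}$, $c(H)$ denotes the product of the two largest among the three numbers $|\sin(\alpha(H)/2i)|$, $\alpha\in\Phi^+$ (counted with multiplicity); one has $c(H)\neq 0$ if and only if $\exp H$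 is non-central in $G$. *)

(* Defs.v *)
From HB Require Import structures.
From mathcomp Require Import all_boot all_order all_algebra.
From mathcomp Require Import complex.
From mathcomp Require Import all_classical all_reals all_analysis.

Set Implicit Arguments.
Unset Strict Implicit.
Unset Printing Implicit Defensive.

Import Order.TTheory GRing.Theory Num.Theory.
Import numFieldNormedType.Exports.

Local Open Scope classical_set_scope.
Local Open Scope ring_scope.
Local Open Scope complex_scope.

(* The usual topology and norm of the complex field R[i]; the spaces of
   complex matrices inherit theirs from it. *)
HB.instance Definition _ (R : rcfType) := PseudoPointedMetric.copy R[i] R[i]^o.
HB.instance Definition _ (R : rcfType) := NormedModule.copy R[i] R[i]^o.

Section Exponentials.
Variable R : realType.

Definition cexp (z : R[i]) : R[i] :=
  (expR (complex.Re z))%:C * (cos (complex.Im z) +i* sin (complex.Im z)).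

Definition expmx n (A : 'M[R[i]]_n) : 'M[R[i]]_n :=
  limn (series (fun k : nat => (k`!%:R)^-1 *: A ^+ k)).

End Exponentials.

Section MaximalTorus.
Variable R : realType.
Local Notation M3 := 'M[R[i]]_3.

Definition SU3 : set M3 := [set g | g \is unitarymx /\ \det g = 1].

Definition central_in_SU3 (g : M3) : Prop :=
  forall h, SU3 h -> g *m h = h *m g.

Definition subgroup (T : set M3) : Prop :=
  [/\ T 1%:M, (forall g h, T g -> T h -> T (g *m h))
    & (forall g, T g -> T (invmx g))].

(* A compact subgroup of SU(3) is a Lie subgroup, and a torus is a compact
   connected abelian Lie group. *)
Definition torus (T : set M3) : Prop :=
  [/\ T `<=` SU3, subgroup T, compact T, connected T
    & (forall g h, T g -> T h -> g *m h = h *m g)].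

Definition maximal_torus (T : set M3) : Prop :=
  torus T /\ forall S, torus S -> T `<=` S -> S = T.

Definition Lie (T : set M3) : set M3 :=
  [set X | forall s : R, T (expmx (s%:C *: X))].

End MaximalTorus.

Section Weights.
Variables (R : realType) (T : set 'M[R[i]]_3).
Local Notation M3 := 'M[R[i]]_3.

(* Functionals live on the subtype of elements of the Lie algebra of T, so that
   extensional equality is equality as functionals on it. *)
Definition functional : Type := Lie T -> R[i].

(* The real vector space i t^*: since Lie T is used as a mere type, real
   linearity is expressed through the values in the ambient matrix space. *)
Definition it_dual : set functional :=
  [set l | (forall H : Lie T, complex.Re (l H) = 0) /\
    forall (a b : R) (H1 H2 H3 : Lie T),
      \val H3 = a%:C *: \val H1 + b%:C *: \val H2 ->
      l H3 = a%:C * l H1 + b%:C * l H2].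

(* Roots of sl(3,C), the complexification of su(3), with respect to Lie T. *)
Definition is_root (l : functional) : Prop :=
  [/\ it_dual l, l <> (fun=> 0) &
    exists X : M3, [/\ X != 0, \tr X = 0 &
      forall H : Lie T, \val H *m X - X *m \val H = l H *: X]].

Definition ladd (l m : functional) : functional := fun H => l H + m H.
Definition lopp (l : functional) : functional := fun H => - l H.
Definition lscale (a : R) (l : functional) : functional := fun H => a%:C * l H.

(* [a] enumerates without repetition a positive root system. *)
Definition positive_system (a : 'I_3 -> functional) : Prop :=
  [/\ injective a,
      (forall i, is_root (a i)),
      (forall l, is_root l ->
         (range a l \/ range a (lopp l)) /\ ~ (range a l /\ range a (lopp l)))
    & (forall i j, is_root (ladd (a i) (a j)) -> range a (ladd (a i) (a j)))].

Definition rho (a : 'I_3 -> functional) : functional :=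
  fun H => 2^-1 * \sum_(i < 3) a i H.

Definition inner_product (ip : functional -> functional -> R) : Prop :=
  [/\ (forall l m, it_dual l -> it_dual m -> ip l m = ip m l),
      (forall (c : R) l l' m, it_dual l -> it_dual l' -> it_dual m ->
         ip (ladd (lscale c l) l') m = c * ip l m + ip l' m)
    & (forall l, it_dual l -> l <> (fun=> 0) -> 0 < ip l l)].

Definition normalizes (n : M3) : Prop :=
  SU3 n /\ forall g : M3, T (n *m g *m invmx n) <-> T g.

(* l' is l composed with Ad n on Lie T. *)
Definition weyl_image (n : M3) (l l' : functional) : Prop :=
  forall H H' : Lie T, \val H' = n *m \val H *m invmx n -> l' H = l H'.

(* The Weyl group is the normalizer of T modulo T, acting through Ad. *)
Definition weyl_invariant (ip : functional -> functional -> R) : Prop :=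
  forall n l l' m m', normalizes n ->
    it_dual l -> it_dual l' -> it_dual m -> it_dual m' ->
    weyl_image n l l' -> weyl_image n m m' -> ip l' m' = ip l m.

Definition dominant_weight (a : 'I_3 -> functional)
    (ip : functional -> functional -> R) (mu : functional) : Prop :=
  [/\ it_dual mu,
      (forall H : Lie T, expmx (\val H) = 1%:M ->
         exists k : int, mu H = (2 * pi * k%:~R) *i)
    & (forall i, 0 <= ip mu (a i))].

Definition upper_mu (a : 'I_3 -> functional)
    (ip : functional -> functional -> R) (mu : functional) : R :=
  \big[Num.max/ip (ladd mu (rho a)) (a ord0)]_(i < 3)
    ip (ladd mu (rho a)) (a i).

Definition lower_mu (a : 'I_3 -> functional)
    (ip : functional -> functional -> R) (mu : functional) : R :=
  \big[Num.min/ip (ladd mu (rho a)) (a ord0)]_(i < 3)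
    ip (ladd mu (rho a)) (a i).

(* For l in i t^*, l(H) / i is the imaginary part of l(H). *)
Definition c_of (a : 'I_3 -> functional) (H : Lie T) : R :=
  let s := sort >=%R [seq `|sin (complex.Im (a i H) / 2)| | i <- enum 'I_3] in
  s`_0 * s`_1.

Section Representations.
Variables (n : nat) (p : 'M[R[i]]_3 -> 'M[R[i]]_n).

(* Continuous homomorphism SU(3) -> GL(n, C); p is irrelevant off SU(3). *)
Definition representation : Prop :=
  [/\ p 1%:M = 1%:M,
      (forall g h, SU3 g -> SU3 h -> p (g *m h) = p g *m p h)
    & {within @SU3 R, continuous p}].

Definition irreducible : Prop :=
  (0 < n)%N /\
  forall V : {vspace 'cV[R[i]]_n},
    (forall g v, SU3 g -> v \in V -> p g *m v \in V) ->
    V = 0%VS \/ V = fullv.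

Definition has_weight (l : functional) : Prop :=
  it_dual l /\
  exists v : 'cV[R[i]]_n, v != 0 /\
    forall H : Lie T, p (expmx (\val H)) *m v = cexp (l H) *: v.

(* Every weight is obtained from the highest one by subtracting a sum of
   positive roots. *)
Definition highest_weight (a : 'I_3 -> functional) (mu : functional) : Prop :=
  has_weight mu /\
  forall l, has_weight l ->
    exists k : 'I_3 -> nat,
      mu = ladd l (fun H => \sum_(i < 3) (k i)%:R * a i H).

Definition chi (H : Lie T) : R[i] := \tr (p (expmx (\val H))).

End Representations.

End Weights.

(* Main.v *)
(* The three roots of SU(3) are treated through the Dynkin coordinates (p, q) of
   mu + rho. By Schur's lemma the Casimir operator, which is built from the
   differential of the representation, is a scalar. Its trace against functions
   of the weights shows that the product of the character and the Weyl
   denominator is carried by the points y with a fixed value of |y|^2; since this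
   product changes sign under the simple reflections and all weights lie below mu,
   it is m times the alternating sum over the orbit of mu + rho, where m is the
   multiplicity of mu (this is the Weyl character formula up to the value of m).

   For each positive root, pairing the six terms of the alternating sum by the
   corresponding reflection bounds the sum by 4 (p + q) |sin|, where sin is the
   factor of that root in the Weyl denominator. Hence |chi| times the product of
   the other two sines is at most m (p + q) / 2. Comparing both sides of the
   character formula at the point 2 / (p + q) of the diagonal gives
   m p q (p + q) <= 128 d, so that |chi| times any two of the sines is at most
   64 d / (p q). Finally the inner product is a multiple b of the standard one, and
   then the product of the extreme values of <mu + rho, alpha> is at most
   18 b^2 p q. *)
Require Import Defs.
From mathcomp Require Import all_boot all_order all_algebra.
From mathcomp Require Import fingroup perm complex spectral separable cyclotomic.
From mathcomp Require Import all_classical all_reals all_analysis.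
From mathcomp Require Import ring lra.
Import Order.TTheory GRing.Theory Num.Theory.
Import numFieldNormedType.Exports.
Set Implicit Arguments.
Unset Strict Implicit.
Unset Printing Implicit Defensive.
Local Open Scope classical_set_scope.
Local Open Scope ring_scope.
Local Open Scope complex_scope.

(** * Matrix norms and convergence at rate 1/k *)

(** Every derivative below is taken along a sequence [g k] in SU(3) for which [k.+1 *: (g k - 1)]
    converges at rate 1/k. For the differential to depend only on the limit, the representation must
    be Lipschitz. This holds because every element of SU(3) is conjugate to a diagonal one whose
    angles are controlled by its distance to 1, and on the diagonal torus the representation is
    given by explicit characters.

    A function of the weights enters as a diagonal matrix, which passes a root vector up to a shift
    of its argument. The Weyl denominator is divisible by 1 - e^(-alpha) for every positive root
    alpha, so the traces taken against it telescope and the Casimir operator yields an eigenvalue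
    equation.

    The factor m occurs linearly both in the bound for the character and in the lower bound for d,
    so it cancels, and 64 is 128 / 2. One sine may vanish at a non-central point, so the
    cancellation of the omitted sine needs a perturbation there. Both extreme values of the inner
    product scale with b, whence b^2 in the final constant. *)

Section MatrixNorm.
Variable R : realType.
Local Notation nz := (@Normc.normc R).

Lemma normc_ge0 (z : R[i]) : 0 <= nz z.
Proof. by case: z => a b; exact: sqrtr_ge0. Qed.

Lemma normc_Re (z : R[i]) : `|complex.Re z| <= nz z.
Proof.
case: z => a b /=; rewrite -sqrtr_sqr ler_sqrt ?addr_ge0 ?sqr_ge0//.
by rewrite lerDl sqr_ge0.
Qed.

Lemma normc_Im (z : R[i]) : `|complex.Im z| <= nz z.
Proof.
case: z => a b /=; rewrite -sqrtr_sqr ler_sqrt ?addr_ge0 ?sqr_ge0//.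
by rewrite lerDr sqr_ge0.
Qed.

Lemma normc_le_ReIm (z : R[i]) : nz z <= `|complex.Re z| + `|complex.Im z|.
Proof.
case: z => a b /=.
rewrite -[leRHS]ger0_norm ?addr_ge0// -sqrtr_sqr ler_sqrt ?sqr_ge0//.
rewrite sqrrD !real_normK ?num_real// addrAC lerDl.
by rewrite mulrn_wge0// mulr_ge0.
Qed.

Lemma normc_real (x : R) : nz x%:C = `|x|.
Proof. by rewrite /= expr0n /= addr0 sqrtr_sqr. Qed.

Lemma normcX (z : R[i]) k : nz (z ^+ k) = nz z ^+ k.
Proof.
by elim: k => [|k IH]; rewrite ?expr0 ?Normc.normc1// !exprS Normc.normcM IH.
Qed.

Lemma normc_sqr (z : R[i]) : (nz z ^+ 2)%:C = z * z^*%C.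
Proof. by rewrite -sqr_normc normc_def; case: z => a b /=; rewrite -rmorphXn. Qed.

Lemma le_normc_sum (I : Type) (s : seq I) (P : pred I) (F : I -> R[i]) :
  nz (\sum_(i <- s | P i) F i) <= \sum_(i <- s | P i) nz (F i).
Proof.
elim/big_ind2: _ => [|x a y b hx hy|//]; first by rewrite Normc.normc0.
by rewrite (le_trans (le_normcD _ _))// lerD.
Qed.

Lemma mxB_E m n (A B : 'M[R[i]]_(m, n)) i j : (A - B) i j = A i j - B i j.
Proof. by rewrite 2!mxE. Qed.

(** The entrywise l1 norm is submultiplicative, also for rectangular matrices. The identity has norm
    n rather than 1, which explains several factors [n%:R] below. *)
Definition mxnorm1 m n (A : 'M[R[i]]_(m, n)) : R := \sum_i \sum_j nz (A i j).
Local Notation N := mxnorm1.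

Lemma mxnorm1_ge0 m n (A : 'M[R[i]]_(m, n)) : 0 <= N A.
Proof. by do 2 (apply: sumr_ge0 => ? _); exact: normc_ge0. Qed.

Lemma normc_le_mxnorm1 m n (A : 'M[R[i]]_(m, n)) i j : nz (A i j) <= N A.
Proof.
rewrite /N (bigD1 i)//= (bigD1 j)//= -addrA lerDl addr_ge0//.
  by apply: sumr_ge0 => k _; exact: normc_ge0.
by do 2 (apply: sumr_ge0 => ? _); exact: normc_ge0.
Qed.

Lemma mxnorm1_0 m n : N (0 : 'M[R[i]]_(m, n)) = 0.
Proof.
rewrite /N big1// => i _; rewrite big1// => j _.
by rewrite mxE Normc.normc0.
Qed.

Lemma mxnorm1_eq0 m n (A : 'M[R[i]]_(m, n)) : N A <= 0 -> A = 0.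
Proof.
move=> h; apply/matrixP => i j; rewrite mxE.
apply: Normc.eq0_normc; apply/eqP; rewrite eq_le normc_ge0 andbT.
exact: le_trans (normc_le_mxnorm1 _ _ _) h.
Qed.

Lemma mxnorm1D m n (A B : 'M[R[i]]_(m, n)) : N (A + B) <= N A + N B.
Proof.
rewrite /N -big_split/= ler_sum// => i _; rewrite -big_split/= ler_sum// => j _.
by rewrite mxE le_normcD.
Qed.

Lemma mxnorm1N m n (A : 'M[R[i]]_(m, n)) : N (- A) = N A.
Proof. by do 2 (apply: eq_bigr => ? _); rewrite mxE normcN. Qed.

Lemma mxnorm1_distC m n (A B : 'M[R[i]]_(m, n)) : N (A - B) = N (B - A).
Proof. by rewrite -mxnorm1N opprB. Qed.

Lemma mxnorm1Z m n (z : R[i]) (A : 'M[R[i]]_(m, n)) : N (z *: A) = nz z * N A.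
Proof.
rewrite /N mulr_sumr; apply: eq_bigr => i _; rewrite mulr_sumr.
by apply: eq_bigr => j _; rewrite mxE Normc.normcM.
Qed.

Lemma mxnorm1_sum m n (I : Type) (s : seq I) (P : pred I) (F : I -> 'M[R[i]]_(m, n)) :
  N (\sum_(i <- s | P i) F i) <= \sum_(i <- s | P i) N (F i).
Proof.
elim/big_ind2: _ => [|x a y b hx hy|//]; first by rewrite mxnorm1_0.
by rewrite (le_trans (mxnorm1D _ _))// lerD.
Qed.

Lemma mxnorm1M m n p (A : 'M[R[i]]_(m, n)) (B : 'M[R[i]]_(n, p)) :
  N (A *m B) <= N A * N B.
Proof.
rewrite {2}/N mulr_suml {1}/N ler_sum// => i _.
rewrite mulr_suml.
apply: le_trans (_ : \sum_j \sum_k nz (A i k) * nz (B k j) <= _).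
  rewrite ler_sum// => j _; rewrite mxE (le_trans (le_normc_sum _ _ _))//.
  by rewrite ler_sum// => k _; rewrite Normc.normcM.
rewrite exchange_big/= ler_sum// => k _; rewrite -mulr_sumr.
rewrite ler_wpM2l ?normc_ge0// /N (bigD1 k)//= lerDl.
by do 2 (apply: sumr_ge0 => ? _); exact: normc_ge0.
Qed.

Lemma mxnorm1_1 n : N (1%:M : 'M[R[i]]_n) = n%:R.
Proof.
rewrite /N (eq_bigr (fun=> 1)) ?sumr_const ?card_ord// => i _.
rewrite (bigD1 i)//= big1 ?addr0 => [|j ji]; rewrite mxE ?eqxx ?Normc.normc1//.
by rewrite eq_sym (negbTE ji) Normc.normc0.
Qed.

Lemma mxnorm1_diag n (d : 'rV[R[i]]_n) : N (diag_mx d) = \sum_i nz (d 0 i).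
Proof.
apply: eq_bigr => i _; rewrite (bigD1 i)//= big1 ?addr0 => [|j ji]; rewrite !mxE.
  by rewrite eqxx.
by rewrite eq_sym (negbTE ji) Normc.normc0.
Qed.

(* Convergence of matrix sequences at rate O(1/k): all limits below are
   derivatives of smooth curves, so a rate is always available, and it turns
   limit arguments into inequalities. *)
Definition approx m n (u : nat -> 'M[R[i]]_(m, n)) (A : 'M[R[i]]_(m, n)) :=
  exists C : R, forall k, N (u k - A) <= C / k.+1%:R.

Lemma approx_cst m n (A : 'M[R[i]]_(m, n)) : approx (fun=> A) A.
Proof. by exists 0 => k; rewrite subrr mxnorm1_0 mul0r. Qed.

Lemma approxD m n (u v : nat -> 'M[R[i]]_(m, n)) A B :
  approx u A -> approx v B -> approx (fun k => u k + v k) (A + B).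
Proof.
move=> [C hC] [D hD]; exists (C + D) => k.
rewrite opprD addrACA (le_trans (mxnorm1D _ _))// mulrDl lerD//.
Qed.

Lemma approxN m n (u : nat -> 'M[R[i]]_(m, n)) A :
  approx u A -> approx (fun k => - u k) (- A).
Proof. by move=> [C hC]; exists C => k; rewrite -opprD mxnorm1N. Qed.

Lemma approxB m n (u v : nat -> 'M[R[i]]_(m, n)) A B :
  approx u A -> approx v B -> approx (fun k => u k - v k) (A - B).
Proof. by move=> hu hv; apply: approxD => //; exact: approxN. Qed.

Lemma approx_bounded m n (u : nat -> 'M[R[i]]_(m, n)) A : approx u A ->
  exists2 B : R, 0 <= B & forall k, N (u k) <= B.
Proof.
move=> [C hC]; have C0 : 0 <= C.
  by have := le_trans (mxnorm1_ge0 _) (hC 0%N); rewrite divr1.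
exists (C + N A) => [|k]; first by rewrite addr_ge0// mxnorm1_ge0.
rewrite -{1}(subrK A (u k)) (le_trans (mxnorm1D _ _))// lerD2r.
by rewrite (le_trans (hC k))// ler_pdivrMr// ler_peMr// ler1n.
Qed.

Lemma approxM m n p (u : nat -> 'M[R[i]]_(m, n)) (v : nat -> 'M[R[i]]_(n, p)) A B :
  approx u A -> approx v B -> approx (fun k => u k *m v k) (A *m B).
Proof.
move=> hu [D hD]; have [b b0 hb] := approx_bounded hu; case: hu => C hC.
exists (b * D + C * N B) => k.
rewrite -(subrK (u k *m B) (_ *m _)) -addrA -mulmxBr -mulmxBl mulrDl.
rewrite (le_trans (mxnorm1D _ _))// lerD// (le_trans (mxnorm1M _ _))//.
  by rewrite -mulrA ler_pM ?mxnorm1_ge0.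
by rewrite mulrAC ler_wpM2r ?mxnorm1_ge0.
Qed.

(** The archimedean property. It turns bounds with rate 1/k into exact inequalities and stands in
    for passages to the limit. *)
Lemma le_inv_nat_le0 (x C : R) : (forall k, x <= C / k.+1%:R) -> x <= 0.
Proof.
move=> h; rewrite leNgt; apply/negP => x0.
have [k /= hk] : exists k, C / x < k%:R.
  exists (Num.bound `|C / x|); rewrite (le_lt_trans (ler_norm _))//.
  exact: archi_boundP.
have := h k; rewrite ler_pdivlMr// leNgt => /negP; apply.
rewrite ltr_pdivrMr// mulrC in hk.
by rewrite (lt_le_trans hk)// ler_pM2l// ler_nat.
Qed.

Lemma approx_uniq m n (u : nat -> 'M[R[i]]_(m, n)) A B :
  approx u A -> approx u B -> A = B.
Proof.
move=> [C hC] [D hD]; apply/eqP; rewrite -subr_eq0; apply/eqP.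
apply: mxnorm1_eq0; apply: (@le_inv_nat_le0 _ (C + D)) => k.
rewrite -(subrK (u k) A) -addrA (le_trans (mxnorm1D _ _))// mulrDl lerD//.
by rewrite mxnorm1_distC.
Qed.

Lemma eq_approx m n (u v : nat -> 'M[R[i]]_(m, n)) A :
  u =1 v -> approx u A -> approx v A.
Proof. by move=> uv [C hC]; exists C => k; rewrite -uv. Qed.

Lemma approx_close m n (u v : nat -> 'M[R[i]]_(m, n)) A :
  approx u A -> approx (fun k => v k - u k) 0 -> approx v A.
Proof.
move=> hu hv; have := approxD hv hu; rewrite add0r; apply: eq_approx => k.
by rewrite subrK.
Qed.

End MatrixNorm.

(** * The unit circle *)

Section UnitCircle.
Variable R : realType.
Implicit Types x y h : R.
Local Notation nz := (@Normc.normc R).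

Lemma sin_mean_value h : 0 <= h -> exists2 c, 0 <= c <= h & sin h = cos c * h.
Proof.
move=> h0; have [] := @MVT_segment R sin cos 0 h h0.
  by apply: continuous_subspaceT => x; exact: continuous_sin.
by move=> c; rewrite in_itv/= sin0 !subr0 => hc ->; exists c.
Qed.

Lemma sin_le_id h : 0 <= h -> `|sin h| <= h.
Proof.
move=> h0; have [c _ ->] := sin_mean_value h0.
by rewrite normrM (ger0_norm h0) ler_piMl// cos_max.
Qed.

Lemma norm_sin_le h : `|sin h| <= `|h|.
Proof.
have [/sin_le_id|h0] := leP 0 h; first by move=> H; rewrite (le_trans H)// ler_norm.
rewrite -[h]opprK sinN !normrN (le_trans (sin_le_id _))//.
  by rewrite oppr_ge0 ltW.
by rewrite ltr0_norm.
Qed.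

Lemma cos_half_sqr h : cos h = 1 - 2 * sin (h / 2) ^+ 2.
Proof.
rewrite {1}(_ : h = (h / 2) *+ 2); last by rewrite -mulr_natr -mulrA mulVf ?mulr1.
rewrite cos_mulr2n cos2sin2; ring.
Qed.

Lemma cos_ge h : 1 - h ^+ 2 / 2 <= cos h.
Proof.
rewrite cos_half_sqr lerD2l lerN2.
have : `|sin (h / 2)| ^+ 2 <= `|h / 2| ^+ 2.
  by rewrite ler_pXn2r ?nnegrE// norm_sin_le.
by rewrite !real_normK ?num_real// => H; nra.
Qed.

(** By the mean value theorem the difference is [(cos c - 1) * h]; the quadratic bound on the cosine
    serves for [h <= 1] and the trivial bound 2 beyond. An error of order [h ^+ 2] is what a rate
    1/k requires. *)
Lemma sin_sub_le h : `|sin h - h| <= 2 * h ^+ 2.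
Proof.
wlog h0 : h / 0 <= h.
  move=> H; have [/H//|h0] := leP 0 h.
  have := H (- h); rewrite sinN -opprD normrN sqrrN; apply.
  by rewrite oppr_ge0 ltW.
have [c /andP[c0 ch] ->] := sin_mean_value h0.
rewrite -{2}[h]mul1r -mulrBl normrM (ger0_norm h0) expr2 mulrA.
rewrite ler_wpM2r//.
have [h1|h1] := leP h 1.
  rewrite ler0_norm ?subr_le0 ?cos_le1//.
  by have := cos_ge c; nra.
rewrite (le_trans (ler_normB _ _))// normr1 (le_trans (lerD (cos_max c) (lexx 1)))//.
by nra.
Qed.

Lemma sin1_ge : 2^-1 <= sin (1 : R).
Proof.
have := sin_sub_le (1 : R).
have [c /andP[c0 ch] ->] := sin_mean_value (@ler01 R).
by move=> _; have := cos_ge c; nra.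
Qed.

(* The constant 1 / 4 is not optimal; any positive one would do. *)
Lemma sin_ge_quarter h : 0 <= h <= pi / 2 -> h / 4 <= sin h.
Proof.
move=> /andP[h0 hpi].
have pi4 : pi / 2 <= 2 :> R by have [/andP[]] := pihalf_02_cos_pihalf R.
have [h1|h1] := leP h 1.
  have [c /andP[c0 ch] ->] := sin_mean_value h0.
  by have := cos_ge c; nra.
have : sin 1 < sin h.
  rewrite ltr_sin//; rewrite in_itv/=; apply/andP; split=> //.
  - by have := pi_gt0 R; lra.
  - by rewrite (le_trans (ltW h1)).
  - by have := pi_gt0 R; lra.
by have := sin1_ge; lra.
Qed.

Definition cis h : R[i] := cos h +i* sin h.

Lemma cis0 : cis 0 = 1.
Proof. by rewrite /cis cos0 sin0. Qed.

Lemma cisD x y : cis (x + y) = cis x * cis y.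
Proof.
rewrite /cis cosD sinD; apply/eqP; rewrite eq_complex/=.
by rewrite eqxx/= addrC eqxx.
Qed.

Lemma cisN x : cis (- x) = (cis x)^*%C.
Proof. by rewrite /cis cosN sinN. Qed.

Lemma cisNK x : cis (- x) * cis x = 1.
Proof. by rewrite -cisD addNr cis0. Qed.

Lemma normc_cis x : nz (cis x) = 1.
Proof. by rewrite /= cos2Dsin2 sqrtr1. Qed.

Lemma cis_neq0 x : cis x != 0.
Proof.
by apply/eqP => h; have := normc_cis x; rewrite h Normc.normc0 => /esym/eqP; rewrite oner_eq0.
Qed.

Lemma cis2pi : cis (pi *+ 2) = 1.
Proof. by rewrite /cis cos2pi sin2pi. Qed.

Lemma cisX x k : cis x ^+ k = cis (x *+ k).
Proof. by elim: k => [|k IH]; rewrite ?expr0 ?mulr0n ?cis0// exprS IH mulrS cisD. Qed.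

Lemma cexp_cis x : cexp (0 +i* x) = cis x.
Proof. by rewrite /cexp /= expR0 mul1r. Qed.

Lemma normc_cis_sub1 x : nz (cis x - 1) = 2 * `|sin (x / 2)|.
Proof.
rewrite /cis /=; apply/eqP; rewrite -(@eqrXn2 _ 2) ?sqrtr_ge0 ?mulr_ge0//.
rewrite sqr_sqrtr ?addr_ge0 ?sqr_ge0// exprMn real_normK ?num_real//.
rewrite oppr0 addr0 sin2cos2 cos_half_sqr; apply/eqP; ring.
Qed.

Lemma normc_cisB x y : nz (cis x - cis y) = 2 * `|sin ((x - y) / 2)|.
Proof.
rewrite -normc_cis_sub1 -[in RHS](mulr1 (nz _)) -(normc_cis y) -Normc.normcM.
by rewrite mulrBl -cisD subrK mul1r.
Qed.

Lemma normc_cis_sub1_le x : nz (cis x - 1) <= `|x|.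
Proof.
rewrite normc_cis_sub1; have := norm_sin_le (x / 2).
by rewrite normrM (@ger0_norm _ 2^-1)// => H; lra.
Qed.

(** The angle is [acos] of the real part, up to sign. Its control by the distance to 1 holds since
    [z - 1] has modulus [2 * |sin (x / 2)|] with [|x| / 2 <= pi / 2]; the Lipschitz bound for
    representations starts from this 4. *)
Lemma unit_complex_cis (z : R[i]) : nz z = 1 ->
  exists2 x, z = cis x & `|x| <= pi /\ `|x| <= 4 * nz (z - 1).
Proof.
move=> z1.
suff [x zx xpi] : exists2 x, z = cis x & `|x| <= pi.
  exists x => //; split=> //; rewrite zx normc_cis_sub1.
  have -> : `|sin (x / 2)| = `|sin (`|x| / 2)|.
    have [x0|x0] := leP 0 x; first by rewrite (ger0_norm x0).
    by rewrite (ltr0_norm x0) mulNr sinN normrN.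
  have : `|x| / 2 / 4 <= sin (`|x| / 2).
    by apply: sin_ge_quarter; rewrite divr_ge0//= ler_pM2r.
  have := ler_norm (sin (`|x| / 2)); lra.
case: z z1 => a b z1.
have ab : a ^+ 2 + b ^+ 2 = 1.
  by move: z1 => /= /(congr1 (fun u => u ^+ 2)); rewrite sqr_sqrtr ?expr1n ?addr_ge0 ?sqr_ge0.
have aI : -1 <= a <= 1 by have := sqr_ge0 b; apply: contraTT => h; rewrite -ltNge; nra.
have [/andP[c0 cpi] ca] := acos_def aI.
have sb : sin (acos a) ^+ 2 = b ^+ 2 by rewrite sin2cos2 ca -ab addrC addKr.
have := eqf_sqr (sin (acos a)) b; rewrite sb eqxx => /esym/orP[]/eqP hb.
  by exists (acos a); rewrite /cis ?ca ?hb// ger0_norm.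
by exists (- acos a); rewrite /cis ?cosN ?sinN ?ca ?hb ?opprK// normrN ger0_norm.
Qed.

(** Induction with the addition formula. This is the estimate applied to each pair of terms in the
    alternating sum. *)
Lemma norm_sinM_nat k x : `|sin (k%:R * x)| <= k%:R * `|sin x|.
Proof.
elim: k => [|k IH]; first by rewrite !mul0r sin0 normr0.
rewrite -natr1 !mulrDl !mul1r sinD (le_trans (ler_normD _ _))// lerD//.
  by rewrite normrM (le_trans _ IH)// ler_piMr// cos_max.
by rewrite normrM ler_piMl// cos_max.
Qed.

Lemma cis_approx x :
  exists C, forall k, nz (k.+1%:R * (cis (x / k.+1%:R) - 1) - (0 +i* x)) <= C / k.+1%:R.
Proof.
exists (3 * x ^+ 2) => k; set K : R := k.+1%:R.
have K0 : 0 < K by rewrite ltr0n.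
have -> : (k.+1%:R : R[i]) = K%:C by rewrite /K rmorph_nat.
set h := x / K; have xh : x = K * h by rewrite /h mulrCA divff ?mulr1// gt_eqF.
have -> : K%:C * (cis h - 1) - (0 +i* x) = K%:C * ((cos h - 1) +i* (sin h - h)).
  by rewrite xh /cis; apply/eqP; rewrite eq_complex/=; apply/andP; split; apply/eqP; ring.
rewrite Normc.normcM normc_real (ger0_norm (ltW K0)).
have -> : 3 * x ^+ 2 / K = K * (3 * h ^+ 2) by rewrite xh; field; rewrite gt_eqF.
rewrite ler_pM2l// (le_trans (normc_le_ReIm _))//=.
have := sin_sub_le h; have := cos_ge h; have := cos_le1 h.
rewrite -subr_le0 => c1; rewrite (ler0_norm c1); nra.
Qed.

End UnitCircle.

(** * The diagonal torus of SU(3) *)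

Section SpecialUnitary.
Variable R : realType.
Local Notation nz := (@Normc.normc R).
Local Notation N := (@mxnorm1 R _ _).
Local Notation M3 := 'M[R[i]]_3.
Local Notation adj A := ((A ^t* )%sesqui).

Definition row3 (x y z : R[i]) : 'rV[R[i]]_3 := \row_j [:: x; y; z]`_j.

Lemma sum_ord3 (V : nmodType) (F : 'I_3 -> V) : \sum_i F i = F 0 + F 1 + F 2%:R.
Proof.
rewrite !big_ord_recl big_ord0 addr0 addrA.
by congr (_ + _ + _); congr F; exact: val_inj.
Qed.

Lemma row3E (d : 'rV[R[i]]_3) : d = row3 (d 0 0) (d 0 1) (d 0 (2%:R)).
Proof.
apply/rowP => j; rewrite mxE.
by case: j => [[|[|[|//]]] h] /=; congr (d _ _); apply: val_inj.
Qed.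

Lemma mulmx_diag_row3 x y z x' y' z' :
  diag_mx (row3 x y z) *m diag_mx (row3 x' y' z') =
  diag_mx (row3 (x * x') (y * y') (z * z')) :> M3.
Proof.
rewrite mulmx_diag; congr diag_mx; apply/rowP => j; rewrite !mxE.
by case: j => [[|[|[|//]]] h].
Qed.

Lemma diag_row3_1 : diag_mx (row3 1 1 1) = 1%:M :> M3.
Proof.
rewrite -diag_const_mx; congr diag_mx; apply/rowP => j; rewrite !mxE.
by case: j => [[|[|[|//]]] h].
Qed.

Lemma det_diag_row3 x y z : \det (diag_mx (row3 x y z)) = x * y * z.
Proof. by rewrite det_diag !big_ord_recl big_ord0 !mxE/= mulr1 mulrA. Qed.

Lemma trace_diag_row3 x y z : \tr (diag_mx (row3 x y z)) = x + y + z.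
Proof. by rewrite mxtrace_diag !big_ord_recl big_ord0 !mxE/= addr0 addrA. Qed.

Lemma mxnorm1_diag_row3 x y z : N (diag_mx (row3 x y z)) = nz x + nz y + nz z.
Proof. by rewrite mxnorm1_diag !big_ord_recl big_ord0 !mxE/= addr0 addrA. Qed.

Lemma adj_diag_row3 x y z : adj (diag_mx (row3 x y z)) =
  diag_mx (row3 x^*%C y^*%C z^*%C).
Proof.
apply/matrixP => i j; rewrite !mxE eq_sym; case: (eqVneq i j) => [->|_].
  rewrite !mulr1n; case: j => [[|[|[|//]]] h] //.
by rewrite !mulr0n rmorph0.
Qed.

Lemma adjM m n p (A : 'M[R[i]]_(m, n)) (B : 'M[R[i]]_(n, p)) :
  adj (A *m B) = adj B *m adj A.
Proof. by rewrite trmx_mul map_mxM. Qed.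

Lemma adjK m n (A : 'M[R[i]]_(m, n)) : adj (adj A) = A.
Proof. by apply/matrixP => i j; rewrite !mxE conjCK. Qed.

Lemma SU3_1 : @SU3 R 1%:M.
Proof. by split; [apply/unitarymxP; rewrite trmx1 map_mx1 mulmx1 | rewrite det1]. Qed.

Lemma SU3_M (g h : M3) : SU3 g -> SU3 h -> SU3 (g *m h).
Proof. move=> [gu gd] [hu hd]; split; first exact: mul_unitarymx.
by rewrite det_mulmx gd hd mulr1. Qed.

Lemma SU3_unit (g : M3) : SU3 g -> g \in unitmx.
Proof. by case=> /unitarymx_unit. Qed.

Lemma SU3_V (g : M3) : SU3 g -> SU3 (invmx g).
Proof.
move=> [gu gd]; split; first by rewrite (invmx_unitary gu) trmxC_unitary.
by rewrite det_inv gd invr1.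
Qed.

Lemma SU3_conj (u g : M3) : SU3 u -> SU3 g -> SU3 (u *m g *m invmx u).
Proof.
by move=> hu hg; exact: SU3_M (SU3_M hu hg) (SU3_V hu).
Qed.

Lemma SU3_X (g : M3) k : SU3 g -> SU3 (g ^+ k).
Proof. by move=> hg; elim: k => [|k IH]; [exact: SU3_1 | rewrite exprS; exact: SU3_M]. Qed.

Lemma SU3_adj (g : M3) : SU3 g -> adj g = invmx g.
Proof. by case=> gu _; rewrite (invmx_unitary gu). Qed.

Lemma SU3_mulmxV (g : M3) : SU3 g -> g *m invmx g = 1%:M.
Proof. by move=> /SU3_unit; exact: mulmxV. Qed.

Lemma SU3_mulVmx (g : M3) : SU3 g -> invmx g *m g = 1%:M.
Proof. by move=> /SU3_unit; exact: mulVmx. Qed.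

Lemma SU3_invM (g h : M3) : SU3 g -> SU3 h -> invmx (g *m h) = invmx h *m invmx g.
Proof.
move=> hg hh; have ghU := SU3_unit (SU3_M hg hh).
have e : g *m h *m (invmx h *m invmx g) = 1%:M.
  by rewrite mulmxA (mulmxK (SU3_unit hh)) (SU3_mulmxV hg).
by rewrite -[LHS]mulmx1 -e (mulKmx ghU).
Qed.

Lemma SU3_conjK (u A : M3) : SU3 u -> invmx u *m (u *m A *m invmx u) *m u = A.
Proof.
by move=> hu; rewrite !mulmxA (SU3_mulVmx hu) mul1mx -mulmxA (SU3_mulVmx hu) mulmx1.
Qed.

Lemma SU3_conjVK (u A : M3) : SU3 u -> u *m (invmx u *m A *m u) *m invmx u = A.
Proof.
by move=> hu; rewrite !mulmxA (SU3_mulmxV hu) mul1mx -mulmxA (SU3_mulmxV hu) mulmx1.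
Qed.

Lemma SU3_conjM (u A B : M3) : SU3 u ->
  u *m A *m invmx u *m (u *m B *m invmx u) = u *m (A *m B) *m invmx u.
Proof. by move=> hu; rewrite !mulmxA (mulmxKV (SU3_unit hu)). Qed.

(** Rows are unit vectors, so each of the nine entries has modulus at most 1. Conjugation then costs
    the factor 81. *)
Lemma unitary_norm (g : M3) : g \is unitarymx -> N g <= 9.
Proof.
move=> /unitarymxP gg; rewrite /mxnorm1.
apply: le_trans (_ : \sum_(i < 3) \sum_(j < 3) 1 <= _); last first.
  by rewrite !sumr_const card_ord -mulrnA.
apply: ler_sum => i _; apply: ler_sum => j _.
have /matrixP/(_ i i) := gg; rewrite !mxE eqxx mulr1n => h.
have {}h : \sum_j (nz (g i j)) ^+ 2 = 1.
  apply: complexI; rewrite rmorph_sum -[RHS]h; apply: eq_bigr => k _.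
  by rewrite !mxE -normc_sqr.
rewrite -(@expr_le1 _ 2) ?normc_ge0// -h (bigD1 j)//= lerDl.
by apply: sumr_ge0 => k _; exact: sqr_ge0.
Qed.

Lemma SU3_norm (g : M3) : SU3 g -> N g <= 9.
Proof. by case=> /unitary_norm. Qed.

Lemma SU3_conj_norm (g A : M3) : SU3 g -> N (g *m A *m invmx g) <= 81 * N A.
Proof.
move=> hg; rewrite (le_trans (mxnorm1M _ _))//.
have h1 := SU3_norm hg; have h2 := SU3_norm (SU3_V hg).
rewrite (_ : 81 = 9 * 9); last by rewrite -natrM.
rewrite mulrAC; apply: ler_pM => //; try exact: mxnorm1_ge0.
by rewrite (le_trans (mxnorm1M _ _))// ler_pM ?mxnorm1_ge0.
Qed.

(* The one-parameter subgroups of the simple coroots: [tor s 0] and [tor 0 t]. *)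
Definition tor (s t : R) : M3 := diag_mx (row3 (cis s) (cis (t - s)) (cis (- t))).

Definition ltor (s t : R) : M3 := diag_mx (row3 (0 +i* s) (0 +i* (t - s)) (0 +i* - t)).

Lemma torD s t s' t' : tor (s + s') (t + t') = tor s t *m tor s' t'.
Proof. by rewrite /tor mulmx_diag_row3 -!cisD opprD addrACA -opprD. Qed.

Lemma tor0 : tor 0 0 = 1%:M.
Proof. by rewrite /tor subr0 oppr0 cis0 diag_row3_1. Qed.

Lemma tor_SU3 s t : SU3 (tor s t).
Proof.
split; last by rewrite det_diag_row3 -!cisD -cis0; congr cis; ring.
apply/unitarymxP; rewrite adj_diag_row3 mulmx_diag_row3 -!cisN -!cisD !subrr cis0.
exact: diag_row3_1.
Qed.

Lemma torV s t : invmx (tor s t) = tor (- s) (- t).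
Proof.
apply: (@row_full_inj _ _ _ _ (tor s t)); rewrite ?row_full_unit ?SU3_unit//; try exact: tor_SU3.
by rewrite SU3_mulmxV -?torD ?subrr ?tor0//; exact: tor_SU3.
Qed.

Lemma torX s t k : tor s t ^+ k = tor (s *+ k) (t *+ k).
Proof.
elim: k => [|k IH]; first by rewrite expr0 !mulr0n tor0.
by rewrite exprS IH !mulrS torD.
Qed.

Lemma tor_norm_sub1 s t : N (tor s t - 1%:M) <= 2 * (`|s| + `|t|).
Proof.
rewrite /tor -diag_row3_1 -raddfB /=.
have -> a b c a' b' c' : row3 a b c - row3 a' b' c' = row3 (a - a') (b - b') (c - c').
  by apply/rowP => j; rewrite !mxE; case: j => [[|[|[|//]]] h].
rewrite mxnorm1_diag_row3.
have := normc_cis_sub1_le s; have := normc_cis_sub1_le (t - s).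
have := normc_cis_sub1_le (- t); have := ler_normB t s; rewrite normrN; lra.
Qed.

Lemma tor_tangent s t :
  approx (fun k => k.+1%:R *: (tor (s / k.+1%:R) (t / k.+1%:R) - 1%:M)) (ltor s t).
Proof.
have [C hC] := cis_approx s; have [D hD] := cis_approx (t - s).
have [E hE] := cis_approx (- t); exists (C + D + E) => k.
rewrite /tor -diag_row3_1 -raddfB /= -linearZ /= -raddfB/=.
have -> a b c a' b' c' l a2 b2 c2 :
    l *: (row3 a b c - row3 a' b' c') - row3 a2 b2 c2 =
    row3 (l * (a - a') - a2) (l * (b - b') - b2) (l * (c - c') - c2).
  by apply/rowP => j; rewrite !mxE; case: j => [[|[|[|//]]] h].
rewrite mxnorm1_diag_row3 !mulrDl.
by have := hD k; have := hE k; rewrite mulrBl mulNr => h1 h2; rewrite !lerD.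
Qed.

Lemma diag_mx_diagonal n (D : 'M[R[i]]_n) : is_diag_mx D -> D = diag_mx (\row_j D j j).
Proof.
move=> /is_diag_mxP dD; apply/matrixP => i j; rewrite !mxE.
by case: (eqVneq i j) => [->//|ij]; rewrite dD.
Qed.

(** Dividing the first row by the determinant moves the unitary matrix into SU(3). The correction is
    diagonal, so it commutes with the diagonal matrices obtained by conjugation. *)
Lemma unitary_diag_SU3 (P : M3) : P \is unitarymx ->
  exists2 Q, SU3 Q & forall A, is_diag_mx (P *m A *m invmx P) ->
    is_diag_mx (Q *m A *m invmx Q).
Proof.
move=> Pu; have Punit := unitarymx_unit Pu.
have dP : \det P != 0 by rewrite -unitfE -unitmxE.
have dPu : \det P * (\det P)^*%C = 1.
  have /unitarymxP/(congr1 determinant) := Pu.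
  by rewrite det_mulmx det1 det_map_mx det_tr.
pose F := diag_mx (row3 (\det P)^-1 1 1).
have FS : SU3 (F *m P).
  split; last by rewrite det_mulmx det_diag_row3 !mulr1 mulVf.
  apply: mul_unitarymx; last exact: Pu.
  apply/unitarymxP.
  rewrite adj_diag_row3 mulmx_diag_row3.
  rewrite (_ : _ * _^*%C = 1) ?rmorph1 ?mulr1 ?diag_row3_1//.
  by rewrite conjc_inv -invfM dPu invr1.
exists (F *m P) => [|A]; first exact: FS.
have [D hD] : exists D, P *m A *m invmx P = D by exists (P *m A *m invmx P).
rewrite hD => dD.
have -> : F *m P *m A *m invmx (F *m P) = D.
  have PA : P *m A = D *m P by rewrite -hD; exact: esym (mulmxKV Punit _).
  have FD : F *m D = D *m F.
    by rewrite (diag_mx_diagonal dD); exact: diag_mxC.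
  rewrite -(mulmxA F P A) PA (mulmxA F D P) FD -(mulmxA D F P).
  exact: mulmxK (SU3_unit FS) D.
exact: dD.
Qed.

Lemma normal_diag (A : M3) : A \is normalmx ->
  exists u d, SU3 u /\ A = u *m diag_mx d *m invmx u.
Proof.
move=> /orthomx_spectralP /=; have := spectral_unitarymx A.
move: (spectralmx A) (spectral_diag A) => P sp Pu hA.
have Punit := unitarymx_unit Pu.
have [Q hQ QD] := unitary_diag_SU3 Pu.
have PA : P *m A *m invmx P = diag_mx sp.
  rewrite {1}hA -(mulmxA (invmx P)) mulKVmx//; exact: mulmxK.
have /QD/diag_mx_diagonal : is_diag_mx (P *m A *m invmx P).
  by rewrite PA; exact: diag_mx_is_diag.
move: (\row_j _) => d hd; exists (invmx Q), d; split; first exact: SU3_V.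
have -> : invmx (invmx Q) = Q by exact: invmxK.
rewrite -hd -(mulmxA Q) (mulmxA (invmx Q) Q) SU3_mulVmx// mul1mx.
exact: esym (mulmxKV (SU3_unit hQ) A).
Qed.

Definition su3 (X : M3) := adj X = - X /\ \tr X = 0.

Lemma diag_ltor d : su3 (diag_mx d) -> exists s t, diag_mx d = ltor s t.
Proof.
rewrite (row3E d); move: (d _ _) (d _ _) (d _ _) => x y z [].
rewrite adj_diag_row3 trace_diag_row3 => /matrixP h.
have := h 2%:R 2%:R; have := h 1 1; have := h 0 0; rewrite !mxE /= !mulr1n.
case: x y z {h} => [a b] [a' b'] [a2 b2] [e1] [e2] [e3] /eqP.
rewrite eq_complex /= => /andP[_ /eqP e4].
have [-> -> ->] : [/\ a = 0, a' = 0 & a2 = 0] by split; lra.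
have -> : b' = - b - b2 by lra.
by exists b2, (- b); rewrite /ltor opprK.
Qed.

Lemma su3_conj (u X : M3) : SU3 u -> su3 X -> su3 (u *m X *m invmx u).
Proof.
move=> hu [hX tX]; split; last by rewrite mxtrace_mulC mulmxA SU3_mulVmx// mul1mx.
by rewrite -(SU3_adj hu) !adjM adjK hX -!mulmxA mulNmx mulmxN.
Qed.

Lemma su3_diag (X : M3) : su3 X ->
  exists u s t, SU3 u /\ X = u *m ltor s t *m invmx u.
Proof.
move=> hX; have [|u [d [hu Xd]]] := @normal_diag X.
  by apply/normalmxP; rewrite hX.1 mulNmx mulmxN.
have : su3 (diag_mx d).
  have -> : diag_mx d = invmx u *m X *m invmx (invmx u).
    by rewrite Xd invmxK -!mulmxA SU3_mulVmx// mulmx1 mulmxA SU3_mulVmx// mul1mx.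
  by apply: su3_conj => //; exact: SU3_V.
by move=> /diag_ltor [s [t e]]; exists u, s, t; rewrite -e.
Qed.

(** The outer entries give the two angles, and the determinant fixes the middle entry. *)
Lemma SU3_diag_tor d : SU3 (diag_mx d) -> exists s t, [/\ diag_mx d = tor s t,
   `|s| <= pi /\ `|t| <= pi &
   `|s| <= 4 * N (diag_mx d - 1%:M) /\ `|t| <= 4 * N (diag_mx d - 1%:M)].
Proof.
rewrite (row3E d); move: (d _ _) (d _ _) (d _ _) => x y z [].
move=> /unitarymxP; rewrite adj_diag_row3 mulmx_diag_row3 det_diag_row3 => /matrixP hu' xyz.
have un w : w * w^*%C = 1 -> nz w = 1.
  move=> hw; have := normc_sqr w; rewrite hw => -[/eqP].
  by rewrite sqrp_eq1 ?normc_ge0// => /eqP.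
have := hu' 2%:R 2%:R; have := hu' 0 0; rewrite !mxE /= !mulr1n => /un x1 /un z1.
have [s xs [s1 s2]] := unit_complex_cis x1.
have [t zt [t1 t2]] := unit_complex_cis z1.
have ye : y = cis (- t - s).
  apply: (mulIf (cis_neq0 t)); apply: (mulfI (cis_neq0 s)).
  by rewrite -zt mulrA -xs xyz zt xs -!cisD -cis0; congr cis; ring.
exists s, (- t); rewrite !normrN; split=> //; first by rewrite /tor opprK xs zt ye.
split; [apply: le_trans s2 _ | apply: le_trans t2 _]; rewrite ler_pM2l//.
  have := normc_le_mxnorm1 (diag_mx (row3 z y x) - 1%:M) 0 0.
  by rewrite !mxE /= !mulr1n.
have := normc_le_mxnorm1 (diag_mx (row3 z y x) - 1%:M) 2%:R 2%:R.
by rewrite !mxE /= !mulr1n.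
Qed.

(** The spectral theorem with controlled angles: 324 is the 4 of the circle times the 81 lost in
    undoing the conjugation. *)
Lemma SU3_diag (g : M3) : SU3 g ->
  exists u s t, [/\ SU3 u, g = u *m tor s t *m invmx u,
   `|s| <= pi /\ `|t| <= pi &
   `|s| <= 324 * N (g - 1%:M) /\ `|t| <= 324 * N (g - 1%:M)].
Proof.
move=> hg; have [|u [d [hu gd]]] := @normal_diag g.
  by apply/normalmxP; rewrite SU3_adj// SU3_mulmxV// SU3_mulVmx.
have hd : diag_mx d = invmx u *m g *m u.
  by rewrite gd -!mulmxA SU3_mulVmx// mulmx1 mulmxA SU3_mulVmx// mul1mx.
have : SU3 (diag_mx d) by rewrite hd; apply: SU3_M => //; apply: SU3_M => //; exact: SU3_V.
have hN : N (diag_mx d - 1%:M) <= 81 * N (g - 1%:M).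
  rewrite hd; have -> : invmx u *m g *m u - 1%:M = invmx u *m (g - 1%:M) *m invmx (invmx u).
    by rewrite invmxK mulmxBr mulmxBl mulmx1 SU3_mulVmx.
  by apply: SU3_conj_norm; exact: SU3_V.
move=> /SU3_diag_tor[s [t [e hpi [h1 h2]]]]; exists u, s, t; split=> //.
  by rewrite gd e.
by split; lra.
Qed.

End SpecialUnitary.

(** * Weights of the diagonal torus *)

Section CircleCharacters.
Variable R : realType.
Local Notation nz := (@Normc.normc R).

Lemma truncn_approx (x d : R) : 0 <= x -> 0 < d ->
  exists m : nat, 0 <= x - d *+ m < d.
Proof.
move=> x0 d0; exists (Num.truncn (x / d)).
have /truncn_itv/andP[] : 0 <= x / d by rewrite divr_ge0// ltW.
rewrite ler_pdivlMr// ltr_pdivrMr// -natr1 mulrDl mul1r mulr_natl => h1 h2.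
by rewrite subr_ge0 h1 ltrBlDl.
Qed.

Lemma exists_div_lt (x d : R) : 0 < d -> exists k : nat, x / k.+1%:R < d.
Proof.
move=> d0; exists (Num.bound `|x / d|); rewrite ltr_pdivrMr// mulrC -ltr_pdivrMr//.
rewrite (le_lt_trans (ler_norm _))// (lt_le_trans (archi_boundP (normr_ge0 _)))//.
by rewrite ler_nat.
Qed.

Lemma exists_half_pow_lt (x d : R) : 0 <= x -> 0 < d -> exists j : nat, x / 2 ^+ j < d.
Proof.
move=> x0 d0; have [k hk] := exists_div_lt x d0; exists k.+1; apply: le_lt_trans hk.
rewrite ler_wpM2l// lef_pV2 ?posrE ?exprn_gt0 ?ltr0n// -natrX ler_nat.
exact/ltnW/ltn_expl.
Qed.

(** Along the halvings of a short arc [D] the value is determined by successive square roots,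
    closeness to 1 excluding the wrong sign; continuity then reaches all reals. The period is used
    to see that [c D] is a root of unity, hence of modulus 1. *)
Lemma circle_character (c : R -> R[i]) :
  {morph c : x y / x + y >-> x * y} -> c (pi *+ 2) = 1 ->
  (forall e, 0 < e -> exists2 d : R, 0 < d & forall x, `|x| < d -> nz (c x - 1) < e) ->
  exists p : R, forall x, c x = cis (p * x).
Proof.
move=> cD c2pi cc; have c2pi0 := c2pi.
have c0 : c 0 = 1.
  by have := cD (pi *+ 2) 0; rewrite addr0 c2pi mul1r => <-.
have cX x k : c (x *+ k) = c x ^+ k.
  by elim: k => [|k IH]; rewrite ?mulr0n ?expr0// mulrS exprS cD IH.
have [d d0 hd] := cc 4^-1 ltac:(by rewrite invr_gt0).
have [K hK] := exists_div_lt (pi *+ 2) d0.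
pose D : R := pi *+ 2 / K.+1%:R.
have D0 : 0 < D by rewrite divr_gt0// pmulrn_rgt0// pi_gt0.
have cD1 : nz (c D) = 1.
  apply/eqP; rewrite -(@pexpr_eq1 _ _ K.+1) ?normc_ge0// -normcX -cX -mulr_natr.
  by rewrite mulfVK ?pnatr_eq0// c2pi Normc.normc1.
have hD : nz (c D - 1) < 4^-1 by apply: hd; rewrite gtr0_norm.
have [f cf [_ f1]] := unit_complex_cis cD1.
have dy j : c (D / 2 ^+ j) = cis (f / 2 ^+ j).
  elim: j => [|j IH]; first by rewrite expr0 !divr1.
  have dbl (y : R) : y / 2 ^+ j = (y / 2 ^+ j.+1) *+ 2.
    by rewrite exprS -mulr_natr; field; rewrite expf_neq0.
  (* With the opposite sign the differences of the two numbers from 1 would add up to -2, although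
     their moduli are less than 1/4 and at most 1. *)
  move: IH; rewrite (dbl D) (dbl f) cX -cisX => /eqP; rewrite eqf_sqr => /orP[/eqP//|/eqP h].
  have h1 : nz (c (D / 2 ^+ j.+1) - 1) < 4^-1.
    apply: hd; rewrite gtr0_norm; last by rewrite divr_gt0 ?exprn_gt0.
    apply: le_lt_trans hK; rewrite -/D ler_pdivrMr ?exprn_gt0//.
    apply: ler_peMr; first exact: ltW.
    by apply: exprn_ege1; rewrite ler1n.
  have h2 : nz (cis (f / 2 ^+ j.+1) - 1) <= 1.
    rewrite (le_trans (normc_cis_sub1_le _))// normrM [X in _ * X]ger0_norm ?invr_ge0 ?exprn_ge0//.
    rewrite ler_pdivrMr ?exprn_gt0// mul1r (@le_trans _ _ 1)//; first by lra.
    by rewrite exprn_ege1// ler1n.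
  have := le_normcD (c (D / 2 ^+ j.+1) - 1) (cis (f / 2 ^+ j.+1) - 1).
  rewrite h addrACA addNr add0r -opprD normcN.
  have h3 : 2 <= nz (1 + 1).
    by have := normc_Re (1 + 1 : R[i]); rewrite [complex.Re _]/= ger0_norm ?addr_ge0.
  move=> h4; exfalso; move: h1 h2 h4 h3; rewrite h.
  by move: (nz _) (nz _) (nz _) => a b e; lra.
pose p := f / D; exists p => x.
(* The quotient by the expected exponential is 1 at all multiples of [D / 2 ^+ j], so its value
   anywhere equals its value at an arbitrarily small remainder. *)
pose h y := c y * cis (- (p * y)).
have hM : {morph h : y z / y + z >-> y * z}.
  by move=> y z; rewrite /h cD mulrDr opprD cisD mulrACA.
have hj j m : h ((D / 2 ^+ j) *+ m) = 1.
  have h0 : h 0 = 1 by rewrite /h c0 mulr0 oppr0 cis0 mulr1.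
  elim: m => [|m IH]; rewrite ?mulr0n// mulrS hM IH mulr1 /h dy /p.
  rewrite -cisD -[RHS]cis0; congr cis; field.
  by rewrite expf_neq0//= gt_eqF.
have pos y : 0 <= y -> h y = 1.
  move=> y0; apply/eqP; rewrite -subr_eq0; apply/eqP; apply: Normc.eq0_normc.
  apply/eqP; rewrite eq_le normc_ge0 andbT; apply/ler_addgt0Pr => e e0; rewrite add0r.
  have e20 : 0 < e / 2 by rewrite divr_gt0.
  have [d1 d10 hd1] := cc _ e20.
  have [k hk] := exists_div_lt (`|p| * 1) e20.
  have m0 : 0 < Num.min d1 k.+1%:R^-1 by rewrite lt_min d10 invr_gt0 ltr0n.
  have [j hj'] := exists_half_pow_lt (ltW D0) m0.
  have Dj : 0 < D / 2 ^+ j by rewrite divr_gt0 ?exprn_gt0.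
  have [m /andP[r0 r1]] := truncn_approx y0 Dj.
  have -> : h y = h (y - D / 2 ^+ j *+ m) by rewrite -[LHS](congr1 h (subrK (D / 2 ^+ j *+ m) y)) hM hj mulr1.
  set r := y - _ in r0 r1 *.
  have := lt_trans r1 hj'; rewrite lt_min => /andP[rd rk].
  rewrite (_ : h r - 1 = (c r - 1) * cis (- (p * r)) + (cis (- (p * r)) - 1)); last by rewrite /h; ring.
  rewrite (le_trans (le_normcD _ _))// Normc.normcM normc_cis mulr1 (splitr e) lerD//.
    by rewrite ltW// hd1// ger0_norm.
  rewrite (le_trans (normc_cis_sub1_le _))// normrN normrM (ger0_norm r0) (le_trans _ (ltW hk))//.
  by rewrite mulr1 ler_wpM2l// ltW.
have [x0|x0] := leP 0 x.
  have /(congr1 (fun z => z * cis (p * x))) := pos x x0.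
  by rewrite /h -mulrA cisNK mulr1 mul1r.
have : h x * h (- x) = 1 by rewrite -hM subrr; exact: pos.
rewrite (pos (- x)) ?oppr_ge0 ?ltW// mulr1 => /(congr1 (fun z => z * cis (p * x))).
by rewrite /h -mulrA cisNK mulr1 mul1r.
Qed.

End CircleCharacters.

(** * Simultaneous diagonalization of the torus in a representation *)

Section TorusWeights.
Variable R : realType.
Local Notation nz := (@Normc.normc R).
Local Notation N := (@mxnorm1 R _ _).
Local Notation M3 := 'M[R[i]]_3.

(** Take elements of [S] whose span has maximal dimension. This reduces an infinite commuting family
    to a finite one. *)
Lemma finite_span (F : fieldType) (V : vectType F) (S : V -> Prop) :
  exists fs : seq V, (forall x, x \in fs -> S x) /\ forall x, S x -> x \in <<fs>>%VS.
Proof.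
pose P k := `[< exists fs : seq V, (forall x, x \in fs -> S x) /\ \dim <<fs>> = k >].
have P0 : exists k, P k.
  by exists 0%N; apply/asboolP; exists [::]; split=> //; rewrite span_nil dimv0.
have Pmax k : P k -> (k <= \dim {:V})%N by move=> /asboolP[fs [_ <-]]; exact: dimvS (subvf _).
case: (ex_maxnP P0 Pmax) => k /asboolP[fs [fsS dk]] kmax; exists fs; split=> // x Sx.
apply: contraT => xfs.
have : P (\dim <<x :: fs>>).
  apply/asboolP; exists (x :: fs); split=> // y; rewrite inE => /predU1P[->//|]; exact: fsS.
move=> /kmax; rewrite -dk leqNgt => /negP; case.
rewrite (ltn_leqif (dimv_leqif_sup _)); last by apply/subvP => y hy; rewrite span_cons (subvP (addvSr _ _)).
apply: contra xfs => /subvP; apply; rewrite span_cons; exact: (subvP (addvSl _ _)) (memv_line _).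
Qed.

(** The minimal polynomial divides ['X^k - 1], which is separable in characteristic 0. *)
Lemma finite_order_diagonalizable n (A : 'M[R[i]]_n) k : (0 < k)%N -> A ^+ k = 1%:M ->
  exists2 P, P \in unitmx & similar_diag P A.
Proof.
case: n A => [|n] A k0 Ak.
  exists 1%:M; first exact: unitmx1.
  by apply/is_diag_mxP => -[].
apply/diagonalizableP.
have k00 : (k%:R : R[i]) != 0 by rewrite pnatr_eq0 -lt0n.
have := closed_field_poly_normal ('X^k - 1 : {poly R[i]}) => -[rs hrs].
have monX : 'X^k - 1 \is @monic R[i] by rewrite monicXnsubC.
exists rs.
  rewrite -separable_prod_XsubC; have := separable_Xn_sub_1 k00.
  by rewrite hrs (monicP monX) scale1r.
have -> : \prod_(x <- rs) ('X - x%:P) = 'X^k - 1 by rewrite [RHS]hrs (monicP monX) scale1r.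
apply: mxminpoly_min; rewrite rmorphB rmorphXn rmorph1/= horner_mx_X Ak.
by rewrite subrr.
Qed.

Variables (n : nat) (q : M3 -> 'M[R[i]]_n).
Hypothesis q1 : q 1%:M = 1%:M.
Hypothesis qM : forall g h, SU3 g -> SU3 h -> q (g *m h) = q g *m q h.
Hypothesis qc : forall e : R, 0 < e ->
  exists2 d : R, 0 < d & forall g, SU3 g -> N (g - 1%:M) < d -> N (q g - 1%:M) < e.

Lemma repX g k : SU3 g -> q (g ^+ k) = q g ^+ k.
Proof.
move=> hg; elim: k => [|k IH]; first by rewrite !expr0 q1.
by rewrite !exprS qM ?IH//; exact: SU3_X.
Qed.

Lemma mxnorm1X (A : 'M[R[i]]_n) b k : N A <= b -> N (A ^+ k) <= b ^+ k * n%:R.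
Proof.
move=> hA; have b0 : 0 <= b := le_trans (mxnorm1_ge0 _) hA.
elim: k => [|k IH]; first by rewrite expr0 mul1r -mxnorm1_1.
by rewrite exprS (le_trans (mxnorm1M _ _))// exprS -mulrA ler_pM ?mxnorm1_ge0.
Qed.

(** Every element is a power, with an exponent independent of it, of an element so close to 1 that
    its image is within 1 of the identity; hence the base [1 + n%:R]. *)
Lemma rep_bounded : exists2 B, 0 <= B & forall g, SU3 g -> N (q g) <= B.
Proof.
have [d d0 hd] := qc ltr01.
have [m hm] := exists_div_lt (81 * (2 * (pi + pi))) d0.
have b0 : (0 : R) <= 1 + n%:R by rewrite addr_ge0.
exists ((1 + n%:R) ^+ m.+1 * n%:R); first by rewrite mulr_ge0 ?exprn_ge0.
move=> g /SU3_diag[u [s [t [hu -> [hs ht] _]]]].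
pose h := tor (s / m.+1%:R) (t / m.+1%:R).
have hh : SU3 (u *m h *m invmx u) by apply: SU3_conj => //; exact: tor_SU3.
have hX k : (u *m h *m invmx u) ^+ k = u *m h ^+ k *m invmx u.
  elim: k => [|k IH]; first by rewrite !expr0 mulmx1 SU3_mulmxV.
  rewrite !exprS IH; rewrite -!mulmxE !mulmxA; congr (_ *m _ *m _).
  by rewrite -!mulmxA SU3_mulVmx// mulmx1.
have -> : tor s t = h ^+ m.+1.
  have sK (x : R) : x / m.+1%:R *+ m.+1 = x by rewrite -mulr_natr mulfVK// pnatr_eq0.
  by rewrite /h torX !sK.
rewrite -hX repX//; apply: mxnorm1X.
rewrite -[q _](subrK 1%:M) (le_trans (mxnorm1D _ _))// mxnorm1_1 lerD2r ltW// hd//.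
have -> : u *m h *m invmx u - 1%:M = u *m (h - 1%:M) *m invmx u.
  by rewrite mulmxBr mulmxBl mulmx1 SU3_mulmxV.
rewrite (le_lt_trans (SU3_conj_norm _ hu))// (le_lt_trans _ hm)// -mulrA ler_wpM2l//.
rewrite (le_trans (tor_norm_sub1 _ _))// -mulrA ler_wpM2l// mulrDl.
by rewrite !normrM (@ger0_norm _ (_^-1))// lerD// ler_wpM2r.
Qed.

Lemma tor_finite_order_dense (s t d : R) : 0 < d -> exists s' t' k,
  [/\ (0 < k)%N, tor s' t' ^+ k = 1%:M, `|s - s'| < d & `|t - t'| < d].
Proof.
move=> d0; have [k hk] := exists_div_lt (pi *+ 2) d0.
set D : R := _ / _ in hk; have D0 : 0 < D by rewrite divr_gt0// pmulrn_rgt0// pi_gt0.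
have Dk : D *+ k.+1 = pi *+ 2 by rewrite -mulr_natr mulfVK// pnatr_eq0.
have {hk}hk x : exists2 x', `|x - x'| < d & cis (x' *+ k.+1) = 1.
  have [x0|x0] := leP 0 x.
    have [m /andP[m0 m1]] := truncn_approx x0 D0; exists (D *+ m).
      by rewrite ger0_norm// (lt_trans m1).
    by rewrite mulrnAC Dk -cisX cis2pi expr1n.
  have [|m /andP[m0 m1]] := @truncn_approx R (- x) D _ D0; first by rewrite oppr_ge0 ltW.
  exists (- (D *+ m)); first by rewrite opprK -normrN opprD ger0_norm// (lt_trans m1).
  by rewrite mulNrn mulrnAC Dk cisN -cisX cis2pi expr1n rmorph1.
have [s' hs cs] := hk s; have [t' ht ct] := hk t.
exists s', t', k.+1; split=> //.
rewrite torX /tor cisD !cisN cs ct rmorph1 mulr1.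
exact: diag_row3_1.
Qed.

(** Torus elements of finite order have commuting diagonalizable images, so one basis serves all of
    them. They are dense, and continuity together with boundedness makes the off-diagonal entries
    vanish everywhere. *)
Lemma tor_rep_diag : exists2 P : 'M[R[i]]_n, P \in unitmx &
  forall s t, is_diag_mx (P *m q (tor s t) *m invmx P).
Proof.
pose S (A : 'M[R[i]]_n) := exists s t k, [/\ (0 < k)%N, tor s t ^+ k = 1%:M & A = q (tor s t)].
have [fs [fsS Sfs]] := finite_span S.
have [|P Pu /allP hP] := (codiagonalizableP fs).1.
  split=> [A B /fsS[s [t [_ [_ _ ->]]]] /fsS[s' [t' [_ [_ _ ->]]]]|A /fsS[s [t [k [k0 hk ->]]]]].
    by rewrite /comm_mx -!qM -?torD ?[s + _]addrC ?[t + _]addrC//; exact: tor_SU3.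
  by apply: (finite_order_diagonalizable k0); rewrite -repX ?hk//; exact: tor_SU3.
exists P => // s t.
have Sdiag A : S A -> is_diag_mx (P *m A *m invmx P).
  move=> /Sfs /(@coord_span _ _ _ (in_tuple fs)) ->.
  rewrite mulmx_sumr mulmx_suml; apply/is_diag_mxP => i j ij.
  rewrite summxE big1// => k _; rewrite -scalemxAr -scalemxAl mxE.
  have /hP : (in_tuple fs)`_k \in fs by rewrite mem_nth.
  by move=> /similar_diagPp/(_ i j ij); rewrite conjumx// => ->; rewrite mulr0.
have [B B0 hB] := rep_bounded.
apply/is_diag_mxP => i j ij; apply: Normc.eq0_normc; apply/eqP; rewrite eq_le normc_ge0 andbT.
apply/ler_addgt0Pr => e e0; rewrite add0r.
set L := N P * B * N (invmx P).
have L0 : 0 <= L by rewrite !mulr_ge0 ?mxnorm1_ge0.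
have eL : 0 < e / (L + 1) by rewrite divr_gt0// ltr_wpDl.
  have [d d0 hd] := qc eL.
have [|s' [t' [k [k0 hk hs ht]]]] := @tor_finite_order_dense s t (d / 4); first by rewrite divr_gt0.
have /is_diag_mxP/(_ i j ij) h0 : is_diag_mx (P *m q (tor s' t') *m invmx P).
  by apply: Sdiag; exists s', t', k.
(* Subtracting the nearby image of finite order does not change an off-diagonal entry. *)
have -> : (P *m q (tor s t) *m invmx P) i j =
    (P *m (q (tor s' t') *m (q (tor (s - s') (t - t')) - 1%:M)) *m invmx P) i j.
  rewrite mulmxBr mulmx1 -qM -?torD; [|exact: tor_SU3..].
  have sK (x y : R) : x + (y - x) = y by rewrite addrC subrK.
  rewrite !sK; move: (q (tor s' t')) (q (tor s t)) h0 => X Y h0.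
  rewrite mulmxBr mulmxBl mxB_E.
  by move: (P *m X *m invmx P) (P *m Y *m invmx P) h0 => X' Y' ->; rewrite subr0.
apply: le_trans (normc_le_mxnorm1 _ _ _) _.
rewrite (le_trans (mxnorm1M _ _))// (le_trans (ler_wpM2r _ (mxnorm1M _ _))) ?mxnorm1_ge0//.
rewrite (le_trans (ler_wpM2r _ (ler_wpM2l _ (mxnorm1M _ _)))) ?mxnorm1_ge0//.
have h1 : N (q (tor (s - s') (t - t')) - 1%:M) <= e / (L + 1).
  rewrite ltW// hd//; first exact: tor_SU3.
  by rewrite (le_lt_trans (tor_norm_sub1 _ _))//; lra.
apply: le_trans (_ : L * (e / (L + 1)) <= _); last first.
  by rewrite mulrCA ger_pMr// ler_pdivrMr ?ltr_wpDl// mul1r lerDl.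
rewrite (_ : L * (e / (L + 1)) = N P * (B * (e / (L + 1))) * N (invmx P)); last first.
  by rewrite {1}/L; ring.
apply: ler_wpM2r; first exact: mxnorm1_ge0.
apply: ler_wpM2l; first exact: mxnorm1_ge0.
by apply: ler_pM => //; try exact: mxnorm1_ge0; apply: hB; exact: tor_SU3.
Qed.

(** Each diagonal entry is multiplicative in [(s, t)] and so splits into characters of the two
    coordinate circles. *)
Lemma tor_weights : exists2 P : 'M[R[i]]_n, P \in unitmx &
  exists x : 'I_n -> R * R, forall s t,
    P *m q (tor s t) *m invmx P =
    diag_mx (\row_a cis ((x a).1 * s + (x a).2 * t)).
Proof.
have [P Pu hP] := tor_rep_diag; exists P => //.
pose c a s t := (P *m q (tor s t) *m invmx P) a a.
have cM a s t s' t' : c a (s + s') (t + t') = c a s t * c a s' t'.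
  rewrite /c torD qM; [|exact: tor_SU3..].
  have -> : P *m (q (tor s t) *m q (tor s' t')) *m invmx P =
     (P *m q (tor s t) *m invmx P) *m (P *m q (tor s' t') *m invmx P).
    by rewrite !mulmxA mulmxKV.
  have /is_diag_mxP h := hP s t; rewrite mxE (bigD1 a)//= big1 ?addr0// => b ba.
  by rewrite h ?mul0r// eq_sym.
have c2 a s t : cis s = 1 -> cis t = 1 -> c a s t = 1.
  move=> hs ht; rewrite /c (_ : tor s t = 1%:M) ?q1 ?mulmx1 ?mulmxV ?mxE ?eqxx//.
  by rewrite /tor cisD !cisN hs ht rmorph1 mulr1 diag_row3_1.
have cc a e : 0 < e -> exists2 d : R, 0 < d &
    forall s t, `|s| + `|t| < d -> nz (c a s t - 1) < e.
  move=> e0; set L := N P * N (invmx P).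
  have L0 : 0 <= L by rewrite !mulr_ge0 ?mxnorm1_ge0.
  have eL : 0 < e / (L + 1) by rewrite divr_gt0// ltr_wpDl.
  have [d d0 hd] := qc eL.
  exists (d / 2) => [|s t st]; first by rewrite divr_gt0.
  have -> : c a s t - 1 = (P *m (q (tor s t) - 1%:M) *m invmx P) a a.
    by rewrite mulmxBr mulmxBl mulmx1 mulmxV// mxB_E [1%:M _ _]mxE eqxx.
  apply: le_lt_trans (normc_le_mxnorm1 _ _ _) _.
  rewrite (le_lt_trans (mxnorm1M _ _))//.
  rewrite (le_lt_trans (ler_wpM2r _ (mxnorm1M _ _))) ?mxnorm1_ge0// mulrAC -/L.
  have h1 : N (q (tor s t) - 1%:M) < e / (L + 1).
    rewrite hd//; first exact: tor_SU3.
    by rewrite (le_lt_trans (tor_norm_sub1 _ _))//; lra.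
  rewrite (le_lt_trans (ler_wpM2l L0 (ltW h1)))// mulrCA gtr_pMr//.
  by rewrite ltr_pdivrMr ?ltr_wpDl// mul1r ltrDl.
have ch1 a : exists p, forall s, c a s 0 = cis (p * s).
  apply: circle_character.
  - by move=> s s'; rewrite -{1}(addr0 0) cM.
  - by rewrite c2 ?cis2pi ?cis0.
  - move=> e /(cc a)[d d0 hd]; exists d => // s hs; apply: hd.
    by rewrite normr0 addr0.
have ch2 a : exists p, forall t, c a 0 t = cis (p * t).
  apply: circle_character.
  - by move=> s s'; rewrite -{1}(addr0 0) cM.
  - by rewrite c2 ?cis2pi ?cis0.
  - move=> e /(cc a)[d d0 hd]; exists d => // s hs; apply: hd.
    by rewrite normr0 add0r.
have [x1 h1] := choice ch1; have [x2 h2] := choice ch2.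
exists (fun a => (x1 a, x2 a)) => s t; apply/matrixP => i j; rewrite [RHS]mxE.
have [<-|ij] := eqVneq i j.
  by rewrite /= mulr1n [RHS]mxE cisD -h1 -h2 -cM addr0 add0r.
by rewrite mulr0n; have /is_diag_mxP -> := hP s t.
Qed.

End TorusWeights.

(** * The differential of a representation *)

Section Tangents.
Variable R : realType.
Local Notation nz := (@Normc.normc R).
Local Notation N := (@mxnorm1 R _ _).
Local Notation M3 := 'M[R[i]]_3.

(** [g k] plays the role of a curve through 1 at time [1 / k.+1], and [X] that of its velocity. *)
Definition tangent n (g : nat -> 'M[R[i]]_n) (X : 'M[R[i]]_n) :=
  approx (fun k => k.+1%:R *: (g k - 1%:M)) X.

Lemma normc_nat k : nz k%:R = k%:R.
Proof. by rewrite -(rmorph_nat (real_complex R)) normc_real ger0_norm. Qed.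

Lemma tangent_cvg n (g : nat -> 'M[R[i]]_n) X : tangent g X -> approx g 1%:M.
Proof.
move=> /approx_bounded[B B0 hB]; exists B => k.
by rewrite ler_pdivlMr// mulrC -{1}(normc_nat k.+1) -mxnorm1Z.
Qed.

Lemma tangentM n (g h : nat -> 'M[R[i]]_n) X Y :
  tangent g X -> tangent h Y -> tangent (fun k => g k *m h k) (X + Y).
Proof.
move=> hg hh; have := approxD (approxM hg (tangent_cvg hh)) hh.
rewrite mulmx1; apply: eq_approx => k.
by rewrite -scalemxAl -scalerDr mulmxBl mul1mx addrA subrK.
Qed.

Lemma tangent_conj n (A B : 'M[R[i]]_n) (g : nat -> 'M[R[i]]_n) X : A *m B = 1%:M ->
  tangent g X -> tangent (fun k => A *m g k *m B) (A *m X *m B).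
Proof.
move=> AB hg; have := approxM (approxM (approx_cst A) hg) (approx_cst B).
apply: eq_approx => k; rewrite -scalemxAr -scalemxAl; congr (_ *: _).
by rewrite mulmxBr mulmxBl mulmx1 AB.
Qed.

Lemma tangent_inv n (g h : nat -> 'M[R[i]]_n) X b : tangent g X ->
  (forall k, h k *m g k = 1%:M) -> (forall k, N (h k) <= b) -> approx h 1%:M.
Proof.
move=> /tangent_cvg[C hC] hg hb; exists (b * C) => k.
have -> : h k - 1%:M = - (h k *m (g k - 1%:M)) by rewrite mulmxBr hg mulmx1 opprB.
by rewrite mxnorm1N (le_trans (mxnorm1M _ _))// -mulrA ler_pM ?mxnorm1_ge0.
Qed.

(** The derivative of the adjoint action: up to the factor [h k], which tends to 1, the quotient is
    the commutator of [k.+1 *: (g k - 1)] with [Y]. *)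
Lemma tangent_bracket n (g h : nat -> 'M[R[i]]_n) X Y b : tangent g X ->
  (forall k, h k *m g k = 1%:M) -> (forall k, N (h k) <= b) ->
  approx (fun k => k.+1%:R *: (g k *m Y *m h k - Y)) (X *m Y - Y *m X).
Proof.
move=> hg hk hb; have ch := tangent_inv hg hk hb.
have := approxM (approxB (approxM hg (approx_cst Y)) (approxM (approx_cst Y) hg)) ch.
rewrite mulmx1; apply: eq_approx => k.
rewrite -scalemxAl -scalemxAr -scalerBr -scalemxAl; congr (_ *: _).
have -> : (g k - 1%:M) *m Y - Y *m (g k - 1%:M) = g k *m Y - Y *m g k.
  by rewrite mulmxBl mulmxBr mul1mx mulmx1 opprB addrA subrK.
by rewrite mulmxBl -[Y *m g k *m _]mulmxA (mulmx1C (hk k)) mulmx1.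
Qed.

Lemma su3D (X Y : M3) : su3 X -> su3 Y -> su3 (X + Y).
Proof.
move=> [hX tX] [hY tY]; split; last by rewrite mxtraceD tX tY addr0.
by rewrite linearD /= map_mxD hX hY opprD.
Qed.

Lemma su3Z (c : R) (X : M3) : su3 X -> su3 (c%:C *: X).
Proof.
move=> [hX tX]; split; last by rewrite mxtraceZ tX mulr0.
rewrite linearZ /= map_mxZ hX scalerN; congr (- (_ *: _)); exact: conjc_real.
Qed.

Lemma su3N (X : M3) : su3 X -> su3 (- X).
Proof. by move=> /(su3Z (-1)); rewrite rmorphN1 scaleN1r. Qed.

Lemma su3B (X Y : M3) : su3 X -> su3 Y -> su3 (X - Y).
Proof. by move=> hX /su3N; exact: su3D. Qed.

Lemma su3_bracket (X Y : M3) : su3 X -> su3 Y -> su3 (X *m Y - Y *m X).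
Proof.
move=> [hX _] [hY _]; split; last by rewrite raddfB /= mxtrace_mulC subrr.
rewrite linearB /= map_mxB !adjM hX hY.
by rewrite !mulmxN !mulNmx !opprK opprB.
Qed.

Lemma su3_0 : su3 (0 : M3).
Proof. by split; [rewrite linear0 map_mx0 oppr0 | exact: mxtrace0]. Qed.

Variables (n : nat) (q : M3 -> 'M[R[i]]_n) (B : R) (x : 'I_n -> R * R).
Hypothesis q1 : q 1%:M = 1%:M.
Hypothesis qM : forall g h, SU3 g -> SU3 h -> q (g *m h) = q g *m q h.
Hypothesis qB : forall g, SU3 g -> N (q g) <= B.
Hypothesis qT : forall s t,
  q (tor s t) = diag_mx (\row_a cis ((x a).1 * s + (x a).2 * t)).

Lemma rep_conj u g : SU3 u -> SU3 g ->
  q (u *m g *m invmx u) = q u *m q g *m q (invmx u).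
Proof.
by move=> hu hg; rewrite (qM (SU3_M hu hg) (SU3_V hu)) (qM hu hg).
Qed.

Lemma rep_Vl g : SU3 g -> q (invmx g) *m q g = 1%:M.
Proof. by move=> hg; rewrite -(qM (SU3_V hg) hg) SU3_mulVmx. Qed.

Lemma rep_Vr g : SU3 g -> q g *m q (invmx g) = 1%:M.
Proof. by move=> hg; rewrite -(qM hg (SU3_V hg)) SU3_mulmxV. Qed.

Lemma repB_ge0 : 0 <= B.
Proof. exact: le_trans (mxnorm1_ge0 _) (qB (@SU3_1 R)). Qed.

(** After diagonalizing [r], the matrix [q r - 1] is conjugate to a diagonal one with entries
    [cis _ - 1]. These are bounded by the angles, hence by the distance of [r] to 1; conjugation by
    [q u] costs a factor [B] on either side. *)
Lemma rep_Lipschitz : exists2 L, 0 <= L &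
  forall r, SU3 r -> N (q r - 1%:M) <= L * N (r - 1%:M).
Proof.
pose S := \sum_a (`|(x a).1| + `|(x a).2|).
have S0 : 0 <= S by apply: sumr_ge0 => a _; rewrite addr_ge0.
have B0 := repB_ge0; exists (B * (S * 324) * B); first exact: (mulr_ge0 (mulr_ge0 B0 (mulr_ge0 S0 (ler0n _ _))) B0).
move=> r hr; have [u [s [t [hu er _ [hs ht]]]]] := SU3_diag hr.
set D := N (r - 1%:M) in hs ht *.
have -> : q r - 1%:M = q u *m (q (tor s t) - 1%:M) *m q (invmx u).
  by rewrite mulmxBr mulmxBl mulmx1 rep_Vr// er rep_conj//; exact: tor_SU3.
rewrite (le_trans (mxnorm1M _ _))// mulrAC; apply: ler_pM; try exact: mxnorm1_ge0.
  2: by apply: qB; exact: SU3_V.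
rewrite (le_trans (mxnorm1M _ _))// -mulrA; apply: ler_pM; try exact: mxnorm1_ge0.
  exact: qB.
rewrite qT -diag_const_mx -raddfB /= mxnorm1_diag mulr_suml mulr_suml.
apply: ler_sum => a _; rewrite !mxE (le_trans (normc_cis_sub1_le _))//.
rewrite (le_trans (ler_normD _ _))// -mulrA mulrDl !normrM.
by rewrite lerD// ler_wpM2l.
Qed.

(** This makes the differential well defined. Two sequences with the same tangent differ by factors
    [invmx (g k) *m g' k] at distance of order 1/k^2 from 1, and the Lipschitz bound transfers this
    to the images. *)
Lemma tangent_rep g g' X A : (forall k, SU3 (g k)) -> (forall k, SU3 (g' k)) ->
  tangent g X -> tangent g' X -> tangent (q \o g) A -> tangent (q \o g') A.
Proof.
move=> hg hg' tg tg' tq; have [L L0 hL] := rep_Lipschitz.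
apply: approx_close tq _; have [C hC] := approxB tg' tg.
rewrite subrr in hC.
exists (B * (L * (9 * C))) => k; rewrite subr0 -scalerBr opprB addrA subrK /=.
have -> : q (g' k) - q (g k) = q (g k) *m (q (invmx (g k) *m g' k) - 1%:M).
  by rewrite (qM (SU3_V (hg k)) (hg' k)) mulmxBr mulmxA rep_Vr// mul1mx mulmx1.
rewrite scalemxAr (le_trans (mxnorm1M _ _))// -mulrA ler_pM ?mxnorm1_ge0//; first exact: qB.
rewrite mxnorm1Z normc_nat (le_trans (ler_wpM2l _ (hL _ (SU3_M (SU3_V (hg k)) (hg' k)))))//.
have -> : invmx (g k) *m g' k - 1%:M = invmx (g k) *m (g' k - g k).
  by rewrite mulmxBr SU3_mulVmx.
rewrite mulrCA -mulrA ler_wpM2l// (le_trans (ler_wpM2l _ (mxnorm1M _ _)))//.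
rewrite mulrCA -mulrA ler_pM ?mxnorm1_ge0//; first by rewrite mulr_ge0// mxnorm1_ge0.
  exact: SU3_norm (SU3_V (hg k)).
have := hC k; rewrite subr0 -scalerBr opprB addrA subrK.
by rewrite mxnorm1Z normc_nat.
Qed.

Definition wdiag s t : 'M[R[i]]_n := diag_mx (\row_a (0 +i* ((x a).1 * s + (x a).2 * t))).

Lemma tangent_tor s t :
  tangent (fun k => q (tor (s / k.+1%:R) (t / k.+1%:R))) (wdiag s t).
Proof.
have /choice[C hC] a := cis_approx ((x a).1 * s + (x a).2 * t).
exists (\sum_a C a) => k.
rewrite qT -diag_const_mx -raddfB /= -linearZ /= -raddfB /= mxnorm1_diag mulr_suml.
apply: ler_sum => a _; have := hC a k; rewrite !mxE.
by rewrite mulrDl !mulrA.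
Qed.

(* Opaque, so that unification never unfolds it. *)
Fact dq_subproof : {f : M3 -> 'M[R[i]]_n | forall X, f X =
  xget 0 [set A | exists g, [/\ forall k, SU3 (g k), tangent g X & tangent (q \o g) A]]}.
Proof.
by exists (fun X => xget 0
  [set A | exists g, [/\ forall k, SU3 (g k), tangent g X & tangent (q \o g) A]]).
Qed.

Definition dq : M3 -> 'M[R[i]]_n := sval dq_subproof.

Lemma dq_unique g X A : (forall k, SU3 (g k)) -> tangent g X -> tangent (q \o g) A ->
  dq X = A.
Proof.
move=> hg tg tq; rewrite [dq X](svalP dq_subproof X); case: xgetP => [A' _ [g' [hg' tg' tq']]|/(_ A)]; last first.
  by case; exists g.
exact: approx_uniq (tangent_rep hg' hg tg' tg tq') tq.
Qed.

(** Every element of su(3) is of this form by [su3_diag], so the differential exists everywhere and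
    is known explicitly. *)
Lemma dq_conj_ltor u s t : SU3 u ->
  exists g, [/\ forall k, SU3 (g k), tangent g (u *m ltor s t *m invmx u) &
    tangent (q \o g) (q u *m wdiag s t *m q (invmx u))].
Proof.
move=> hu; exists (fun k => u *m tor (s / k.+1%:R) (t / k.+1%:R) *m invmx u); split.
- by move=> k; apply: SU3_conj => //; exact: tor_SU3.
- by apply: tangent_conj (tor_tangent s t); rewrite SU3_mulmxV.
- apply: eq_approx (tangent_conj (rep_Vr hu) (tangent_tor s t)) => k.
  by rewrite /= rep_conj//; exact: tor_SU3.
Qed.

Lemma dqE u s t : SU3 u -> dq (u *m ltor s t *m invmx u) = q u *m wdiag s t *m q (invmx u).
Proof. by move=> /(dq_conj_ltor s t)[g [hg tg tq]]; exact: dq_unique hg tg tq. Qed.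

Lemma dq_ltor s t : dq (ltor s t) = wdiag s t.
Proof.
have := @dqE 1%:M s t (@SU3_1 R).
by rewrite invmx1 mul1mx mulmx1 q1 mul1mx mulmx1.
Qed.

Lemma dq_tangent X : su3 X ->
  exists g, [/\ forall k, SU3 (g k), tangent g X & tangent (q \o g) (dq X)].
Proof.
move=> /su3_diag[u [s [t [hu ->]]]]; have [g [hg tg tq]] := dq_conj_ltor s t hu.
by exists g; rewrite (dq_unique hg tg tq).
Qed.

Lemma dqD X Y : su3 X -> su3 Y -> dq (X + Y) = dq X + dq Y.
Proof.
move=> /dq_tangent[g [hg tg tq]] /dq_tangent[h [hh th tq']].
apply: (dq_unique (g := fun k => g k *m h k)) (tangentM tg th) _.
  by move=> k; exact: SU3_M.
apply: eq_approx (tangentM tq tq') => k /=.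
by rewrite qM.
Qed.

Lemma dqZ (c : R) X : su3 X -> dq (c%:C *: X) = c%:C *: dq X.
Proof.
move=> /su3_diag[u [s [t [hu ->]]]].
have hl : c%:C *: ltor s t = ltor (c * s) (c * t).
  rewrite /ltor -linearZ /=; congr diag_mx; apply/rowP => j; rewrite !mxE.
  by case: j => [[|[|[|//]]] h] /=; apply/eqP; rewrite eq_complex /=; apply/andP; split; apply/eqP; ring.
have hw : c%:C *: wdiag s t = wdiag (c * s) (c * t).
  rewrite /wdiag -linearZ /=; congr diag_mx; apply/rowP => j; rewrite !mxE.
  by apply/eqP; rewrite eq_complex /=; apply/andP; split; apply/eqP; ring.
by rewrite scalemxAl scalemxAr hl !dqE// scalemxAl scalemxAr hw.
Qed.

Lemma dqN X : su3 X -> dq (- X) = - dq X.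
Proof. by move=> /(dqZ (-1)); rewrite rmorphN1 !scaleN1r. Qed.

Lemma dqB X Y : su3 X -> su3 Y -> dq (X - Y) = dq X - dq Y.
Proof. by move=> hX hY; rewrite dqD ?dqN//; exact: su3N. Qed.

Lemma dq_Ad h X : SU3 h -> su3 X ->
  dq (h *m X *m invmx h) = q h *m dq X *m q (invmx h).
Proof.
move=> hh /dq_tangent[g [hg tg tq]].
apply: dq_unique (tangent_conj (SU3_mulmxV hh) tg) _; first by move=> k; exact: SU3_conj.
apply: eq_approx (tangent_conj (rep_Vr hh) tq) => k.
by rewrite /= rep_conj.
Qed.

(** The differential inherits the Lipschitz constant. Its continuity is what allows [dq] to pass to
    the limit defining a bracket. *)
Lemma dq_bound : exists2 L, 0 <= L & forall X, su3 X -> N (dq X) <= L * N X.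
Proof.
have [L L0 hL] := rep_Lipschitz; exists L => // X /dq_tangent[g [hg [C hC] [D hD]]].
rewrite -subr_le0; apply: (@le_inv_nat_le0 R _ (D + L * C)) => k.
have h1 : N (k.+1%:R *: (q (g k) - 1%:M)) <= L * N (k.+1%:R *: (g k - 1%:M)).
  by rewrite !mxnorm1Z mulrCA ler_wpM2l ?normc_ge0// hL.
have h2 : N (k.+1%:R *: (g k - 1%:M)) <= N X + C / k.+1%:R.
  by rewrite -[X in N X <= _](subrK X) addrC (le_trans (mxnorm1D _ _))// lerD2l.
have h3 : N (dq X) <= D / k.+1%:R + N (k.+1%:R *: (q (g k) - 1%:M)).
  rewrite -[X in N X <= _](subrK (k.+1%:R *: (q (g k) - 1%:M))).
  by rewrite (le_trans (mxnorm1D _ _))// lerD2r mxnorm1_distC.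
rewrite lerBlDr (le_trans h3)// mulrDl -addrA lerD2l (le_trans h1)//.
by rewrite (le_trans (ler_wpM2l L0 h2))// mulrDr addrC mulrA.
Qed.

(** Both brackets are derivatives of adjoint actions along the same sequence, and [dq_Ad] identifies
    the difference quotients. *)
Lemma dq_bracket X Y : su3 X -> su3 Y ->
  dq (X *m Y - Y *m X) = dq X *m dq Y - dq Y *m dq X.
Proof.
move=> hX hY; have [g [hg tg tq]] := dq_tangent hX; have [L L0 hL] := dq_bound.
have c1 := tangent_bracket Y tg (fun k => SU3_mulVmx (hg k)) (fun k => SU3_norm (SU3_V (hg k))).
have c2 := tangent_bracket (dq Y) tq (fun k => rep_Vl (hg k)) (fun k => qB (SU3_V (hg k))).
apply: approx_uniq c2; case: c1 => C hC; exists (L * C) => k /=.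
rewrite -dq_Ad//.
have hZ : su3 (g k *m Y *m invmx (g k) - Y) by apply: su3B => //; exact: su3_conj.
have kR : (k.+1%:R : R[i]) = (k.+1%:R : R)%:C by rewrite rmorph_nat.
rewrite -dqB//; last exact: su3_conj.
rewrite kR -dqZ// -dqB; [|exact: su3Z|exact: su3_bracket].
rewrite (le_trans (hL _ _))//; first by apply: su3B; [exact: su3Z|exact: su3_bracket].
by rewrite -kR -mulrA ler_wpM2l.
Qed.

End Tangents.

(** * Complex-linear extension of the differential *)

Section Complexification.
Variable R : realType.
Local Notation N := (@mxnorm1 R _ _).
Local Notation M3 := 'M[R[i]]_3.
Local Notation adj A := ((A ^t* )%sesqui).
Local Notation I := (0 +i* 1 : R[i]).

Lemma mulII : I * I = -1.
Proof. by have := sqr_i R; rewrite expr2. Qed.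

Lemma adjZ m n (z : R[i]) (A : 'M[R[i]]_(m, n)) : adj (z *: A) = z^*%C *: adj A.
Proof. by apply/matrixP => i j; rewrite !mxE rmorphM. Qed.

Lemma adjD m n (A B : 'M[R[i]]_(m, n)) : adj (A + B) = adj A + adj B.
Proof. by rewrite linearD /= map_mxD. Qed.

Lemma adjN m n (A : 'M[R[i]]_(m, n)) : adj (- A) = - adj A.
Proof. by rewrite linearN /= map_mxN. Qed.

Lemma trace_adj n (A : 'M[R[i]]_n) : \tr (adj A) = (\tr A)^*%C.
Proof. by rewrite trace_map_mx mxtrace_tr. Qed.

Definition sk0 (A : M3) : M3 := 2^-1 *: (A - adj A).

(* The projection of gl(3, C) to su(3), opaque like [dq]. *)
Fact sk_subproof :
  {f : M3 -> M3 | forall A, f A = sk0 A - (\tr (sk0 A) / 3)%:M}.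
Proof. by exists (fun A => sk0 A - (\tr (sk0 A) / 3)%:M). Qed.

Definition sk : M3 -> M3 := sval sk_subproof.

Lemma skE A : sk A = sk0 A - (\tr (sk0 A) / 3)%:M.
Proof. exact: (svalP sk_subproof). Qed.

Lemma trace_third (z : R[i]) : \tr ((z / 3)%:M : M3) = z.
Proof. by rewrite mxtrace_scalar -(mulr_natr (z / 3) 3) divfK// pnatr_eq0. Qed.

Lemma adj_scalar n (z : R[i]) : adj (z%:M : 'M[R[i]]_n) = (z^*%C)%:M.
Proof. by rewrite tr_scalar_mx map_scalar_mx. Qed.

Lemma conj_inv_nat k : ((k%:R : R[i])^-1)^*%C = k%:R^-1.
Proof. by rewrite conjc_inv conjc_nat. Qed.

Lemma scaler_half (V : lmodType R[i]) (v : V) : 2^-1 *: (v + v) = v.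
Proof. by rewrite scalerDr -scalerDl (_ : 2^-1 + 2^-1 = 1) ?scale1r//; field. Qed.

Lemma sk_su3 A : su3 (sk A).
Proof.
have h0 : adj (sk0 A) = - sk0 A.
  by rewrite /sk0 adjZ adjD adjN adjK conj_inv_nat -scalerN opprB addrC.
split; last by rewrite !skE linearB /= trace_third subrr.
have := trace_adj (sk0 A); rewrite !skE adjD adjN adj_scalar h0 linearN /= => ht.
have -> : (\tr (sk0 A) / 3)^*%C = - (\tr (sk0 A) / 3).
  by rewrite rmorphM -mulNr ht; congr (_ * _); exact: conj_inv_nat.
by rewrite rmorphN opprK opprB addrC.
Qed.

Lemma skD A B : sk (A + B) = sk A + sk B.
Proof.
have h : sk0 (A + B) = sk0 A + sk0 B.
  by rewrite /sk0 adjD opprD addrACA; exact: scalerDr.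
by rewrite !skE h mxtraceD mulrDl [X in _ - X]raddfD /= opprD addrACA.
Qed.

Lemma skZ (c : R) A : sk (c%:C *: A) = c%:C *: sk A.
Proof.
have h : sk0 (c%:C *: A) = c%:C *: sk0 A.
  by rewrite /sk0 adjZ conjc_real -scalerBr !scalerA mulrC.
by rewrite !skE h mxtraceZ scalerBr scale_scalar_mx mulrA.
Qed.

Lemma skN A : sk (- A) = - sk A.
Proof. by have := skZ (-1) A; rewrite rmorphN1 !scaleN1r. Qed.

Lemma sk_id X : su3 X -> sk X = X.
Proof.
move=> [h t]; have s0 : sk0 X = X.
  by rewrite /sk0 h opprK scaler_half.
by rewrite !skE s0 t mul0r raddf0 subr0.
Qed.

Lemma sk_I X : su3 X -> sk (I *: X) = 0.
Proof.
move=> [h t]; have s0 : sk0 (I *: X) = 0.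
  rewrite /sk0 adjZ h (_ : I^*%C = - I) ?scaleNr ?scalerN ?opprK ?subrr ?scaler0//.
  by apply/eqP; rewrite eq_complex /= oppr0 !eqxx.
by rewrite !skE s0 mxtrace0 mul0r raddf0 subrr.
Qed.

Lemma sk_conj g A : SU3 g -> sk (g *m A *m invmx g) = g *m sk A *m invmx g.
Proof.
move=> hg.
have h : sk0 (g *m A *m invmx g) = g *m sk0 A *m invmx g.
  rewrite /sk0 -(SU3_adj hg) !adjM adjK -scalemxAr -scalemxAl mulmxBr mulmxBl.
  by rewrite mulmxA.
rewrite !skE h mxtrace_mulC mulmxA SU3_mulVmx// mul1mx mulmxBr mulmxBl.
by rewrite scalar_mxC -[X in _ = _ - X]mulmxA SU3_mulmxV// mulmx1.
Qed.

(** gl(3, C) is su(3) plus i su(3) plus the scalars; multiplication by [- I] makes the Hermitian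
    part skew-Hermitian. *)
Lemma sk_decomp A : A = sk A + I *: sk (- I *: A) + (\tr A / 3)%:M.
Proof.
have hI : I *: sk0 (- I *: A) = 2^-1 *: (A + adj A).
  rewrite /sk0 adjZ scalerA mulrC -scalerA scalerBr !scalerA.
  rewrite (_ : (- I)^*%C = I); last by apply/eqP; rewrite eq_complex /= !oppr0 opprK !eqxx.
  by rewrite mulrN mulII opprK scaleN1r opprK scale1r.
have h : sk0 A + I *: sk0 (- I *: A) = A.
  by rewrite hI /sk0 -scalerDr addrACA [- _ + _]addrC subrr addr0 scaler_half.
rewrite !skE scalerBr scale_scalar_mx mulrA -mxtraceZ addrACA h -opprD -raddfD /= -mulrDl.
by rewrite -mxtraceD h subrK.
Qed.

Variables (n : nat) (q : M3 -> 'M[R[i]]_n) (B : R) (x : 'I_n -> R * R).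
Hypothesis q1 : q 1%:M = 1%:M.
Hypothesis qM : forall g h, SU3 g -> SU3 h -> q (g *m h) = q g *m q h.
Hypothesis qB : forall g, SU3 g -> N (q g) <= B.
Hypothesis qT : forall s t,
  q (tor s t) = diag_mx (\row_a cis ((x a).1 * s + (x a).2 * t)).

Let dqD := dqD q1 qM qB qT.
Let dqZ := dqZ q1 qM qB qT.
Let dqN := dqN q1 qM qB qT.
Let dqB := dqB q1 qM qB qT.
Let dq_bracket := dq_bracket q1 qM qB qT.
Let dq_Ad := dq_Ad q1 qM qB qT.

Fact crho_subproof : {f : M3 -> 'M[R[i]]_n |
  forall A, f A = dq q (sk A) + I *: dq q (sk (- I *: A))}.
Proof. by exists (fun A => dq q (sk A) + I *: dq q (sk (- I *: A))). Qed.

(* The complex-linear extension of the differential to gl(3, C), zero on the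
   scalar matrices. *)
Definition crho : M3 -> 'M[R[i]]_n := sval crho_subproof.

Lemma crhoE A : crho A = dq q (sk A) + I *: dq q (sk (- I *: A)).
Proof. exact: (svalP crho_subproof). Qed.

Lemma crhoD A A' : crho (A + A') = crho A + crho A'.
Proof.
rewrite !crhoE scalerDr !skD !(dqD (sk_su3 _) (sk_su3 _)).
by rewrite scalerDr addrACA.
Qed.

Lemma crho_realZ (c : R) A : crho (c%:C *: A) = c%:C *: crho A.
Proof.
rewrite !crhoE scalerA mulrC -scalerA !skZ !(dqZ _ (sk_su3 _)).
by rewrite scalerDr; congr (_ + _); rewrite !scalerA mulrC.
Qed.

Lemma crho_I A : crho (I *: A) = I *: crho A.
Proof.
rewrite !crhoE scalerA mulNr mulII opprK scale1r scalerDr scalerA mulII scaleN1r.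
by rewrite scaleNr skN (dqN (sk_su3 _)) opprK addrC.
Qed.

Lemma crhoZ (z : R[i]) A : crho (z *: A) = z *: crho A.
Proof.
have -> : z = (complex.Re z)%:C + I * (complex.Im z)%:C by rewrite -complexE.
by rewrite !scalerDl -!scalerA crhoD crho_I !crho_realZ.
Qed.

Lemma crho0 : crho 0 = 0.
Proof. by have := crhoZ 0 0; rewrite !scale0r. Qed.

Lemma crho_sum (J : finType) (F : J -> M3) : crho (\sum_j F j) = \sum_j crho (F j).
Proof.
elim/big_rec2: _ => [|j y1 y2 _ <-]; first exact: crho0.
exact: crhoD.
Qed.

Lemma crhoN A : crho (- A) = - crho A.
Proof. by have := crhoZ (-1) A; rewrite !scaleN1r. Qed.

Lemma crhoB A A' : crho (A - A') = crho A - crho A'.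
Proof. by rewrite crhoD crhoN. Qed.

Lemma crho_Ad g A : SU3 g -> crho (g *m A *m invmx g) = q g *m crho A *m q (invmx g).
Proof.
move=> hg; rewrite !crhoE mulmxDr mulmxDl -scalemxAr -scalemxAl.
have -> : - I *: (g *m A *m invmx g) = g *m (- I *: A) *m invmx g.
  by rewrite -scalemxAr -scalemxAl.
by rewrite !(sk_conj _ hg) !(dq_Ad hg (sk_su3 _)).
Qed.

Lemma crho_su3 U V : su3 U -> su3 V -> crho (U + I *: V) = dq q U + I *: dq q V.
Proof.
move=> hU hV; rewrite crhoD crho_I !crhoE !(sk_id hU) !(sk_id hV) !scaleNr !skN !(sk_I hU) !(sk_I hV).
have h0 : dq q 0 = 0 by have := dqZ 0 (su3_0 R); rewrite !scale0r.
by rewrite oppr0 h0 scaler0 !addr0.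
Qed.

Lemma complex_bracket m (U V U' V' : 'M[R[i]]_m) :
  (U + I *: V) *m (U' + I *: V') - (U' + I *: V') *m (U + I *: V) =
  ((U *m U' - U' *m U) - (V *m V' - V' *m V)) +
  I *: ((U *m V' - V' *m U) + (V *m U' - U' *m V)).
Proof.
rewrite !mulmxDl !mulmxDr -!scalemxAl -!scalemxAr !scalerA mulII !scaleN1r.
move: (U *m U') (U' *m U) (V *m V') (V' *m V) (U *m V') (V' *m U) (V *m U') (U' *m V).
by move=> *; apply/matrixP => i j; rewrite !mxE; ring.
Qed.

Lemma dq_complex_bracket (U V U' V' : M3) : su3 U -> su3 V -> su3 U' -> su3 V' ->
  dq q ((U *m U' - U' *m U) - (V *m V' - V' *m V)) +
  I *: dq q ((U *m V' - V' *m U) + (V *m U' - U' *m V)) =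
  (dq q U + I *: dq q V) *m (dq q U' + I *: dq q V') -
  (dq q U' + I *: dq q V') *m (dq q U + I *: dq q V).
Proof.
move=> hU hV hU' hV'; rewrite complex_bracket.
rewrite -(dq_bracket hU hU') -(dq_bracket hV hV') -(dq_bracket hU hV') -(dq_bracket hV hU').
rewrite -(dqB (su3_bracket hU hU') (su3_bracket hV hV')).
by rewrite -(dqD (su3_bracket hU hV') (su3_bracket hV hU')).
Qed.

(** Scalars drop out of commutators; the rest is complex bilinearity and the bracket relation on
    su(3). *)
Lemma crho_bracket A A' :
  crho (A *m A' - A' *m A) = crho A *m crho A' - crho A' *m crho A.
Proof.
rewrite {1 2}(sk_decomp A) {1 2}(sk_decomp A').
have red (X Y : M3) (z w : R[i]) :
    (X + z%:M) *m (Y + w%:M) - (Y + w%:M) *m (X + z%:M) = X *m Y - Y *m X.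
  rewrite !mulmxDl !mulmxDr !mul_mx_scalar !mul_scalar_mx.
  by move: (X *m Y) (Y *m X) => P Q; apply/matrixP => i j; rewrite !mxE; case: (i == j); rewrite ?mulr1n ?mulr0n; ring.
have hb X Y : su3 (sk X *m sk Y - sk Y *m sk X) := su3_bracket (sk_su3 X) (sk_su3 Y).
rewrite red complex_bracket (crho_su3 (su3B (hb _ _) (hb _ _)) (su3D (hb _ _) (hb _ _))).
rewrite !crhoE; exact: dq_complex_bracket (sk_su3 _) (sk_su3 _) (sk_su3 _) (sk_su3 _).
Qed.

End Complexification.

(** * The Casimir operator *)

Section WeightStructure.
Variable R : realType.
Local Notation N := (@mxnorm1 R _ _).
Local Notation M3 := 'M[R[i]]_3.
Local Notation adj A := ((A ^t* )%sesqui).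
Local Notation I := (0 +i* 1 : R[i]).
Local Notation E := (@delta_mx R[i] 3 3).

(* The sign makes the determinant 1. *)
Definition wperm (s : {perm 'I_3}) : M3 := (-1) ^+ s *: perm_mx s.

Lemma wperm_SU3 s : SU3 (wperm s).
Proof.
split; last first.
  by rewrite /wperm detZ det_perm -exprSr -exprM -signr_odd oddM andbF.
apply/unitarymxP; rewrite /wperm adjZ -scalemxAl -scalemxAr scalerA.
rewrite (_ : _ * _^*%C = 1); last first.
  by rewrite rmorphXn rmorphN1 -exprMn mulrNN mulr1 expr1n.
rewrite tr_perm_mx map_perm_mx -perm_mxM.
by rewrite (mulgV s) perm_mx1 scale1r.
Qed.

Lemma wperm_conj s d :
  wperm s *m diag_mx d *m invmx (wperm s) = diag_mx (\row_j d 0 (s j)).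
Proof.
have h : wperm s *m diag_mx d = diag_mx (\row_j d 0 (s j)) *m wperm s.
  rewrite /wperm -scalemxAl -scalemxAr; congr (_ *: _).
  rewrite -row_permE; apply/matrixP => i j; rewrite mul_diag_mx !mxE.
  by case: eqP => _; rewrite ?mulr1n ?mulr1 ?mulr0n ?mulr0.
by rewrite h mulmxK// SU3_unit//; exact: wperm_SU3.
Qed.

Lemma cis_linear_eq1 (p q : R) : (forall s t, cis (p * s + q * t) = 1) -> p = 0 /\ q = 0.
Proof.
have aux (r : R) : (forall s, cis (r * s) = 1) -> r = 0.
  move=> h; apply/eqP; apply: contraT => r0.
  have := h (pi / r); rewrite mulrC divfK// /cis cospi => /eqP.
  by rewrite eq_complex /= => /andP[/eqP]; have := @ltr01 R; lra.
move=> h; split; apply: aux => s.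
  by have := h s 0; rewrite mulr0 addr0.
by have := h 0 s; rewrite mulr0 add0r.
Qed.

(* Dynkin coordinates of the weights of the standard representation, and the
   coordinates of a weight as a traceless diagonal matrix. *)
Definition wt (j : 'I_3) : R * R := [:: (1, 0); (-1, 1); (0, -1)]`_j.

Definition hcoord (j : 'I_3) (y : R * R) : R :=
  [:: (2 * y.1 + y.2) / 3; (y.2 - y.1) / 3; - (y.1 + 2 * y.2) / 3]`_j.

Lemma torE s t : tor s t = diag_mx (\row_j cis ((wt j).1 * s + (wt j).2 * t)).
Proof.
congr diag_mx; apply/rowP => j; rewrite !mxE.
by case: j => [[|[|[|//]]] h] /=; congr cis; ring.
Qed.

Lemma mul_delta_entry m n p r (g : 'M[R[i]]_(m, n)) j k (h : 'M[R[i]]_(p, r)) a b :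
  (g *m delta_mx j k *m h) a b = g a j * h k b.
Proof.
rewrite -(mul_delta_mx (0 : 'I_1)) mulmxA -colE -mulmxA -rowE.
by rewrite mxE big_ord1 !mxE.
Qed.

Variables (n : nat) (q : M3 -> 'M[R[i]]_n) (B : R) (x : 'I_n -> R * R).
Hypothesis q1 : q 1%:M = 1%:M.
Hypothesis qM : forall g h, SU3 g -> SU3 h -> q (g *m h) = q g *m q h.
Hypothesis qB : forall g, SU3 g -> N (q g) <= B.
Hypothesis qT : forall s t,
  q (tor s t) = diag_mx (\row_a cis ((x a).1 * s + (x a).2 * t)).

Let crhoZ := crhoZ q1 qM qB qT.
Let crhoB := crhoB q1 qM qB qT.
Let crho_sum := crho_sum q1 qM qB qT.
Let crho_Ad := crho_Ad q1 qM qB qT.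
Let crho_bracket := crho_bracket q1 qM qB qT.

Definition erho (y : 'I_3 * 'I_3) := crho q (E y.1 y.2).

(** [E j k] and [E k j] are dual for the trace form of gl(3, C). As [crho] kills the scalars, this
    is the quadratic Casimir operator of sl(3, C). *)
Definition casimir := \sum_j \sum_k erho (j, k) *m erho (k, j).

Lemma crho_conj_delta g j k : SU3 g ->
  q g *m erho (j, k) *m q (invmx g) =
  \sum_y (g y.1 j * invmx g k y.2) *: erho y.
Proof.
move=> hg; rewrite /erho -crho_Ad// (matrix_sum_delta (g *m _ *m _)) pair_bigA /=.
rewrite crho_sum; apply: eq_bigr => -[a b] _ /=.
by rewrite mul_delta_entry crhoZ.
Qed.

(** Conjugation acts on one index of each matrix unit by [g] and on the other by its inverse;
    summation over [j] and [k] contracts the two. *)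
Lemma casimir_conj g : SU3 g -> q g *m casimir *m q (invmx g) = casimir.
Proof.
move=> hg.
have -> : q g *m casimir *m q (invmx g) = \sum_j \sum_k
   (\sum_y (g y.1 j * invmx g k y.2) *: erho y) *m
   (\sum_z (g z.1 k * invmx g j z.2) *: erho z).
  rewrite /casimir mulmx_sumr mulmx_suml; apply: eq_bigr => j _.
  rewrite mulmx_sumr mulmx_suml; apply: eq_bigr => k _.
  rewrite -!crho_conj_delta// !mulmxA; congr (_ *m _); rewrite -!mulmxA; congr (_ *m (_ *m _)).
  by rewrite mulmxA rep_Vl// mul1mx.
have -> : \sum_j \sum_k (\sum_y (g y.1 j * invmx g k y.2) *: erho y) *m
     (\sum_z (g z.1 k * invmx g j z.2) *: erho z) =
   \sum_y \sum_z (\sum_j \sum_k (g y.1 j * invmx g j z.2) * (invmx g k y.2 * g z.1 k)) *: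
     (erho y *m erho z).
  rewrite pair_bigA /=.
  under eq_bigr => p _ do rewrite mulmx_suml.
  rewrite exchange_big /=; apply: eq_bigr => y _.
  under eq_bigr => p _ do rewrite mulmx_sumr.
  rewrite exchange_big /=; apply: eq_bigr => z _.
  rewrite pair_bigA /= scaler_suml; apply: eq_bigr => p _.
  by rewrite -scalemxAl -scalemxAr scalerA; congr (_ *: _); ring.
have gg a b : \sum_j g a j * invmx g j b = (a == b)%:R.
  by have /matrixP/(_ a b) := SU3_mulmxV hg; rewrite !mxE.
rewrite [RHS]/casimir [RHS]pair_bigA /=; apply: eq_bigr => -[a b] _ /=.
rewrite (bigD1 (b, a))//= [X in _ + X]big1 ?addr0; last first.
  move=> [c d] /= cd; rewrite -big_distrlr /= gg.
  under [X in _ * X]eq_bigr => k _ do rewrite mulrC.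
  rewrite gg; case: (eqVneq a d) cd => [->|_] cd; last by rewrite mul0r scale0r.
  by case: (eqVneq c b) cd => [->|_]; rewrite ?eqxx// mulr0 scale0r.
rewrite -big_distrlr /= gg.
under [X in _ * X]eq_bigr => k _ do rewrite mulrC.
by rewrite gg !eqxx mulr1 scale1r.
Qed.

(** The torus acts on [E j k] by the character of [wt j - wt k]. Comparing matrix entries before and
    after conjugation, a non-zero entry forces the characters to agree. *)
Lemma root_weight j k a b : erho (j, k) a b != 0 -> x a = x b + wt j - wt k.
Proof.
move=> h0.
have [] : (x a).1 - (x b).1 - ((wt j).1 - (wt k).1) = 0 /\
    (x a).2 - (x b).2 - ((wt j).2 - (wt k).2) = 0.
  apply: cis_linear_eq1 => s t.
  have /matrixP/(_ a b) := crho_Ad (E j k) (tor_SU3 s t).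
  have -> : tor s t *m E j k *m invmx (tor s t) =
      (cis ((wt j).1 * s + (wt j).2 * t) * cis (- ((wt k).1 * s + (wt k).2 * t))) *: E j k.
    apply/matrixP => c d; rewrite mul_delta_entry torV !torE !mxE.
    have -> : (wt k).1 * - s + (wt k).2 * - t = - ((wt k).1 * s + (wt k).2 * t) by ring.
    case: (eqVneq c j) => [->|_]; case: (eqVneq k d) => _;
      by rewrite ?eqxx ?mulr1n ?mulr0n ?mulr1 ?mulr0 ?mul0r.
  rewrite crhoZ torV !qT mul_diag_mx mul_mx_diag !mxE -/(erho (j, k)) => h.
  have {}h : (cis ((x a).1 * s + (x a).2 * t) * cis ((x b).1 * - s + (x b).2 * - t)) =
      cis ((wt j).1 * s + (wt j).2 * t) * cis (- ((wt k).1 * s + (wt k).2 * t)).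
    by apply: (mulIf h0); rewrite [RHS]h mulrAC.
  rewrite -cisD in h.
  set z := cis _; have : z * (cis ((wt j).1 * s + (wt j).2 * t) * cis (- ((wt k).1 * s + (wt k).2 * t)))
      = cis ((wt j).1 * s + (wt j).2 * t) * cis (- ((wt k).1 * s + (wt k).2 * t)).
    by rewrite -{2}h /z -!cisD; congr cis; ring.
  rewrite -cisD -[RHS]mul1r => /mulIf -> //; exact: cis_neq0.
case: (x a) (x b) (wt j) (wt k) => [a1 a2] [b1 b2] [c1 c2] [d1 d2] /= h1 h2.
have -> : (b1, b2) + (c1, c2) - (d1, d2) = (b1 + c1 - d1, b2 + c2 - d2) by [].
by congr (_, _); lra.
Qed.

Lemma erho_diag j : erho (j, j) = diag_mx (\row_a (hcoord j (x a))%:C).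
Proof.
have aE : adj (E j j) = E j j.
  apply/matrixP => a b; rewrite !mxE; case: eqP => _; case: eqP => _; by rewrite ?rmorph1 ?rmorph0.
(* Torus coordinates of - i (E_jj - 1/3), the skew-Hermitian traceless matrix attached to
   [E j j]. *)
pose s : R := [:: -(2/3); 1/3; 1/3]`_j; pose t : R := [:: -(1/3); -(1/3); 2/3]`_j.
rewrite /erho crhoE /=.
have -> : sk (E j j) = 0 by rewrite skE /sk0 aE subrr scaler0 mxtrace0 mul0r raddf0 subrr.
have h0 : dq q 0 = 0.
  by have := dqZ q1 qM qB qT 0 (su3_0 R); rewrite !scale0r.
have -> : sk (- I *: E j j) = ltor s t.
  have e0 : sk0 (- I *: E j j) = - I *: E j j.
    rewrite /sk0 adjZ aE (_ : (- I)^*%C = I); last by apply/eqP; rewrite eq_complex /= !oppr0 opprK !eqxx.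
    by rewrite scaleNr -opprD -scaleNr scalerN scaler_half scaleNr.
  rewrite skE e0 mxtraceZ (_ : \tr (E j j) = 1); last first.
    rewrite /mxtrace (bigD1 j)//= mxE !eqxx big1 ?addr0// => k kj.
    by rewrite mxE (negbTE kj).
  apply/matrixP => a b; rewrite !mxE /s /t {s t e0 aE}.
  case: j => [[|[|[|//]]] hj]; case: a => [[|[|[|//]]] ha]; case: b => [[|[|[|//]]] hb];
   rewrite -?val_eqE /= ?mulr1n ?mulr0n; apply/eqP; rewrite eq_complex /= ?oppr0; apply/andP; split; apply/eqP; by field.
rewrite h0 add0r (dq_ltor q1 qM qB qT) /wdiag -linearZ /=; congr diag_mx; apply/rowP => a; rewrite !mxE.
rewrite /hcoord /s /t.
case: j {aE s t} => [[|[|[|//]]] hj] /=; apply/eqP; rewrite eq_complex /= ?oppr0; apply/andP; split; apply/eqP; by field.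
Qed.

(** The diagonal matrix lets sums over weights be handled as traces, so that cyclicity and
    commutators become available. *)
Definition wmx (phi : R * R -> R[i]) : 'M[R[i]]_n := diag_mx (\row_a phi (x a)).

Definition root_trace j k phi := \tr (wmx phi *m erho (j, k) *m erho (k, j)).

Lemma wmx_shift j k phi :
  erho (j, k) *m wmx phi = wmx (fun y => phi (y - wt j + wt k)) *m erho (j, k).
Proof.
apply/matrixP => a b; rewrite mul_mx_diag mul_diag_mx !mxE.
have [->|h] := eqVneq (erho (j, k) a b) 0; first by rewrite mulr0 mul0r.
have e (u v w : R * R) : u + v - w - v + w = u.
  by rewrite -[u + v - w]addrA [v - w]addrC addrA addrK subrK.
by rewrite (root_weight h) e mulrC.
Qed.

Lemma root_trace_swap j k phi :
  root_trace k j phi = root_trace j k (fun y => phi (y - wt j + wt k)).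
Proof.
by rewrite /root_trace -wmx_shift -!mulmxA [RHS]mxtrace_mulC -!mulmxA.
Qed.

(** The commutator of opposite root vectors is the coroot [E j j - E k k], which acts on weight
    vectors through [hcoord]. *)
Lemma root_trace_diff j k phi :
  root_trace j k phi - root_trace k j phi =
  \sum_a phi (x a) * (hcoord j (x a) - hcoord k (x a))%:C.
Proof.
rewrite /root_trace -raddfB /= -!mulmxA -mulmxBr -crho_bracket /=.
rewrite !mul_delta_mx crhoB -/(erho (j, j)) -/(erho (k, k)) !erho_diag -raddfB /=.
rewrite /wmx mulmx_diag mxtrace_diag; apply: eq_bigr => a _.
by rewrite !mxE rmorphB.
Qed.

Lemma casimir_relation c phi : casimir = c%:M ->
  \sum_j \sum_k root_trace j k phi = c * \sum_a phi (x a).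
Proof.
move=> hc; have : \tr (wmx phi *m casimir) = c * \sum_a phi (x a).
  rewrite hc mul_mx_scalar mxtraceZ /wmx mxtrace_diag; congr (_ * _).
  by apply: eq_bigr => a _; rewrite mxE.
move=> <-; rewrite /casimir mulmx_sumr raddf_sum; apply: eq_bigr => j _.
rewrite mulmx_sumr raddf_sum; apply: eq_bigr => k _.
by rewrite /root_trace mulmxA.
Qed.

Lemma root_trace_diag j phi :
  root_trace j j phi = \sum_a phi (x a) * (hcoord j (x a) ^+ 2)%:C.
Proof.
rewrite /root_trace erho_diag /wmx !mulmx_diag mxtrace_diag; apply: eq_bigr => a _.
by rewrite !mxE -mulrA -rmorphM.
Qed.

(** [f] is the action of a Weyl group element on torus coordinates and [w] its transpose on weights.
    The matrix [q g] intertwines the two torus actions, so it conjugates [wmx phi] to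
    [wmx (phi \o w)] and the traces agree. *)
Lemma weight_sum_invariant (g : M3) (f : R * R -> R * R) (w : R * R -> R * R)
    (phi : R * R -> R[i]) :
  SU3 g -> (forall s t, g *m tor s t *m invmx g = tor (f (s, t)).1 (f (s, t)).2) ->
  (forall y s t, y.1 * (f (s, t)).1 + y.2 * (f (s, t)).2 = (w y).1 * s + (w y).2 * t) ->
  \sum_a phi (x a) = \sum_a phi (w (x a)).
Proof.
move=> hg hf hw.
have key a b : q g a b != 0 -> x b = w (x a).
  move=> h0; suff [h1 h2] : (x b).1 - (w (x a)).1 = 0 /\ (x b).2 - (w (x a)).2 = 0.
    by case: (x b) (w (x a)) h1 h2 => [b1 b2] [c1 c2] /= h1 h2; congr (_, _); lra.
  apply: cis_linear_eq1 => s t.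
  have : q g *m q (tor s t) = q (tor (f (s, t)).1 (f (s, t)).2) *m q g.
    rewrite -!qM//; try exact: tor_SU3.
    by rewrite -hf -mulmxA SU3_mulVmx// mulmx1.
  rewrite !qT => /matrixP/(_ a b); rewrite mul_mx_diag mul_diag_mx !mxE mulrC hw => /(mulIf h0) h.
  have -> : ((x b).1 - (w (x a)).1) * s + ((x b).2 - (w (x a)).2) * t =
     ((x b).1 * s + (x b).2 * t) + - ((w (x a)).1 * s + (w (x a)).2 * t) by ring.
  by rewrite cisD h mulrC cisNK.
have h : q g *m wmx phi *m q (invmx g) = wmx (phi \o w).
  have -> : q g *m wmx phi = wmx (phi \o w) *m q g.
    apply/matrixP => a b; rewrite mul_mx_diag mul_diag_mx !mxE /=.
    have [->|/key ->] := eqVneq (q g a b) 0; first by rewrite mulr0 mul0r.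
    by rewrite mulrC.
  by rewrite -mulmxA rep_Vr// mulmx1.
have : \tr (q g *m wmx phi *m q (invmx g)) = \tr (wmx phi).
  by rewrite mxtrace_mulC mulmxA rep_Vl// mul1mx.
rewrite h /wmx !mxtrace_diag => h'.
transitivity (\sum_a (\row_a0 phi (x a0) : 'rV_n) 0 a).
  by apply: eq_bigr => a _; rewrite mxE.
by rewrite -h'; apply: eq_bigr => a _; rewrite mxE.
Qed.

Lemma tor_reflect1 s t :
  wperm (tperm 0 1) *m tor s t *m invmx (wperm (tperm 0 1)) = tor (t - s) t.
Proof.
rewrite wperm_conj; congr diag_mx; apply/rowP => j; rewrite !mxE permE /=.
by case: j => [[|[|[|//]]] h] /=; rewrite ?mxE /=; congr cis; ring.
Qed.

Lemma tor_reflect2 s t :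
  wperm (tperm 1 2%:R) *m tor s t *m invmx (wperm (tperm 1 2%:R)) = tor s (s - t).
Proof.
rewrite wperm_conj; congr diag_mx; apply/rowP => j; rewrite !mxE permE /=.
by case: j => [[|[|[|//]]] h] /=; rewrite ?mxE /=; congr cis; ring.
Qed.

Lemma weight_sum_reflect1 (phi : R * R -> R[i]) :
  \sum_a phi (x a) = \sum_a phi (- (x a).1, (x a).1 + (x a).2).
Proof.
apply: (@weight_sum_invariant (wperm (tperm 0 1)) (fun u => (u.2 - u.1, u.2))
  (fun y => (- y.1, y.1 + y.2))).
- exact: wperm_SU3.
- by move=> s t; rewrite tor_reflect1.
- by move=> y s t /=; ring.
Qed.

Lemma weight_sum_reflect2 (phi : R * R -> R[i]) :
  \sum_a phi (x a) = \sum_a phi ((x a).1 + (x a).2, - (x a).2).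
Proof.
apply: (@weight_sum_invariant (wperm (tperm 1 2%:R)) (fun u => (u.1, u.1 - u.2))
  (fun y => (y.1 + y.2, - y.2))).
- exact: wperm_SU3.
- by move=> s t; rewrite tor_reflect2.
- by move=> y s t /=; ring.
Qed.

End WeightStructure.

(** * The Weyl character formula *)

Section WeylNumerator.
Variable R : realType.
Implicit Types (phi : R * R -> R[i]) (y z : R * R).

(* The alternating sum of phi over the translates of y by the Weyl orbit of rho. *)
Definition rho_alt phi y : R[i] :=
  phi (y.1 + 1, y.2 + 1) - phi (y.1 - 1, y.2 + 2) - phi (y.1 + 2, y.2 - 1)
  + phi (y.1 - 2, y.2 + 1) + phi (y.1 + 1, y.2 - 2) - phi (y.1 - 1, y.2 - 1).

(** Squared length normalized so that roots have squared length 2. That of rho is also 2, which is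
    the constant subtracted in [x_casimir]. *)
Definition nrm y : R := 2 / 3 * (y.1 ^+ 2 + y.1 * y.2 + y.2 ^+ 2).

Definition refl1 y := (- y.1, y.1 + y.2).
Definition refl2 y := (y.1 + y.2, - y.2).

Lemma refl1K : involutive refl1.
Proof. by case=> a b; rewrite /refl1 /= opprK addrA addNr add0r. Qed.

Lemma refl2K : involutive refl2.
Proof. by case=> a b; rewrite /refl2 /= opprK addrK. Qed.

Lemma rho_alt_refl1 phi y : rho_alt (phi \o refl1) y = - rho_alt phi (refl1 y).
Proof.
rewrite /rho_alt /refl1 /=; case: y => a b /=; pose f u v := phi (u, v).
have e u v u' v' : u = u' -> v = v' -> phi (u, v) = f u' v' by move=> -> ->.
rewrite (e (- (a + 1)) _ (- a - 1) (a + b + 2)); [|ring|ring].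
rewrite (e (- (a - 1)) _ (- a + 1) (a + b + 1)); [|ring|ring].
rewrite (e (- (a + 2)) _ (- a - 2) (a + b + 1)); [|ring|ring].
rewrite (e (- (a - 2)) _ (- a + 2) (a + b - 1)); [|ring|ring].
rewrite (e (- (a + 1)) _ (- a - 1) (a + b - 1)); [|ring|ring].
rewrite (e (- (a - 1)) _ (- a + 1) (a + b - 2)); [|ring|ring].
rewrite /f; ring.
Qed.

Lemma rho_alt_refl2 phi y : rho_alt (phi \o refl2) y = - rho_alt phi (refl2 y).
Proof.
rewrite /rho_alt /refl2 /=; case: y => a b /=; pose f u v := phi (u, v).
have e u v u' v' : u = u' -> v = v' -> phi (u, v) = f u' v' by move=> -> ->.
rewrite (e _ (- (b + 1)) (a + b + 2) (- b - 1)); [|ring|ring].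
rewrite (e _ (- (b + 2)) (a + b + 1) (- b - 2)); [|ring|ring].
rewrite (e _ (- (b - 1)) (a + b + 1) (- b + 1)); [|ring|ring].
rewrite (e _ (- (b + 1)) (a + b - 1) (- b - 1)); [|ring|ring].
rewrite (e _ (- (b - 2)) (a + b - 1) (- b + 2)); [|ring|ring].
rewrite (e _ (- (b - 1)) (a + b - 2) (- b + 1)); [|ring|ring].
rewrite /f; ring.
Qed.

Variables (n : nat) (x : 'I_n -> R * R).

(** The pairing of [phi] with the product of the character and the Weyl denominator; [wsum (ind z)]
    is the coefficient of e^z in this product. *)
Definition wsum phi := \sum_a rho_alt phi (x a).

Lemma wsumD phi psi : wsum (fun y => phi y + psi y) = wsum phi + wsum psi.
Proof.
rewrite /wsum -big_split /=; apply: eq_bigr => a _.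
rewrite /rho_alt; ring.
Qed.

Lemma wsumZ k phi : wsum (fun y => k * phi y) = k * wsum phi.
Proof.
rewrite /wsum mulr_sumr; apply: eq_bigr => a _.
rewrite /rho_alt; ring.
Qed.

Definition wpoints a : seq (R * R) :=
  [:: ((x a).1 + 1, (x a).2 + 1); ((x a).1 - 1, (x a).2 + 2);
      ((x a).1 + 2, (x a).2 - 1); ((x a).1 - 2, (x a).2 + 1);
      ((x a).1 + 1, (x a).2 - 2); ((x a).1 - 1, (x a).2 - 1)].

Lemma eq_wsum phi psi : (forall a, {in wpoints a, phi =1 psi}) -> wsum phi = wsum psi.
Proof.
move=> h; apply: eq_bigr => a _; rewrite /rho_alt.
by rewrite !(h a) // /wpoints !inE ?eqxx ?orbT.
Qed.

Definition ind z y : R[i] := (y == z)%:R.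

Lemma wsum_points (L : seq (R * R)) phi : uniq L ->
  (forall a, {subset wpoints a <= L}) ->
  wsum phi = \sum_(z <- L) phi z * wsum (ind z).
Proof.
move=> uL hL.
have -> : wsum phi = wsum (fun y => \sum_(z <- L) phi z * ind z y).
  apply: eq_wsum => a y /hL yL; rewrite (bigD1_seq y)//= big1 ?addr0; last first.
    by move=> z zy; rewrite /ind eq_sym (negbTE zy) mulr0.
  by rewrite /ind eqxx mulr1.
elim: L {uL hL} => [|z L IH]; last first.
  rewrite big_cons -IH -wsumZ -wsumD; apply: eq_bigr => a _.
  by rewrite /rho_alt !big_cons.
rewrite big_nil /wsum big1// => a _.
by rewrite /rho_alt !big_nil; ring.
Qed.

Lemma wsum_ind_neq0 z : wsum (ind z) != 0 -> exists a, z \in wpoints a.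
Proof.
move=> h; apply: contrapT => hn; move/eqP: h; apply.
rewrite (@eq_wsum _ (fun=> 0 * 0)); first by rewrite wsumZ mul0r.
move=> a y ya; rewrite /ind mul0r; case: eqP => // yz; exfalso; apply: hn.
by exists a; rewrite -yz.
Qed.

Hypothesis x_refl1 : forall phi, \sum_a phi (x a) = \sum_a phi (refl1 (x a)).
Hypothesis x_refl2 : forall phi, \sum_a phi (x a) = \sum_a phi (refl2 (x a)).
Variable c : R[i].
Hypothesis x_casimir : forall phi,
  wsum (fun y => (nrm y - 2)%:C * phi y) = c * wsum phi.

Lemma wsum_refl1 phi : wsum (phi \o refl1) = - wsum phi.
Proof.
rewrite /wsum x_refl1 -sumrN; apply: eq_bigr => a _.
by rewrite rho_alt_refl1 refl1K.
Qed.

Lemma wsum_refl2 phi : wsum (phi \o refl2) = - wsum phi.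
Proof.
rewrite /wsum x_refl2 -sumrN; apply: eq_bigr => a _.
by rewrite rho_alt_refl2 refl2K.
Qed.

Lemma ind_inv (f : R * R -> R * R) z : involutive f -> ind (f z) = ind z \o f.
Proof.
by move=> fK; apply/funext => y; rewrite /ind /= (inv_eq fK).
Qed.

Lemma wsum_ind_refl1 z : wsum (ind (refl1 z)) = - wsum (ind z).
Proof. by rewrite (ind_inv _ refl1K) wsum_refl1. Qed.

Lemma wsum_ind_refl2 z : wsum (ind (refl2 z)) = - wsum (ind z).
Proof. by rewrite (ind_inv _ refl2K) wsum_refl2. Qed.

(** The Casimir relation at an indicator function: multiplication by [nrm z - 2] and by [c] agree on
    the coefficient at [z]. *)
Lemma wsum_ind_nrm z : wsum (ind z) != 0 -> (nrm z - 2)%:C = c.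
Proof.
move=> h; apply: (mulIf h); rewrite -x_casimir -wsumZ; apply: eq_wsum => a y _.
by rewrite /ind; case: eqP => [->|]; rewrite ?mulr0.
Qed.

Variable x0 : R * R.
Hypothesis x0_ge : 0 <= x0.1 /\ 0 <= x0.2.
Hypothesis x0_top : forall a, exists k l : R, [/\ 0 <= k, 0 <= l &
  x0 = ((x a).1 + 2 * k - l, (x a).2 - k + 2 * l)].

Let lam : R * R := (x0.1 + 1, x0.2 + 1).
Let m0 : R[i] := \sum_a (x a == x0)%:R.

(** The increments of [k] and [l] in the six cases are the simple-root coefficients of rho - w
    rho. *)
Lemma wpoints_top a y : y \in wpoints a -> exists k l : R, [/\ 0 <= k, 0 <= l &
  lam = (y.1 + 2 * k - l, y.2 - k + 2 * l)].
Proof.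
have [k [l [k0 l0 e]]] := x0_top a; rewrite /wpoints !inE /lam e /=.
move=> /or4P[/eqP->|/eqP->|/eqP->|/or3P[/eqP->|/eqP->|/eqP->]] /=.
- by exists k, l; split=> //; congr (_, _); ring.
- by exists (k + 1), l; split; [lra|lra|congr (_, _); ring].
- by exists k, (l + 1); split; [lra|lra|congr (_, _); ring].
- by exists (k + 2), (l + 1); split; [lra|lra|congr (_, _); ring].
- by exists (k + 1), (l + 2); split; [lra|lra|congr (_, _); ring].
- by exists (k + 2), (l + 2); split; [lra|lra|congr (_, _); ring].
Qed.

(** A translate by w rho with w non-trivial lies strictly below [lam], so each weight equal to [x0]
    contributes exactly one term. *)
Lemma wsum_ind_top : wsum (ind lam) = m0.
Proof.
apply: eq_bigr => a _; have [k [l [k0 l0 e]]] := x0_top a.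
rewrite /rho_alt /ind /lam !xpair_eqE.
have -> : (x a == x0) = ((x a).1 + 1 == x0.1 + 1) && ((x a).2 + 1 == x0.2 + 1).
  by rewrite !(inj_eq (addIr 1)) -xpair_eqE -!surjective_pairing.
rewrite e /=; set u := (x a).1; set v := (x a).2.
have h r s : (r = u + 2 * k - l + 1 -> s = v - k + 2 * l + 1 -> False) ->
    ((r == u + 2 * k - l + 1) && (s == v - k + 2 * l + 1))%:R = 0 :> R[i].
  by move=> H; case: eqP => // h1; case: eqP => // h2; case: (H h1 h2).
rewrite !(h (u - _)) ?(h (u + 2)) ?(h _ (v - _)) ?subr0 ?addr0//; by move=> *; lra.
Qed.

(** [lam - z] is a non-negative combination of simple roots, and both points have the same length
    because both carry non-zero coefficients. As [z] is dominant, its inner product with [lam - z]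
    is non-negative, so [lam - z] has length 0. *)
Lemma wsum_ind_dominant z : m0 != 0 -> wsum (ind z) != 0 ->
  0 <= z.1 -> 0 <= z.2 -> z = lam.
Proof.
rewrite -wsum_ind_top => /wsum_ind_nrm hl hz z1 z2.
have := wsum_ind_nrm hz; rewrite -hl => -[/addIr].
have [a /wpoints_top[k [l [k0 l0 ->]]]] := wsum_ind_neq0 hz.
case: z z1 z2 {hz hl} => u v /= u0 v0; rewrite /nrm /= => e.
(* Twice the inner product of [z] with the difference, plus the squared length of the difference. *)
have e2 : 2 * (k * u + l * v) + 2 * (k ^+ 2 - k * l + l ^+ 2) = 0.
  have -> : 2 * (k * u + l * v) + 2 * (k ^+ 2 - k * l + l ^+ 2) =
    2 / 3 * ((u + 2 * k - l) ^+ 2 + (u + 2 * k - l) * (v - k + 2 * l) + (v - k + 2 * l) ^+ 2)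
     - 2 / 3 * (u ^+ 2 + u * v + v ^+ 2) by field.
  by rewrite -e subrr.
have ku : 0 <= k * u by exact: mulr_ge0.
have lv : 0 <= l * v by exact: mulr_ge0.
have sq : (k - l) ^+ 2 + k ^+ 2 + l ^+ 2 <= 0 by rewrite sqrrB -mulr_natr; nra.
have kk : k ^+ 2 <= 0 by have := sqr_ge0 (k - l); have := sqr_ge0 l; lra.
have ll : l ^+ 2 <= 0 by have := sqr_ge0 (k - l); have := sqr_ge0 k; lra.
have k00 : k = 0 by apply/eqP; rewrite -sqrf_eq0 eq_le kk sqr_ge0.
have l00 : l = 0 by apply/eqP; rewrite -sqrf_eq0 eq_le ll sqr_ge0.
by rewrite k00 l00 !mulr0 !subr0 !addr0.
Qed.

Definition orbit_of y : seq (R * R) :=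
  [:: (y.1, y.2); (- y.1, y.1 + y.2); (y.1 + y.2, - y.2);
      (- (y.1 + y.2), y.1); (y.2, - (y.1 + y.2)); (- y.2, - y.1)].

(** By antisymmetry the coefficient stays non-zero under reflections, and at most three simple ones
    make [z] dominant. The cases are the six chambers, told apart by the signs of [z.1], [z.2] and
    their sum. *)
Lemma wsum_ind_support z : m0 != 0 -> wsum (ind z) != 0 -> z \in orbit_of lam.
Proof.
move=> hm hz.
have r1 y : wsum (ind y) != 0 -> wsum (ind (refl1 y)) != 0 by rewrite wsum_ind_refl1 oppr_eq0.
have r2 y : wsum (ind y) != 0 -> wsum (ind (refl2 y)) != 0 by rewrite wsum_ind_refl2 oppr_eq0.
have dom := wsum_ind_dominant hm.
have [z1|z1] := leP 0 z.1; have [z2|z2] := leP 0 z.2.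
- by rewrite -(dom z hz z1 z2) /orbit_of -surjective_pairing inE eqxx.
- have [zz|zz] := leP 0 (z.1 + z.2).
    have /= e := dom _ (r2 _ hz) zz; rewrite oppr_ge0 in e.
    by rewrite -(e (ltW z2)) /orbit_of /= opprK addrK -surjective_pairing !inE eqxx !orbT.
  have /= e := dom _ (r1 _ (r2 _ hz)); rewrite oppr_ge0 addrK in e.
  rewrite -(e (ltW zz) z1) /orbit_of /= addrK !inE.
  have -> : - (- (z.1 + z.2) + z.1) = z.2 by ring.
  by rewrite -surjective_pairing eqxx !orbT.
- have [zz|zz] := leP 0 (z.1 + z.2).
    have /= e := dom _ (r1 _ hz); rewrite oppr_ge0 in e.
    by rewrite -(e (ltW z1) zz) /orbit_of /= addKr opprK -surjective_pairing !inE eqxx !orbT.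
  have /= e := dom _ (r2 _ (r1 _ hz)); rewrite oppr_ge0 addKr in e.
  rewrite -(e z2 (ltW zz)) /orbit_of /= addKr !inE.
  have -> : - (z.2 - (z.1 + z.2)) = z.1 by ring.
  by rewrite -surjective_pairing eqxx !orbT.
- have [zz|zz] := leP 0 (z.1 + z.2); first by have := z1; have := z2; lra.
  have /= e := dom _ (r1 _ (r2 _ (r1 _ hz))); rewrite !oppr_ge0 addKr in e.
  have {}e : (- z.2, - z.1) = lam.
    rewrite -e; [|exact: ltW|by move: z1 z2; lra].
    by rewrite /refl1 /refl2 /=; congr (_, _); ring.
  by rewrite -e /orbit_of /= !opprK -surjective_pairing !inE eqxx !orbT.
Qed.

Lemma weyl_numerator phi : m0 != 0 -> wsum phi = m0 *
  (phi (lam.1, lam.2) - phi (- lam.1, lam.1 + lam.2) - phi (lam.1 + lam.2, - lam.2)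
   + phi (- (lam.1 + lam.2), lam.1) + phi (lam.2, - (lam.1 + lam.2))
   - phi (- lam.2, - lam.1)).
Proof.
move=> hm.
pose L := undup (flatten [seq wpoints a | a <- enum 'I_n] ++ orbit_of lam).
rewrite (@wsum_points L); first last.
- move=> a y ya; rewrite mem_undup mem_cat; apply/orP; left.
  by apply/flattenP; exists (wpoints a) => //; apply: map_f; rewrite mem_enum.
- exact: undup_uniq.
rewrite (bigID (mem (orbit_of lam)))/= [X in _ + X]big1 ?addr0; last first.
  move=> z zO; apply/eqP; rewrite mulf_eq0; apply/orP; right.
  by apply: contraNT zO; exact: wsum_ind_support.
(* Strict dominance of [lam] makes the six points of its orbit distinct. *)
have [l1 l2] : 0 < lam.1 /\ 0 < lam.2 by rewrite /lam /=; have := x0_ge; lra.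
have uO : uniq (orbit_of lam).
  move: l1 l2; rewrite /orbit_of /lam /= !inE !xpair_eqE !negb_or => l1 l2.
  by do ! [apply/andP; split] => //; apply/negP => /andP[/eqP h1 /eqP h2]; move: l1 l2 h1 h2; lra.
rewrite -big_filter (perm_big (orbit_of lam)); last first.
  apply: uniq_perm => //; first by rewrite filter_uniq ?undup_uniq.
  by move=> y; rewrite mem_filter mem_undup mem_cat; case: (y \in orbit_of lam); rewrite ?orbT ?andbF.
have M0 : wsum (ind (lam.1, lam.2)) = m0 by rewrite -surjective_pairing wsum_ind_top.
have M1 : wsum (ind (- lam.1, lam.1 + lam.2)) = - m0 by rewrite -wsum_ind_top -wsum_ind_refl1.
have M2 : wsum (ind (lam.1 + lam.2, - lam.2)) = - m0 by rewrite -wsum_ind_top -wsum_ind_refl2.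
have M3 : wsum (ind (- (lam.1 + lam.2), lam.1)) = m0.
  by rewrite -[RHS]opprK -M2 -wsum_ind_refl1; congr (wsum (ind (_, _))); rewrite /= addrK.
have M4 : wsum (ind (lam.2, - (lam.1 + lam.2))) = m0.
  by rewrite -[RHS]opprK -M1 -wsum_ind_refl2; congr (wsum (ind (_, _))); rewrite /= addKr.
have M5 : wsum (ind (- lam.2, - lam.1)) = - m0.
  by rewrite -M4 -wsum_ind_refl1; congr (wsum (ind (_, _))); rewrite /=; ring.
rewrite /lam /= in M0 M1 M2 M3 M4 M5 *.
rewrite /orbit_of /= !big_cons big_nil M0 M1 M2 M3 M4 M5; ring.
Qed.

End WeylNumerator.

(** * The Casimir relation for the Weyl numerator *)

Section CharacterFormula.
Variable R : realType.
Local Notation N := (@mxnorm1 R _ _).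
Local Notation M3 := 'M[R[i]]_3.
Variables (n : nat) (q : M3 -> 'M[R[i]]_n) (B : R) (x : 'I_n -> R * R).
Hypothesis q1 : q 1%:M = 1%:M.
Hypothesis qM : forall g h, SU3 g -> SU3 h -> q (g *m h) = q g *m q h.
Hypothesis qB : forall g, SU3 g -> N (q g) <= B.
Hypothesis qT : forall s t,
  q (tor s t) = diag_mx (\row_a cis ((x a).1 * s + (x a).2 * t)).
Hypothesis q_Schur : forall A, (forall g, SU3 g -> q g *m A = A *m q g) ->
  exists c, A = c%:M.

Let swap := root_trace_swap q1 qM qB qT.
Let diff := root_trace_diff q1 qM qB qT.

Lemma root_traceB j k phi psi :
  root_trace q x j k (fun y => phi y - psi y) =
  root_trace q x j k phi - root_trace q x j k psi.
Proof.
have h : wmx x (fun y => phi y - psi y) = wmx x phi - wmx x psi.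
  by rewrite /wmx -raddfB /=; congr diag_mx; apply/rowP => a; rewrite !mxE.
rewrite /root_trace h; move: (wmx _ _) (wmx _ _) (erho _ _) (erho _ _) => W W' U V.
by rewrite !mulmxBl raddfB.
Qed.

(** For a difference along the root, cyclicity turns the shifted term into the trace of the opposite
    root, and the commutator evaluates the remainder; the unknown traces of [psi] cancel. *)
Lemma root_trace_telescope j k phi psi :
  (forall y, phi y = psi y - psi (y - wt R j + wt R k)) ->
  root_trace q x j k phi + root_trace q x k j phi =
  \sum_a (2 * psi (x a) - phi (x a)) * (hcoord j (x a) - hcoord k (x a))%:C.
Proof.
move=> h.
have h1 : root_trace q x j k phi = \sum_a psi (x a) * (hcoord j (x a) - hcoord k (x a))%:C.
  rewrite -(diff j k psi) (swap j k psi) -(root_traceB j k psi).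
  by congr root_trace; apply/funext => y; exact: h.
have -> : root_trace q x k j phi =
    root_trace q x j k phi - \sum_a phi (x a) * (hcoord j (x a) - hcoord k (x a))%:C.
  by rewrite -diff opprB addrC subrK.
rewrite h1 addrA -big_split -sumrB /=; apply: eq_bigr => a _; ring.
Qed.

Lemma casimir_scalar : exists c, casimir q = c%:M.
Proof.
apply: q_Schur => g hg.
by rewrite -{2}(casimir_conj q1 qM qB qT hg) -!mulmxA rep_Vl// mulmx1.
Qed.

Lemma wsum_casimir c phi : casimir q = c%:M ->
  wsum x (fun y => (nrm y - 2)%:C * phi y) = c * wsum x phi.
Proof.
move=> /(casimir_relation x (rho_alt phi)); rewrite -/(wsum x phi) => <-.
rewrite sum_ord3 !sum_ord3 !(root_trace_diag q1 qM qB qT).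
pose f u v := phi (u, v).
have e u v u' v' : u = u' -> v = v' -> phi (u, v) = f u' v' by move=> -> ->.
(* Each function pairs [phi] with a translate of e^rho times the factors 1 - e^(-beta) of the two
   other positive roots; the missing factor is the difference that telescopes. *)
pose psi01 y := phi (y.1 + 1, y.2 + 1) - phi (y.1 + 2, y.2 - 1) - phi y + phi (y.1 + 1, y.2 - 2).
pose psi12 y := phi (y.1 + 1, y.2 + 1) - phi (y.1 - 1, y.2 + 2) - phi y + phi (y.1 - 2, y.2 + 1).
pose psi02 y := phi (y.1 + 1, y.2 + 1) + phi y - phi (y.1 - 1, y.2 + 2) - phi (y.1 + 2, y.2 - 1).
have t01 := @root_trace_telescope 0 1 (rho_alt phi) psi01.
have t12 := @root_trace_telescope 1 2%:R (rho_alt phi) psi12.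
have t02 := @root_trace_telescope 0 2%:R (rho_alt phi) psi02.
have {}t01 := t01 _; have {}t12 := t12 _; have {}t02 := t02 _.
have re (T : 'I_3 -> 'I_3 -> R[i]) d0 d1 d2 : d0 + T 0 1 + T 0 2%:R + (T 1 0 + d1 + T 1 2%:R) +
    (T 2%:R 0 + T 2%:R 1 + d2) = d0 + d1 + d2 +
    ((T 0 1 + T 1 0) + (T 1 2%:R + T 2%:R 1) + (T 0 2%:R + T 2%:R 0)) by ring.
rewrite (re (fun j k => root_trace q x j k (rho_alt phi))) {re}.
have wE j k a b : (a, b) - wt R j + wt R k =
    (a - (wt R j).1 + (wt R k).1, b - (wt R j).2 + (wt R k).2) by [].
rewrite t01; last first.
  case=> a b; rewrite /rho_alt /psi01 wE /wt /=.
  rewrite (e (a - 1 - 1 + 1) (b - 0 + 1 + 1) (a - 1) (b + 2)); [|ring|ring].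
  rewrite (e (a - 1 - 1 + 2) (b - 0 + 1 - 1) a b); [|ring|ring].
  rewrite (e (a - 1 - 1) (b - 0 + 1) (a - 2) (b + 1)); [|ring|ring].
  rewrite (e (a - 1 - 1 + 1) (b - 0 + 1 - 2) (a - 1) (b - 1)); [|ring|ring].
  rewrite /f; ring.
rewrite t12; last first.
  case=> a b; rewrite /rho_alt /psi12 wE /wt /=.
  rewrite (e (a - -1 + 0 + 1) (b - 1 - 1 + 1) (a + 2) (b - 1)); [|ring|ring].
  rewrite (e (a - -1 + 0 - 1) (b - 1 - 1 + 2) a b); [|ring|ring].
  rewrite (e (a - -1 + 0) (b - 1 - 1) (a + 1) (b - 2)); [|ring|ring].
  rewrite (e (a - -1 + 0 - 2) (b - 1 - 1 + 1) (a - 1) (b - 1)); [|ring|ring].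
  rewrite /f; ring.
rewrite t02; last first.
  case=> a b; rewrite /rho_alt /psi02 wE /wt /=.
  rewrite (e (a - 1 + 0 + 1) (b - 0 - 1 + 1) a b); [|ring|ring].
  rewrite (e (a - 1 + 0) (b - 0 - 1) (a - 1) (b - 1)); [|ring|ring].
  rewrite (e (a - 1 + 0 - 1) (b - 0 - 1 + 2) (a - 2) (b + 1)); [|ring|ring].
  rewrite (e (a - 1 + 0 + 2) (b - 0 - 1 - 1) (a + 1) (b - 2)); [|ring|ring].
  rewrite /f; ring.
(* What remains is an identity at a single weight: diagonal and coroot terms together give |y|^2 -
   |rho|^2 at each of the six translates. *)
rewrite /wsum -!big_split /=; apply: eq_bigr => a _.
rewrite /rho_alt /psi01 /psi12 /psi02 /nrm /hcoord /=.
case: (x a) => u v /=.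
by field.
Qed.

End CharacterFormula.

(** * Estimates for the character *)

Section CharacterBound.
Variable R : realType.
Local Notation nz := (@Normc.normc R).

(** Serves to extend an estimate to points where the omitted sine vanishes: evaluation at
    [e = 1 / k.+1] leaves an error of order 1/k. *)
Lemma lipschitz_le0 (H : R -> R) K b :
  (forall e, 0 < e <= 1 -> H e <= b) -> (forall e, 0 < e <= 1 -> H 0 - H e <= K * e) ->
  H 0 <= b.
Proof.
move=> h1 h2; rewrite -subr_le0; apply: (@le_inv_nat_le0 R _ K) => k.
have e01 : 0 < (k.+1%:R^-1 : R) <= 1 by rewrite invr_gt0 ltr0n invf_le1// ler1n.
by apply: le_trans (h2 _ e01); rewrite lerD2l lerN2 h1.
Qed.

Lemma le_mul3_diff (a b c a' b' c' K M e : R) : 0 <= b <= 1 -> 0 <= c <= 1 ->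
  0 <= a' <= M -> 0 <= b' <= 1 -> 0 <= e -> 0 <= K ->
  a - a' <= K * e -> b - b' <= 2 * e -> c - c' <= 2 * e ->
  a * b * c - a' * b' * c' <= (K + 4 * M) * e.
Proof.
move=> /andP[b0 b1] /andP[c0 c1] /andP[a0 aM] /andP[b0' b1'] e0 K0 ha hb hc.
have -> : a * b * c - a' * b' * c' =
  (a - a') * (b * c) + a' * (c * (b - b')) + a' * (b' * (c - c')) by ring.
have bc : 0 <= b * c <= 1 by rewrite mulr_ge0//= mulr_ile1.
have h1 : (a - a') * (b * c) <= K * e.
  apply: le_trans (ler_wpM2r (andP bc).1 ha) _.
  by rewrite ler_piMr ?mulr_ge0//; case/andP: bc.
have e2 : 0 <= 2 * e by rewrite mulr_ge0.
have aux v w : 0 <= v <= 1 -> w <= 2 * e -> a' * (v * w) <= M * (2 * e).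
  move=> /andP[v0 v1] hw; apply: le_trans (_ : a' * (2 * e) <= _); last exact: ler_wpM2r.
  rewrite ler_wpM2l// (le_trans (ler_wpM2l v0 hw))// ler_piMl//.
have h2 := aux c _ (introT andP (conj c0 c1)) hb.
have h3 := aux b' _ (introT andP (conj b0' b1')) hc.
by lra.
Qed.

Lemma sin_add_neq0 (u e : R) : sin u = 0 -> 0 < e <= 1 -> sin (u + e) != 0.
Proof.
move=> su /andP[e0 e1]; rewrite sinD su mul0r add0r mulf_neq0//.
  by have := cos2Dsin2 u; rewrite su expr0n addr0 => /eqP; apply: contraTneq => ->; rewrite expr0n eq_sym oner_eq0.
by rewrite gt_eqF// sin2_gt0// e0 (le_lt_trans e1)// ltr1n.
Qed.

Lemma abs_sin_lip (u v : R) : `|sin u| - `|sin v| <= 2 * `|(u - v) / 2|.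
Proof.
apply: le_trans (lerB_dist _ _) _.
have := normc_Im (cis u - cis v); rewrite normc_cisB /cis /= => h.
apply: le_trans h _; rewrite ler_pM2l//; exact: norm_sin_le.
Qed.

(** The Weyl numerator for the shifted highest weight [(p, q)], with the terms in the order of
    [orbit_of]; at [(1, 1)] it is the Weyl denominator. *)
Definition alt_sum (p q s t : R) : R[i] :=
  cis (p * s + q * t) - cis (- p * s + (p + q) * t) - cis ((p + q) * s + - q * t)
  + cis (- (p + q) * s + p * t) + cis (q * s + - (p + q) * t) - cis (- q * s + - p * t).

(** Expansion of the product of e^(iw) - e^(-iw) over w = u, v, u + v; two of the eight terms have
    exponent 0 and cancel. *)
Lemma weyl_product (u v : R) :
  nz (cis (2 * u + 2 * v) - cis (2 * u) - cis (2 * v) + cis (- (2 * v)) + cis (- (2 * u))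
      - cis (- (2 * u) - 2 * v)) = 8 * (`|sin u| * `|sin v| * `|sin (u + v)|).
Proof.
have e w : 2 * `|sin w| = nz (cis w - cis (- w)).
  by rewrite normc_cisB (_ : (w - - w) / 2 = w)//; field.
have -> : 8 * (`|sin u| * `|sin v| * `|sin (u + v)|) =
   (2 * `|sin u|) * (2 * `|sin v|) * (2 * `|sin (u + v)|) by ring.
rewrite !e -!Normc.normcM; congr (nz _).
rewrite !(mulrBl, mulrBr) -!cisD.
rewrite (_ : u + v + (u + v) = 2 * u + 2 * v); last by ring.
rewrite (_ : u + - v + (u + v) = 2 * u); last by ring.
rewrite (_ : - u + v + (u + v) = 2 * v); last by ring.
rewrite (_ : - u + - v + (u + v) = 0); last by ring.
rewrite (_ : u + v + - (u + v) = 0); last by ring.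
rewrite (_ : u + - v + - (u + v) = - (2 * v)); last by ring.
rewrite (_ : - u + v + - (u + v) = - (2 * u)); last by ring.
rewrite (_ : - u + - v + - (u + v) = - (2 * u) - 2 * v); last by ring.
ring.
Qed.

Lemma alt_sum_rho (s t : R) : nz (alt_sum 1 1 s t) =
  8 * (`|sin ((2 * s - t) / 2)| * `|sin ((2 * t - s) / 2)| * `|sin ((s + t) / 2)|).
Proof.
have -> : (s + t) / 2 = (2 * s - t) / 2 + (2 * t - s) / 2 by field.
rewrite -weyl_product /alt_sum; congr nz.
rewrite (_ : 2 * ((2 * s - t) / 2) = 2 * s - t); last by field.
rewrite (_ : 2 * ((2 * t - s) / 2) = 2 * t - s); last by field.
have c a b a' : a = b -> a' = cis b -> cis a = a' by move=> -> ->.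
rewrite (_ : 1 * s + 1 * t = 2 * s - t + (2 * t - s)); last by ring.
rewrite (_ : -1 * s + (1 + 1) * t = 2 * t - s); last by ring.
rewrite (_ : (1 + 1) * s + -1 * t = 2 * s - t); last by ring.
rewrite (_ : - (1 + 1) * s + 1 * t = - (2 * s - t)); last by ring.
rewrite (_ : 1 * s + - (1 + 1) * t = - (2 * t - s)); last by ring.
rewrite (_ : -1 * s + -1 * t = - (2 * s - t) - (2 * t - s)); last by ring.
ring.
Qed.

(** The principal specialization: at multiples of the half sum of the positive coroots the numerator
    factors like the denominator. *)
Lemma alt_sum_diag (p q s : R) : nz (alt_sum p q s s) =
  8 * (`|sin (p * s / 2)| * `|sin (q * s / 2)| * `|sin ((p + q) * s / 2)|).
Proof.
have -> : (p + q) * s / 2 = p * s / 2 + q * s / 2 by field.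
rewrite -weyl_product /alt_sum; congr nz.
rewrite (_ : 2 * (p * s / 2) = p * s); last by field.
rewrite (_ : 2 * (q * s / 2) = q * s); last by field.
rewrite (_ : - p * s + (p + q) * s = q * s); last by ring.
rewrite (_ : (p + q) * s + - q * s = p * s); last by ring.
rewrite (_ : - (p + q) * s + p * s = - (q * s)); last by ring.
rewrite (_ : q * s + - (p + q) * s = - (p * s)); last by ring.
rewrite (_ : - q * s + - p * s = - (p * s) - q * s); last by ring.
ring.
Qed.

Lemma normc_cisB_nat (a b u : R) k : a - b = k%:R * (2 * u) ->
  nz (cis a - cis b) <= 2 * k%:R * `|sin u|.
Proof.
move=> h; rewrite normc_cisB h -[leRHS]mulrA ler_pM2l//.
rewrite (_ : k%:R * (2 * u) / 2 = k%:R * u); last by field.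
exact: norm_sinM_nat.
Qed.

Lemma normc_three_pairs (z1 z2 z3 z4 z5 z6 w : R[i]) (a b e S : R) :
  nz (z1 - z2) <= 2 * a * S -> nz (z3 - z4) <= 2 * b * S -> nz (z5 - z6) <= 2 * e * S ->
  w = z1 - z2 - (z3 - z4) + (z5 - z6) -> nz w <= 2 * (a + b + e) * S.
Proof.
move=> h1 h2 h3 ->; apply: le_trans (le_normcD _ _) _.
have := le_normcD (z1 - z2) (- (z3 - z4)); rewrite normcN; lra.
Qed.

(** Exponents exchanged by the reflection in a root differ by a multiple of that root. The three
    multiples are p, q and p + q in absolute value, with sum 2 (p + q). *)
Lemma alt_sum_le (p q : nat) (s t S : R) :
  S \in [:: `|sin ((2 * s - t) / 2)|; `|sin ((2 * t - s) / 2)|; `|sin ((s + t) / 2)|] ->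
  nz (alt_sum p%:R q%:R s t) <= 4 * (p%:R + q%:R) * S.
Proof.
set P : R := p%:R; set Q : R := q%:R.
have PQ : (p + q)%N%:R = P + Q :> R by rewrite natrD.
have fin a b c T w : w <= 2 * (a + b + c) * T -> a + b + c = 2 * (P + Q) -> w <= 4 * (P + Q) * T.
  by move=> h e; rewrite (le_trans h)// e; have -> : 2 * (2 * (P + Q)) = 4 * (P + Q) by ring.
rewrite !inE => /or3P[] /eqP ->.
- apply: (fin P (P + Q) Q); last by ring.
  apply: (normc_three_pairs (z1 := cis (P * s + Q * t)) (z2 := cis (- P * s + (P + Q) * t))
    (z3 := cis ((P + Q) * s + - Q * t)) (z4 := cis (- (P + Q) * s + P * t))
    (z5 := cis (Q * s + - (P + Q) * t)) (z6 := cis (- Q * s + - P * t))).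
  + by apply: normc_cisB_nat; rewrite -/P; field.
  + by rewrite -PQ; apply: normc_cisB_nat; rewrite PQ; field.
  + by apply: normc_cisB_nat; rewrite -/Q; field.
  + by rewrite /alt_sum; ring.
- apply: (fin Q (P + Q) P); last by ring.
  apply: (normc_three_pairs (z1 := cis (P * s + Q * t)) (z2 := cis ((P + Q) * s + - Q * t))
    (z3 := cis (- P * s + (P + Q) * t)) (z4 := cis (Q * s + - (P + Q) * t))
    (z5 := cis (- (P + Q) * s + P * t)) (z6 := cis (- Q * s + - P * t))).
  + by apply: normc_cisB_nat; rewrite -/Q; field.
  + by rewrite -PQ; apply: normc_cisB_nat; rewrite PQ; field.
  + by apply: normc_cisB_nat; rewrite -/P; field.
  + by rewrite /alt_sum; ring.
- apply: (fin (P + Q) Q P); last by ring.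
  apply: (normc_three_pairs (z1 := cis (P * s + Q * t)) (z2 := cis (- Q * s + - P * t))
    (z3 := cis (- P * s + (P + Q) * t)) (z4 := cis (- (P + Q) * s + P * t))
    (z5 := cis (Q * s + - (P + Q) * t)) (z6 := cis ((P + Q) * s + - Q * t))).
  + by rewrite -PQ; apply: normc_cisB_nat; rewrite PQ; field.
  + by apply: normc_cisB_nat; rewrite -/Q; field.
  + rewrite -(normcN) opprB; by apply: normc_cisB_nat; rewrite -/P; field.
  + by rewrite /alt_sum; ring.
Qed.

Variables (n : nat) (x : 'I_n -> R * R) (m p q : nat).
Hypothesis m0 : (0 < m)%N.
Hypothesis p0 : (0 < p)%N.
Hypothesis q0 : (0 < q)%N.

Let f (s t : R) : R[i] := \sum_a cis ((x a).1 * s + (x a).2 * t).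

Hypothesis weyl_formula : forall s t : R,
  f s t * alt_sum 1 1 s t = m%:R * alt_sum p%:R q%:R s t.

Let P : R := p%:R.
Let Q : R := q%:R.

Lemma character_le_dim s t : nz (f s t) <= n%:R.
Proof.
rewrite (le_trans (le_normc_sum _ _ _))// (eq_bigr (fun=> 1)) => [|a _]; last exact: normc_cis.
by rewrite sumr_const card_ord.
Qed.

Lemma dim_ge : m%:R * (P * Q * (P + Q)) <= 128 * n%:R.
Proof.
have P0 : 0 < P by rewrite ltr0n.
have Q0 : 0 < Q by rewrite ltr0n.
have PQ0 : 0 < P + Q by exact: addr_gt0.
(* With this choice the sines of the numerator have arguments p / (p + q), q / (p + q) and 1, all in
   the range of [sin_ge_quarter]. *)
pose s := 2 / (P + Q); have s0 : 0 < s by rewrite divr_gt0.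
have /(congr1 nz) := weyl_formula s s.
rewrite !Normc.normcM alt_sum_rho alt_sum_diag normc_nat -/P -/Q.
have pi1 : 1 <= pi / 2 :> R by have [] := pihalf_02_cos_pihalf R; have := pi_ge2 R; lra.
have sge (r : R) : 0 <= r <= 1 -> r / 4 <= `|sin r|.
  move=> /andP[r0 r1]; apply: le_trans (ler_norm _); apply: sin_ge_quarter.
  by rewrite r0 (le_trans r1).
rewrite (_ : P * s / 2 = P / (P + Q)); last by rewrite /s; field; lra.
rewrite (_ : Q * s / 2 = Q / (P + Q)); last by rewrite /s; field; lra.
rewrite (_ : (P + Q) * s / 2 = 1); last by rewrite /s; field; lra.
rewrite (_ : (2 * s - s) / 2 = s / 2); last by field.
rewrite (_ : (s + s) / 2 = s); last by field.
have h1 := sge (P / (P + Q)); have h2 := sge (Q / (P + Q)); have h3 := sge 1.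
have {}h1 := h1 _; have {}h2 := h2 _; have {}h3 := h3 _.
have {}h1 : P / (P + Q) / 4 <= `|sin (P / (P + Q))|.
  by apply: h1; rewrite (divr_ge0 (ltW P0) (ltW PQ0)) ler_pdivrMr// mul1r lerDl ltW.
have {}h2 : Q / (P + Q) / 4 <= `|sin (Q / (P + Q))|.
  by apply: h2; rewrite (divr_ge0 (ltW Q0) (ltW PQ0)) ler_pdivrMr// mul1r lerDr ltW.
have {}h3 : 1 / 4 <= `|sin (1 : R)| by apply: h3; rewrite ler01 lexx.
have k1 : `|sin (s / 2)| <= s / 2.
  by have := norm_sin_le (s / 2); rewrite (@ger0_norm _ (s / 2))// divr_ge0 ?(ltW s0).
have k2 : `|sin s| <= s by have := norm_sin_le s; rewrite (ger0_norm (ltW s0)).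
have fn := character_le_dim s s => e.
have up : nz (f s s) * (8 * (`|sin (s / 2)| * `|sin (s / 2)| * `|sin s|)) <=
    n%:R * (8 * (s / 2 * (s / 2) * s)).
  apply: ler_pM => //; first exact: normc_ge0.
  by rewrite ler_pM2l//; apply: ler_pM => //; apply: ler_pM.
have lo : m%:R * (8 * (P / (P + Q) / 4 * (Q / (P + Q) / 4) * (1 / 4))) <=
    m%:R * (8 * (`|sin (P / (P + Q))| * `|sin (Q / (P + Q))| * `|sin 1|)).
  rewrite ler_wpM2l// ler_pM2l//; apply: ler_pM => //.
    by apply: mulr_ge0; (apply: divr_ge0 => //; apply: divr_ge0; exact: ltW).
  by apply: ler_pM => //; (apply: divr_ge0 => //; apply: divr_ge0; exact: ltW).
(* After multiplication by (p + q)^3 the lower bound is m p q (p + q) / 8 and the upper one 16 n,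
   whence 128. *)
rewrite e in up; have {}up := le_trans lo up.
have := ler_wpM2r (ltW (exprn_gt0 3 PQ0)) up.
have -> : m%:R * (8 * (P / (P + Q) / 4 * (Q / (P + Q) / 4) * (1 / 4))) * (P + Q) ^+ 3 =
   m%:R * (P * Q * (P + Q)) / 8 by field; lra.
have -> : n%:R * (8 * (s / 2 * (s / 2) * s)) * (P + Q) ^+ 3 = 16 * n%:R by rewrite /s; field; lra.
by lra.
Qed.

(** [S1] is a factor of the denominator and, by [alt_sum_le], of the bound for the numerator. It
    cancels, and 4 / 8 leaves 1 / 2. *)
Lemma character_generic s t (S1 S2 S3 : R) : S1 != 0 ->
  S1 \in [:: `|sin ((2 * s - t) / 2)|; `|sin ((2 * t - s) / 2)|; `|sin ((s + t) / 2)|] ->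
  S1 * S2 * S3 = `|sin ((2 * s - t) / 2)| * `|sin ((2 * t - s) / 2)| * `|sin ((s + t) / 2)| ->
  nz (f s t) * S2 * S3 <= m%:R * (P + Q) / 2.
Proof.
move=> S10 hS hp; have := alt_sum_le p q hS.
have /(congr1 nz) := weyl_formula s t; rewrite !Normc.normcM alt_sum_rho -hp normc_nat => e h.
have S1gt : 0 < S1.
  rewrite lt_neqAle eq_sym S10; move: hS; rewrite !inE => /or3P[] /eqP ->; exact: normr_ge0.
have := ler_wpM2l (ler0n R m) h; rewrite -e -/P -/Q => h'.
rewrite -(ler_pM2r S1gt); nra.
Qed.

Lemma character_lip s t s' t' : nz (f s t) - nz (f s' t') <=
  \sum_a (`|(x a).1| * `|s - s'| + `|(x a).2| * `|t - t'|).
Proof.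
have h : nz (f s t) - nz (f s' t') <= nz (f s t - f s' t').
  by rewrite lerBlDr -{1}(subrK (f s' t') (f s t)) le_normcD.
apply: le_trans h _; rewrite /f -sumrB (le_trans (le_normc_sum _ _ _))// ler_sum// => a _.
have -> : cis ((x a).1 * s + (x a).2 * t) - cis ((x a).1 * s' + (x a).2 * t') =
   cis ((x a).1 * s' + (x a).2 * t') * (cis ((x a).1 * (s - s') + (x a).2 * (t - t')) - 1).
  by rewrite mulrBr -cisD mulr1; congr (cis _ - _); ring.
rewrite Normc.normcM normc_cis mul1r (le_trans (normc_cis_sub1_le _))//.
by rewrite (le_trans (ler_normD _ _))// !normrM.
Qed.

(* If the omitted sine vanishes, move along a line on which it does not. *)
Lemma character_perturb (h1 h2 h3 : R -> R -> R) (u v s t : R) :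
  (forall s t, `|sin (h1 s t)| * `|sin (h2 s t)| * `|sin (h3 s t)| =
    `|sin ((2 * s - t) / 2)| * `|sin ((2 * t - s) / 2)| * `|sin ((s + t) / 2)|) ->
  (forall s t, `|sin (h1 s t)| \in
     [:: `|sin ((2 * s - t) / 2)|; `|sin ((2 * t - s) / 2)|; `|sin ((s + t) / 2)|]) ->
  (forall e, h1 (s + u * e) (t + v * e) = h1 s t + e) ->
  (forall e, 0 <= e -> `|h2 s t - h2 (s + u * e) (t + v * e)| <= 2 * e) ->
  (forall e, 0 <= e -> `|h3 s t - h3 (s + u * e) (t + v * e)| <= 2 * e) ->
  nz (f s t) * `|sin (h2 s t)| * `|sin (h3 s t)| <= m%:R * (P + Q) / 2.
Proof.
move=> hp hS e1 e2 e3.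
have [z1|z1] := eqVneq (sin (h1 s t)) 0; last first.
  by apply: (@character_generic s t `|sin (h1 s t)|) => //; rewrite normr_eq0.
pose H e := nz (f (s + u * e) (t + v * e)) * `|sin (h2 (s + u * e) (t + v * e))| *
  `|sin (h3 (s + u * e) (t + v * e))|.
have -> : nz (f s t) * `|sin (h2 s t)| * `|sin (h3 s t)| = H 0 by rewrite /H !mulr0 !addr0.
pose K := \sum_a (`|(x a).1| * `|u| + `|(x a).2| * `|v|).
apply: (@lipschitz_le0 H (K + 4 * n%:R)) => e /andP[e0 e11].
  apply: (@character_generic _ _ `|sin (h1 (s + u * e) (t + v * e))|) => //.
  by rewrite normr_eq0 e1; apply: sin_add_neq0 => //; rewrite e0.
rewrite /H !mulr0 !addr0; apply: le_mul3_diff; rewrite ?normr_ge0 ?sin_max ?normc_ge0//=.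
- exact: character_le_dim.
- exact: ltW.
- by apply: sumr_ge0 => a _; rewrite addr_ge0 ?mulr_ge0.
- apply: le_trans (character_lip _ _ _ _) _; rewrite /K mulr_suml ler_sum// => a _.
  by rewrite !opprD !addNKr !normrN !normrM (ger0_norm (ltW e0)) mulrDl !mulrA.
- apply: le_trans (abs_sin_lip _ _) _; have := e2 _ (ltW e0).
  by rewrite normrM (@ger0_norm _ 2^-1)//; lra.
- apply: le_trans (abs_sin_lip _ _) _; have := e3 _ (ltW e0).
  by rewrite normrM (@ger0_norm _ 2^-1)//; lra.
Qed.

Lemma character_bound s t (S2 S3 : R) :
  (S2, S3) \in [:: (`|sin ((2 * t - s) / 2)|, `|sin ((s + t) / 2)|);
    (`|sin ((2 * s - t) / 2)|, `|sin ((s + t) / 2)|);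
    (`|sin ((2 * s - t) / 2)|, `|sin ((2 * t - s) / 2)|)] ->
  nz (f s t) * S2 * S3 <= 64 * n%:R / (P * Q).
Proof.
move=> hS.
have P0 : 0 < P by rewrite ltr0n.
have Q0 : 0 < Q by rewrite ltr0n.
have h : nz (f s t) * S2 * S3 <= m%:R * (P + Q) / 2.
  have nl (w e : R) : 0 <= e -> `|w| <= 2 -> `|w * e| <= 2 * e.
    by move=> e0 hw; rewrite normrM (ger0_norm e0) ler_wpM2r.
  have n1 : `|2^-1 : R| <= 2 by rewrite ger0_norm//; lra.
  have n2 : `|- 2^-1 : R| <= 2 by rewrite normrN.
  move: hS; rewrite !inE !xpair_eqE => /or3P[] /andP[/eqP -> /eqP ->].
  (* The last two arguments are a direction in which the argument of the omitted sine moves at unit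
     speed and the other two at speed 1/2; the two cases below choose theirs likewise. *)
  - apply: (@character_perturb (fun s t => (2 * s - t) / 2) (fun s t => (2 * t - s) / 2)
      (fun s t => (s + t) / 2) 1 0) => //.
    + by move=> *; rewrite !inE eqxx.
    + by move=> e; field.
    + by move=> e e0; rewrite (_ : _ - _ = 2^-1 * e); [exact: nl|field].
    + by move=> e e0; rewrite (_ : _ - _ = - 2^-1 * e); [exact: nl|field].
  - apply: (@character_perturb (fun s t => (2 * t - s) / 2) (fun s t => (2 * s - t) / 2)
      (fun s t => (s + t) / 2) 0 1) => //.
    + by move=> *; ring.
    + by move=> *; rewrite !inE eqxx orbT.
    + by move=> e; field.
    + by move=> e e0; rewrite (_ : _ - _ = 2^-1 * e); [exact: nl|field].
    + by move=> e e0; rewrite (_ : _ - _ = - 2^-1 * e); [exact: nl|field].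
  - apply: (@character_perturb (fun s t => (s + t) / 2) (fun s t => (2 * s - t) / 2)
      (fun s t => (2 * t - s) / 2) 1 1) => //.
    + by move=> *; ring.
    + by move=> *; rewrite !inE eqxx !orbT.
    + by move=> e; field.
    + by move=> e e0; rewrite (_ : _ - _ = - 2^-1 * e); [exact: nl|field].
    + by move=> e e0; rewrite (_ : _ - _ = - 2^-1 * e); [exact: nl|field].
have PQ0 : 0 < P * Q by exact: mulr_gt0.
rewrite ler_pdivlMr//; have := dim_ge.
have := ler_wpM2r (ltW PQ0) h; lra.
Qed.

End CharacterBound.

(** * Schur's lemma *)

Section Schur.
Variable R : realType.
Local Notation nz := (@Normc.normc R).
Local Notation N := (@mxnorm1 R _ _).
Local Notation M3 := 'M[R[i]]_3.

Lemma exists_eigenvector d (A : 'M[R[i]]_d) : (0 < d)%N ->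
  exists c (v : 'cV[R[i]]_d), v != 0 /\ A *m v = c *: v.
Proof.
move=> d0; have [|c] := closed_rootP (char_poly A^T) _.
  by rewrite size_char_poly; case: d d0 {A}.
rewrite -eigenvalue_root_char => /eigenvalueP[v hv v0]; exists c, v^T; split.
  by apply: contra_neq v0 => h; rewrite -(trmxK v) h trmx0.
by rewrite -[LHS]trmxK trmx_mul trmxK hv linearZ.
Qed.

Lemma Schur_scalar d (p : M3 -> 'M[R[i]]_d) A : irreducible p ->
  (forall g, SU3 g -> p g *m A = A *m p g) -> exists c, A = c%:M.
Proof.
move=> [d0 irr] comm; have [c [v [v0 hv]]] := exists_eigenvector A d0.
pose D := A - c%:M; pose V := lker (linfun (mulmx D : 'cV[R[i]]_d -> 'cV[R[i]]_d)).
have memV w : (w \in V) = (D *m w == 0) by rewrite memv_ker lfunE.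
have hV g w : SU3 g -> w \in V -> p g *m w \in V.
  move=> hg; rewrite !memV /D => /eqP hw.
  by rewrite mulmxA mulmxBl -(comm g hg) -scalar_mxC -mulmxBr -mulmxA hw mulmx0.
exists c; have [V0|VT] := irr V hV.
- have : v \in V by rewrite memV /D mulmxBl hv mul_scalar_mx subrr.
  by rewrite V0 memv0 (negbTE v0).
- apply/eqP; rewrite -subr_eq0 -/D; apply/eqP/matrixP => i j; rewrite [RHS]mxE.
  have : delta_mx j 0 \in V by rewrite VT memvf.
  by rewrite memV -colE => /eqP/matrixP/(_ i 0); rewrite !mxE.
Qed.

Variables (d : nat) (p : M3 -> 'M[R[i]]_d).
Hypothesis p1 : p 1%:M = 1%:M.
Hypothesis pM : forall g h, SU3 g -> SU3 h -> p (g *m h) = p g *m p h.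
Hypothesis pc : forall e : R, 0 < e ->
  exists2 r : R, 0 < r & forall g, SU3 g -> N (g - 1%:M) < r -> N (p g - 1%:M) < e.
Hypothesis p_irr : irreducible p.

(** [k] and [l] are the coordinates of the highest weight itself, so its shift by rho is
    [(k.+1, l.+1)]. Of the simple-root coefficients [u], [v] only the sign is recorded. *)
Definition top_weight (k l : nat) (x : 'I_d -> R * R) :=
  (exists a, x a = (k%:R, l%:R)) /\ forall a, exists u v : R, [/\ 0 <= u, 0 <= v &
    (k%:R, l%:R) = ((x a).1 + 2 * u - v, (x a).2 - u + 2 * v)].

(** [P] and [x] are part of the conclusion because [top_weight] still has to be established for
    these very weights. *)
Lemma irreducible_character_bound : exists P x, [/\ P \in unitmx,
  forall s t, P *m p (tor s t) *m invmx P =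
    diag_mx (\row_a cis ((x a).1 * s + (x a).2 * t)) &
  forall k l, top_weight k l x -> forall s t (S2 S3 : R),
   (S2, S3) \in [:: (`|sin ((2 * t - s) / 2)|, `|sin ((s + t) / 2)|);
    (`|sin ((2 * s - t) / 2)|, `|sin ((s + t) / 2)|);
    (`|sin ((2 * s - t) / 2)|, `|sin ((2 * t - s) / 2)|)] ->
  nz (\tr (p (tor s t))) * S2 * S3 <= 64 * d%:R / (k.+1%:R * l.+1%:R)].
Proof.
have [P Pu [x hx]] := tor_weights p1 pM pc.
have [b b0 hb] := rep_bounded p1 pM pc.
exists P, x; split=> // k l [[a0 ha0] htop] s0 t0 S2 S3 hS.
pose q g := P *m p g *m invmx P.
have q1 : q 1%:M = 1%:M by rewrite /q p1 mulmx1 (mulmxV Pu).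
have qM g h : SU3 g -> SU3 h -> q (g *m h) = q g *m q h.
  by move=> hg hh; rewrite /q pM// !mulmxA mulmxKV.
have qB g : SU3 g -> N (q g) <= N P * b * N (invmx P).
  move=> hg; rewrite (le_trans (mxnorm1M _ _))// ler_wpM2r ?mxnorm1_ge0//.
  by rewrite (le_trans (mxnorm1M _ _))// ler_wpM2l ?mxnorm1_ge0// hb.
have qS A : (forall g, SU3 g -> q g *m A = A *m q g) -> exists c, A = c%:M.
  move=> hA; have [|c hc] := Schur_scalar (A := invmx P *m A *m P) p_irr.
    move=> g hg; have := hA g hg; rewrite /q => h.
    have -> : p g *m (invmx P *m A *m P) = invmx P *m (P *m p g *m invmx P *m A) *m P.
      by rewrite !mulmxA (mulVmx Pu) mul1mx.
    by rewrite h !mulmxA (mulmxKV Pu).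
  exists c; have : P *m (invmx P *m A *m P) *m invmx P = P *m c%:M *m invmx P by rewrite hc.
  by rewrite !mulmxA (mulmxV Pu) mul1mx (mulmxK Pu) scalar_mxC (mulmxK Pu).
have [c hc] := casimir_scalar q1 qM qB hx qS.
pose m := (\sum_a (x a == (k%:R, l%:R)))%N.
have mE : \sum_a (x a == (k%:R, l%:R))%:R = m%:R :> R[i] by rewrite /m natr_sum.
have m0 : (0 < m)%N by rewrite /m (bigD1 a0)//= ha0 eqxx.
have mn0 : \sum_a (x a == (k%:R, l%:R))%:R != 0 :> R[i] by rewrite mE pnatr_eq0 -lt0n.
have wf s t : (\sum_a cis ((x a).1 * s + (x a).2 * t)) * alt_sum 1 1 s t =
    m%:R * alt_sum k.+1%:R l.+1%:R s t.
  have k0 : 0 <= ((k%:R, l%:R) : R * R).1 /\ 0 <= ((k%:R, l%:R) : R * R).2 by [].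
  have := weyl_numerator (weight_sum_reflect1 q1 qM hx)
    (weight_sum_reflect2 q1 qM hx)
    (fun phi => wsum_casimir q1 qM qB hx phi hc) k0 htop
    (fun y => cis (y.1 * s + y.2 * t)) mn0.
  rewrite mE /= -!natr1 => <-; rewrite /wsum mulr_suml; apply: eq_bigr => a _.
  rewrite /rho_alt /alt_sum /=; case: (x a) => y1 y2 /=.
  rewrite !(mulrDr, mulrN) -!cisD.
  congr (_ - _ - _ + _ + _ - _); congr cis; ring.
have tr s t : \tr (p (tor s t)) = \sum_a cis ((x a).1 * s + (x a).2 * t).
  have : \tr (q (tor s t)) = \tr (p (tor s t)).
    by rewrite /q mxtrace_mulC mulmxA (mulVmx Pu) mul1mx.
  rewrite /q hx mxtrace_diag => <-; apply: eq_bigr => a _.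
  by rewrite mxE.
by rewrite tr; apply: (character_bound (m := m)) hS.
Qed.

End Schur.

(** * Maximal tori *)

Section MatrixTopology.
Variable R : realType.
Local Notation nz := (@Normc.normc R).
Local Notation N := (@mxnorm1 R _ _).
Local Notation M3 := 'M[R[i]]_3.

Lemma ball_mxP m n (A B : 'M[R[i]]_(m, n)) (r : R) : 0 < r ->
  ball A r%:C B <-> forall i j, nz (A i j - B i j) < r.
Proof.
move=> r0; have nE (z : R[i]) : (`|z| < r%:C) = (nz z < r) by rewrite -ltcR.
split=> [[_ h] i j|h]; first by rewrite -nE; exact: h.
by split=> [|i j]; [rewrite ltcR | have := h i j; rewrite -nE].
Qed.

(** Translates the matrix topology of the definitions into the norm [N]. Balls bound single entries
    and [N] their sum, hence the division by [(m * n).+1], the successor covering empty matrices. *)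
Lemma nbhs_mxnorm1 m n (A : 'M[R[i]]_(m, n)) (U : set 'M[R[i]]_(m, n)) :
  nbhs A U <-> exists2 r : R, 0 < r & forall B, N (A - B) < r -> U B.
Proof.
rewrite nbhs_ballP; split=> [[e /= e0 eU]|[r r0 rU]].
  have [ei er] : complex.Im e = 0 /\ 0 < complex.Re e.
    by move: e0; rewrite ltcE /= => /andP[/eqP -> ->].
  have ee : e = (complex.Re e)%:C by rewrite [LHS]complexE ei mulr0 addr0.
  exists (complex.Re e) => // B hB; apply: eU; rewrite ee; apply/ball_mxP => // i j.
  by rewrite -mxB_E (le_lt_trans (normc_le_mxnorm1 _ _ _)).
have mn0 : 0 < (m * n).+1%:R :> R by rewrite ltr0n.
exists (r / (m * n).+1%:R)%:C => /=; first by rewrite ltcR divr_gt0.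
move=> B /ball_mxP -/(_ (divr_gt0 r0 mn0)) h; apply: rU.
apply: le_lt_trans (_ : \sum_(i < m) \sum_(j < n) r / (m * n).+1%:R < r).
  by apply: ler_sum => i _; apply: ler_sum => j _; rewrite mxB_E ltW.
rewrite !sumr_const !card_ord -mulrnA -(mulr_natr (r / _)) mulnC mulrAC ltr_pdivrMr//.
by rewrite ltr_pM2l// ltr_nat.
Qed.

Lemma continuous_mxnorm1 (V : pseudoMetricType R) m n (f : V -> 'M[R[i]]_(m, n)) :
  (forall x e, 0 < e -> exists2 d : R, 0 < d & forall y, ball x d y -> N (f x - f y) < e) ->
  continuous f.
Proof.
move=> h x U /nbhs_mxnorm1[e e0 eU]; have [d d0 hd] := h x e e0.
by apply/nbhs_ballP; exists d => // y /hd; exact: eU.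
Qed.

Lemma limn_mxnorm1 n (u : nat -> 'M[R[i]]_n) A :
  (forall e : R, 0 < e -> \forall k \near \oo, N (A - u k) < e) -> limn u = A.
Proof.
move=> h; apply: cvg_lim; first exact: norm_hausdorff.
move=> U /nbhs_mxnorm1[e e0 eU]; apply: filterS (h e e0) => k; exact: eU.
Qed.

Lemma cvg_entries m n (u : nat -> 'M[R[i]]_(m, n)) (a b : 'I_m -> 'I_n -> R) :
  (forall i j, complex.Re (u k i j) @[k --> \oo] --> a i j) ->
  (forall i j, complex.Im (u k i j) @[k --> \oo] --> b i j) ->
  forall e : R, 0 < e -> \forall k \near \oo, N (\matrix_(i, j) (a i j +i* b i j) - u k) < e.
Proof.
move=> ha hb e e0; pose e' := e / (2 * (m * n).+1%:R).
have mn0 : 0 < (m * n).+1%:R :> R by rewrite ltr0n.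
have e'0 : 0 < e' by rewrite divr_gt0// mulr_gt0.
have : \forall k \near \oo, forall ij : 'I_m * 'I_n,
    `|a ij.1 ij.2 - complex.Re (u k ij.1 ij.2)| < e' /\
    `|b ij.1 ij.2 - complex.Im (u k ij.1 ij.2)| < e'.
  apply: filter_forall => -[i j] /=; apply: filterI.
    by have /cvgrPdist_lt/(_ _ e'0) := ha i j.
  by have /cvgrPdist_lt/(_ _ e'0) := hb i j.
apply: filterS => k hk.
apply: le_lt_trans (_ : \sum_(i < m) \sum_(j < n) 2 * e' < e).
  apply: ler_sum => i _; apply: ler_sum => j _.
  rewrite mxB_E mxE (le_trans (normc_le_ReIm _))//.
  have [] := hk (i, j); case: (u k i j) => c d /=; lra.
rewrite !sumr_const !card_ord -mulrnA -(mulr_natr (2 * e')) mulnC.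
have -> : 2 * e' * (m * n)%:R = e * (m * n)%:R / (m * n).+1%:R.
  by rewrite /e'; field; rewrite gt_eqF.
by rewrite ltr_pdivrMr// ltr_pM2l// ltr_nat.
Qed.

Lemma representation_continuous1 d (p : M3 -> 'M[R[i]]_d) : representation p ->
  forall e : R, 0 < e ->
  exists2 r : R, 0 < r & forall g, SU3 g -> N (g - 1%:M) < r -> N (p g - 1%:M) < e.
Proof.
move=> [p1 _ /subspace_continuousP pc] e e0.
have : nbhs (p 1%:M) [set B | N (p 1%:M - B) < e].
  by apply/nbhs_mxnorm1; exists e.
move=> /(pc _ (SU3_1 R)); rewrite /= /nbhs /= /within /= => /nbhs_mxnorm1[r r0 hr].
exists r => // g hg gr; rewrite mxnorm1_distC -p1; apply: hr => //.
by rewrite mxnorm1_distC.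
Qed.

Definition ctor (u : M3) (x : R * R) : M3 := u *m tor x.1 x.2 *m invmx u.

Lemma ctor_dist u x y : SU3 u ->
  N (ctor u x - ctor u y) <= 81 * 9 * (2 * (`|y.1 - x.1| + `|y.2 - x.2|)).
Proof.
move=> hu; have -> : ctor u x - ctor u y =
   u *m (tor x.1 x.2 *m (1%:M - tor (y.1 - x.1) (y.2 - x.2))) *m invmx u.
  rewrite mulmxBr mulmx1 -torD.
  by rewrite [x.1 + _]addrC [x.2 + _]addrC !subrK mulmxBr mulmxBl.
rewrite (le_trans (SU3_conj_norm _ hu))// -mulrA ler_wpM2l//.
rewrite (le_trans (mxnorm1M _ _))//; apply: ler_pM; try exact: mxnorm1_ge0.
  exact: SU3_norm (tor_SU3 _ _).
by rewrite mxnorm1_distC; exact: tor_norm_sub1.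
Qed.

Lemma ctor_SU3 u x : SU3 u -> SU3 (ctor u x).
Proof. by move=> hu; apply: SU3_conj => //; exact: tor_SU3. Qed.

Lemma ctorM u x y : SU3 u -> ctor u x *m ctor u y = ctor u (x.1 + y.1, x.2 + y.2).
Proof.
move=> hu; rewrite /ctor /= torD -!mulmxA; congr (_ *m (_ *m _)).
by rewrite !mulmxA SU3_mulVmx// mul1mx.
Qed.

Lemma ctor0 u : SU3 u -> ctor u (0, 0) = 1%:M.
Proof. by move=> hu; rewrite /ctor /= tor0 mulmx1 SU3_mulmxV. Qed.

(** Compact as the image of a square of angles, connected as a union of arcs through the
    identity. *)
Lemma ctor_torus u : SU3 u -> torus (range (ctor u)).
Proof.
move=> hu; split.
- by move=> _ [x _ <-]; exact: ctor_SU3.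
- split; first by exists (0, 0) => //; exact: ctor0.
    by move=> _ _ [x _ <-] [y _ <-]; rewrite ctorM//; exists (x.1 + y.1, x.2 + y.2).
  move=> _ [x _ <-]; exists (- x.1, - x.2) => //.
  have h : ctor u x *m ctor u (- x.1, - x.2) = 1%:M by rewrite ctorM//= !subrr ctor0.
  by rewrite -[RHS]mulmx1 -h mulKmx//; apply: SU3_unit; exact: ctor_SU3.
- have -> : range (ctor u) = ctor u @` (`[- pi, pi]%classic `*` `[- pi, pi]%classic).
    apply/seteqP; split=> [_ [x _ <-]|_ [x _ <-]]; last by exists x.
    have hx : SU3 (tor x.1 x.2) := tor_SU3 _ _.
    pose per (r : R) := exists2 r', - pi <= r' <= pi & cis r' = cis r.
    have hper r : per r.
      have [r' e [r1 _]] := unit_complex_cis (normc_cis r).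
      by exists r' => //; rewrite -ler_norml.
    have [s s1 s2] := hper x.1; have [t t1 t2] := hper x.2.
    exists (s, t); first by split; rewrite /= in_itv.
    rewrite /ctor /=; congr (_ *m _ *m _); rewrite /tor.
    by rewrite !cisD !cisN s2 t2.
  apply: continuous_compact; last by apply: compact_setX; exact: segment_compact.
  apply: continuous_subspaceT; apply: continuous_mxnorm1 => x e e0.
  exists (e / (81 * 9 * 4 + 1)); first by rewrite divr_gt0// ltr_wpDl.
  move=> y [/= h1 h2]; apply: le_lt_trans (ctor_dist _ _ hu) _.
  move: h1 h2; rewrite /ball /= ltr_pdivlMr ?ltr_wpDl// ltr_pdivlMr ?ltr_wpDl//.
  rewrite ![`|x.1 - _|]distrC ![`|x.2 - _|]distrC.
  have := normr_ge0 (y.1 - x.1); have := normr_ge0 (y.2 - x.2); lra.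
- have -> : range (ctor u) = \bigcup_(x in setT) ((fun r : R => ctor u (r * x.1, r * x.2)) @` `[0, 1]%classic).
    apply/seteqP; split=> [_ [x _ <-]|_ [x _ [r _ <-]]]; last by exists (r * x.1, r * x.2).
    exists x => //; exists 1; first by rewrite /= in_itv /= ler01 lexx.
    by rewrite !mul1r -surjective_pairing.
  apply: bigcup_connected.
    by exists 1%:M => x _; exists 0; [rewrite /= in_itv /= ler01 lexx|rewrite !mul0r ctor0].
  move=> x _; apply: connected_continuous_connected; first exact: segment_connected.
  apply: continuous_subspaceT; apply: continuous_mxnorm1 => r e e0.
  set K := 81 * 9 * (2 * (`|x.1| + `|x.2|)).
  have K0 : 0 <= K by rewrite /K !mulr_ge0// addr_ge0.
  exists (e / (K + 1)); first by rewrite divr_gt0// ltr_wpDl.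
  move=> r' h; apply: le_lt_trans (ctor_dist _ _ hu) _ => /=.
  rewrite -!mulrBl !normrM -mulrDr.
  have -> : 81 * 9 * (2 * (`|r' - r| * (`|x.1| + `|x.2|))) = `|r' - r| * K by rewrite /K; ring.
  move: h; rewrite /ball /= ltr_pdivlMr ?ltr_wpDl// distrC => h.
  by apply: le_lt_trans h; rewrite mulrDr mulr1 lerDl.
- by move=> _ _ [x _ <-] [y _ <-]; rewrite (ctorM x y hu) (ctorM y x hu) addrC [x.2 + _]addrC.
Qed.

(* The torus is contained in a conjugate of the diagonal one; maximality does the rest. *)
Lemma maximal_torus_conj (T : set M3) : maximal_torus T ->
  exists2 u, SU3 u & T = range (ctor u).
Proof.
move=> [Tt Tmax].
suff [u hu Tu] : exists2 u, SU3 u & T `<=` range (ctor u).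
  by exists u => //; apply/esym/Tmax => //; exact: ctor_torus.
case: Tt => TS [_ _ TV] _ _ Tc.
have [fs [fsT Tfs]] := @finite_span _ 'M[R[i]]_3 (fun g => T g).
have [|P Pu /allP hP] := @cotrigonalization _ 3 fs.
  by move=> A B /fsT hA /fsT hB; exact: Tc.
have Pinv : P \in unitmx := unitarymx_unit Pu.
have trig g : T g -> is_trig_mx (P *m g *m invmx P).
  move=> /Tfs /(@coord_span _ _ _ (in_tuple fs)) ->.
  rewrite mulmx_sumr mulmx_suml; apply/is_trig_mxP => i j ij.
  rewrite summxE big1// => k _; rewrite -scalemxAr -scalemxAl mxE.
  have /hP : (in_tuple fs)`_k \in fs by rewrite mem_nth.
  by rewrite /similar_to /= (conjumx _ Pinv) => /is_trig_mxP ->//; rewrite mulr0.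
have PuE : invmx P = (P ^t* )%sesqui := invmx_unitary Pu.
(* The inverse of [g] is its adjoint and also lies in [T]; triangularity of both leaves only the
   diagonal. *)
have diagT g : T g -> is_diag_mx (P *m g *m invmx P).
  move=> Tg; apply/is_diag_mxP => i j; rewrite neq_ltn => /orP[ij|ji].
    by have /is_trig_mxP -> := trig g Tg.
  have /trig/is_trig_mxP/(_ j i ji) : T (invmx g) by exact: TV.
  rewrite -(SU3_adj (TS _ Tg)) PuE -{1}(adjK P) -mulmxA -!adjM !mxE.
  by move/eqP; rewrite conjC_eq0 => /eqP.
have [Q hQ QD] := unitary_diag_SU3 Pu.
exists (invmx Q) => [|g Tg]; first exact: SU3_V.
have /diag_mx_diagonal := QD _ (diagT g Tg).
have : SU3 (Q *m g *m invmx Q) := SU3_conj hQ (TS _ Tg).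
move=> h e; move: h; rewrite e => /SU3_diag_tor[s [t [e' _ _]]].
exists (s, t) => //; rewrite /ctor /= -e' -e.
have -> : invmx (invmx Q) = Q by exact: invmxK.
rewrite -(mulmxA Q) (mulmxA (invmx Q) Q) SU3_mulVmx// mul1mx.
exact: mulmxKV (SU3_unit hQ) g.
Qed.

End MatrixTopology.

(** * Exponentials of matrices *)

Section MatrixExponential.
Variable R : realType.
Local Notation nz := (@Normc.normc R).
Local Notation N := (@mxnorm1 R _ _).
Local Notation M3 := 'M[R[i]]_3.
Local Notation adj A := ((A ^t* )%sesqui).

Definition exp_term n (A : 'M[R[i]]_n) (k : nat) := (k`!%:R)^-1 *: A ^+ k.

Lemma Re_sum (I : Type) (s : seq I) (P : pred I) (F : I -> R[i]) :
  complex.Re (\sum_(i <- s | P i) F i) = \sum_(i <- s | P i) complex.Re (F i).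
Proof. by elim/big_rec2: _ => [//|i a z _ <-]; case: (F i) z => ? ? []. Qed.

Lemma Im_sum (I : Type) (s : seq I) (P : pred I) (F : I -> R[i]) :
  complex.Im (\sum_(i <- s | P i) F i) = \sum_(i <- s | P i) complex.Im (F i).
Proof. by elim/big_rec2: _ => [//|i a z _ <-]; case: (F i) z => ? ? []. Qed.

Lemma imag_exp_coeff (y : R) k :
  (k`!%:R)^-1 * (0 +i* y) ^+ k = cos_coeff y k +i* sin_coeff y k.
Proof.
have hk : (0 +i* y) ^+ k = ((~~ odd k)%:R * (-1) ^+ k./2 * y ^+ k) +i*
    ((odd k)%:R * (-1) ^+ k.-1./2 * y ^+ k).
  elim: k => [|k IH]; first by rewrite !expr0 /= !mulr1.
  rewrite exprS IH; apply/eqP; rewrite eq_complex /= negbK.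
  rewrite uphalf_half; case: (boolP (odd k)) => ok /=; apply/andP; split; apply/eqP.
  - have -> : k./2 = k.-1./2 by case: k ok {IH} => //= k ok; rewrite uphalf_half (negbTE ok).
    by rewrite add1n !exprS; ring.
  - by ring.
  - by ring.
  - by rewrite exprS; ring.
rewrite hk cos_coeffE sin_coeffE /=.
have -> : (k`!%:R : R[i])^-1 = (k`!%:R^-1 : R)%:C by rewrite fmorphV rmorph_nat.
by apply/eqP; rewrite eq_complex /=; apply/andP; split; apply/eqP; ring.
Qed.

Lemma exp_ltor (s t : R) e : 0 < e ->
  \forall k \near \oo, N (tor s t - series (exp_term (ltor s t)) k) < e.
Proof.
pose th (j : 'I_3) : R := [:: s; t - s; - t]`_j.
have hl : ltor s t = diag_mx (\row_j (0 +i* th j)).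
  by congr diag_mx; apply/rowP => j; rewrite !mxE /th; case: j => [[|[|[|//]]] h].
have ht : tor s t = \matrix_(i, j) ((if i == j then cos (th j) else 0) +i* (if i == j then sin (th j) else 0)).
  apply/matrixP => i j; rewrite !mxE; case: (eqVneq i j) => [->|_]; last by rewrite mulr0n.
  by rewrite mulr1n /th; case: j => [[|[|[|//]]] h].
have he k i j : series (exp_term (ltor s t)) k i j =
    if i == j then \sum_(0 <= l < k) (cos_coeff (th j) l +i* sin_coeff (th j) l) else 0.
  rewrite seriesEnat summxE; case: (eqVneq i j) => [->|ij].
    apply: eq_bigr => l _; rewrite /exp_term mxE hl -imag_exp_coeff; congr (_ * _).
    elim: l => [|l IH]; first by rewrite expr0 mxE eqxx.
    by rewrite exprS -mulmxE mul_diag_mx !mxE IH exprS.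
  rewrite big1// => l _; rewrite /exp_term mxE hl.
  suff -> : (diag_mx (\row_j (0 +i* th j)) ^+ l) i j = 0 by rewrite mulr0.
  elim: l => [|l IH]; first by rewrite expr0 mxE (negbTE ij).
  by rewrite exprS -mulmxE mul_diag_mx !mxE IH mulr0.
rewrite ht => e0; apply: (cvg_entries _ _ e0) => i j.
- have -> : (fun k => complex.Re (series (exp_term (ltor s t)) k i j)) =
      if i == j then series (cos_coeff (th j)) else (fun=> 0).
    apply/funext => k; rewrite he; case: eqP => // _.
    by rewrite Re_sum seriesEnat.
  case: eqP => _; last exact: cvg_cst.
  rewrite unlock; exact: is_cvg_series_cos_coeff.
- have -> : (fun k => complex.Im (series (exp_term (ltor s t)) k i j)) =
      if i == j then series (sin_coeff (th j)) else (fun=> 0).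
    apply/funext => k; rewrite he; case: eqP => // _.
    by rewrite Im_sum seriesEnat.
  case: eqP => _; last exact: cvg_cst.
  rewrite unlock; exact: is_cvg_series_sin_coeff.
Qed.

Lemma expmx_ltor (u : M3) s t : SU3 u -> expmx (u *m ltor s t *m invmx u) = ctor u (s, t).
Proof.
move=> hu; apply: limn_mxnorm1 => e e0.
(* 82 exceeds the factor 81 lost in conjugation, which keeps the inequality strict. *)
have e1 : 0 < e / 82 by rewrite divr_gt0.
apply: filterS (exp_ltor s t e1) => k hk.
have -> : series (exp_term (u *m ltor s t *m invmx u)) k =
    u *m series (exp_term (ltor s t)) k *m invmx u.
  rewrite /series /= mulmx_sumr mulmx_suml; apply: eq_bigr => l _.
  rewrite /exp_term -scalemxAr -scalemxAl; congr (_ *: _).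
  elim: l => [|l IH]; first by rewrite !expr0 mulmx1 SU3_mulmxV.
  rewrite !exprS IH -!mulmxE -!mulmxA; congr (_ *m (_ *m _)).
  by rewrite !mulmxA SU3_mulVmx// mul1mx.
rewrite /ctor -mulmxBl -mulmxBr /= (le_lt_trans (SU3_conj_norm _ hu))//.
by have := mxnorm1_ge0 (tor s t - series (exp_term (ltor s t)) k); lra.
Qed.

Lemma exp_term_norm n (A : 'M[R[i]]_n) k :
  N (exp_term A k) <= n%:R * exp_coeff (N A) k.
Proof.
rewrite /exp_term mxnorm1Z Normc.normcV normc_nat exp_coeffE /=.
rewrite mulrCA ler_wpM2l ?invr_ge0// mulrC; exact: mxnorm1X.
Qed.

Lemma expmx_cvg n (A : 'M[R[i]]_n) e : 0 < e ->
  \forall k \near \oo, N (expmx A - series (exp_term A) k) < e.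
Proof.
suff [a [b h]] : exists a b : 'I_n -> 'I_n -> R, forall e : R, 0 < e ->
    \forall k \near \oo, N (\matrix_(i, j) (a i j +i* b i j) - series (exp_term A) k) < e.
  have -> : expmx A = \matrix_(i, j) (a i j +i* b i j) by exact: limn_mxnorm1 h.
  exact: h.
have cv (f : R[i] -> R) : (forall z, `|f z| <= nz z) -> forall i j,
    cvgn (series (fun k => f (exp_term A k i j))).
  move=> hf i j; apply: normed_cvg.
  apply: (@series_le_cvg _ _ (fun k => n%:R * exp_coeff (N A) k)) => //.
  - by move=> k; rewrite normr_ge0.
  - by move=> k; rewrite mulr_ge0// exp_coeff_ge0// mxnorm1_ge0.
  - move=> k; apply: le_trans (hf _) _; apply: le_trans (normc_le_mxnorm1 _ _ _) _.
    exact: exp_term_norm.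
  - exact: is_cvg_seriesZ (is_cvg_series_exp_coeff _).
exists (fun i j => limn (series (fun k => complex.Re (exp_term A k i j)))).
exists (fun i j => limn (series (fun k => complex.Im (exp_term A k i j)))).
apply: cvg_entries => i j.
- have -> : (fun k => complex.Re (series (exp_term A) k i j)) =
      series (fun k => complex.Re (exp_term A k i j)).
    by apply/funext => k; rewrite !seriesEnat summxE Re_sum.
  apply: (cv _ _ i j); exact: normc_Re.
- have -> : (fun k => complex.Im (series (exp_term A) k i j)) =
      series (fun k => complex.Im (exp_term A k i j)).
    by apply/funext => k; rewrite !seriesEnat summxE Im_sum.
  apply: (cv _ _ i j); exact: normc_Im.
Qed.

(** Since (l + 2)! is at least l!, the series without its first two terms is dominated by [N A ^+ 2]
    times the exponential series of the norm. *)
Lemma expmx_sub_le n (A : 'M[R[i]]_n) :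
  N (expmx A - 1%:M - A) <= n%:R * N A ^+ 2 * expR (N A).
Proof.
apply/ler_addgt0Pr => e e0.
have red (E F : 'M[R[i]]_n) : E - 1%:M - A - (F - 1%:M - A) = E - F.
  by apply/matrixP => i j; rewrite !mxE; ring.
have [k0 _ hk] := expmx_cvg A e0.
have := hk k0.+2 (leqW (leqnSn k0)) => /=.
set S := series _ _ => hS.
rewrite -[X in N X <= _](subrK (S - 1%:M - A)).
apply: le_trans (mxnorm1D _ _) _; rewrite addrC; apply: lerD; last first.
  by rewrite red ltW.
have -> : S - 1%:M - A = \sum_(0 <= l < k0) exp_term A l.+2.
  have -> : S = \sum_(0 <= l < k0.+2) exp_term A l by rewrite /S seriesEnat.
  rewrite big_nat_recl// big_nat_recl// /exp_term.
  rewrite [0`!]/= [1`!]/= expr0 expr1 invr1 !scale1r.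
  have rd (a b z : 'M[R[i]]_n) : a + (b + z) - a - b = z.
    by apply/matrixP => i j; rewrite !mxE; ring.
  exact: rd.
apply: le_trans (mxnorm1_sum _ _ _) _.
apply: le_trans (_ : \sum_(0 <= l < k0) n%:R * N A ^+ 2 * exp_coeff (N A) l <= _).
  apply: ler_sum => l _; apply: le_trans (exp_term_norm _ _) _.
  set x := N A; have x0 : 0 <= x by exact: mxnorm1_ge0.
  rewrite !exp_coeffE /= -(addn2 l) exprD addn2.
  have -> : n%:R * x ^+ 2 * (l`!%:R^-1 * x ^+ l) = n%:R * (l`!%:R^-1 * (x ^+ l * x ^+ 2)) by ring.
  apply: ler_wpM2l => //; apply: ler_wpM2r; first by rewrite mulr_ge0 ?exprn_ge0.
  rewrite lef_pV2 ?posrE ?ltr0n ?fact_gt0// ler_nat.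
  by rewrite !factS mulnA leq_pmull// muln_gt0.
rewrite -mulr_sumr ler_wpM2l ?mulr_ge0 ?exprn_ge0 ?mxnorm1_ge0//.
have : nondecreasing_seq (series (exp_coeff (N A))).
  by apply: nondecreasing_series => l _ _; apply: exp_coeff_ge0; exact: mxnorm1_ge0.
move=> /nondecreasing_cvgn_le/(_ (is_cvg_series_exp_coeff _) k0).
by rewrite seriesEnat.
Qed.

Lemma expmx_tangent n (X : 'M[R[i]]_n) :
  tangent (fun k => expmx ((k.+1%:R^-1)%:C *: X)) X.
Proof.
exists (n%:R * N X ^+ 2 * expR (N X)) => k; set K : R := k.+1%:R.
have K0 : 0 < K by rewrite ltr0n.
have kK : (k.+1%:R : R[i]) = K%:C by rewrite rmorph_nat.
have -> : k.+1%:R *: (expmx (K^-1%:C *: X) - 1%:M) - X =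
    K%:C *: (expmx (K^-1%:C *: X) - 1%:M - K^-1%:C *: X).
  rewrite kK [RHS]scalerBr; congr (_ - _).
  by rewrite scalerA -rmorphM /= divff ?gt_eqF// scale1r.
rewrite mxnorm1Z normc_real (gtr0_norm K0).
apply: le_trans (ler_wpM2l (ltW K0) (expmx_sub_le _)) _.
rewrite mxnorm1Z normc_real gtr0_norm ?invr_gt0//.
have -> : K * (n%:R * (K^-1 * N X) ^+ 2 * expR (K^-1 * N X)) =
    n%:R * N X ^+ 2 / K * expR (K^-1 * N X) by field; rewrite gt_eqF.
have -> : n%:R * N X ^+ 2 * expR (N X) / K = n%:R * N X ^+ 2 / K * expR (N X) by ring.
rewrite ler_wpM2l ?mulr_ge0 ?exprn_ge0 ?mxnorm1_ge0 ?invr_ge0 ?(ltW K0)//.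
rewrite ler_expR ler_piMl ?mxnorm1_ge0// invf_le1// /K ler1n//.
Qed.

Lemma approx_adj n (g : nat -> 'M[R[i]]_n) X : approx g X ->
  approx (fun k => adj (g k)) (adj X).
Proof.
move=> [C hC]; exists C => k; rewrite -adjN -adjD.
apply: le_trans (hC k); rewrite /mxnorm1 exchange_big /=.
rewrite le_eqVlt; apply/orP; left; apply/eqP; apply: eq_bigr => i _; apply: eq_bigr => j _.
by rewrite mxE mxE; case: ((g k - X) i j) => a b /=; rewrite sqrrN.
Qed.

(** Entries become 1 x 1 matrices so that the product rule [tangentM] applies to them. *)
Lemma tangent_entry n (g : nat -> 'M[R[i]]_n) X a : tangent g X ->
  tangent (fun k => (g k a a)%:M : 'M[R[i]]_1) ((X a a)%:M : 'M[R[i]]_1).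
Proof.
move=> [C hC]; exists C => k; apply: le_trans (hC k).
rewrite /mxnorm1 !big_ord1 -/(mxnorm1 _).
have -> : (k.+1%:R *: ((g k a a)%:M - 1%:M) - (X a a)%:M : 'M[R[i]]_1) 0 0 =
    (k.+1%:R *: (g k - 1%:M) - X) a a by rewrite !mxE !eqxx !mulr1n.
exact: normc_le_mxnorm1.
Qed.

Lemma tangent_cst1 n X : tangent (fun=> 1%:M : 'M[R[i]]_n) X -> X = 0.
Proof.
move=> h; apply: approx_uniq h _; have := approx_cst (0 : 'M[R[i]]_n).
by apply: eq_approx => k; rewrite subrr scaler0.
Qed.

(** For the direct implication, [expmx (X / k.+1)] is a sequence in the torus with velocity [X].
    Conjugated by [u] it consists of matrices [tor], from which the limit inherits being diagonal,
    skew-Hermitian and traceless. *)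
Lemma Lie_ctor (u X : M3) : SU3 u -> Lie (range (ctor u)) X <->
  exists s t, X = u *m ltor s t *m invmx u.
Proof.
move=> hu; split=> [hX|[s [t ->]] c]; last first.
  have -> : c%:C *: (u *m ltor s t *m invmx u) = u *m ltor (c * s) (c * t) *m invmx u.
    rewrite scalemxAl scalemxAr; congr (_ *m _ *m _); rewrite /ltor -linearZ /=.
    congr diag_mx; apply/rowP => j; rewrite !mxE.
    by case: j => [[|[|[|//]]] h] /=; apply/eqP; rewrite eq_complex /=; apply/andP; split; apply/eqP; ring.
  by rewrite expmx_ltor//; exists (c * s, c * t).
pose g k := expmx ((k.+1%:R^-1)%:C *: X).
have /choice[y hy] : forall k, exists y, ctor u y = g k.
  by move=> k; have [y _ hy] := hX k.+1%:R^-1; exists y.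
pose h k := tor (y k).1 (y k).2.
have [Y YE] : exists Y, Y = invmx u *m X *m u by eexists.
have th : tangent h Y.
  rewrite YE; apply: eq_approx (tangent_conj (SU3_mulVmx hu) (expmx_tangent X)) => k.
  by rewrite -/(g k) -hy /ctor -!mulmxA SU3_mulVmx// mulmx1 !mulmxA SU3_mulVmx// mul1mx.
have Ydiag : is_diag_mx Y.
  apply/is_diag_mxP => a b ab; case: th => C hC.
  apply: Normc.eq0_normc; apply/eqP; rewrite eq_le normc_ge0 andbT.
  apply: (@le_inv_nat_le0 R _ C) => k; apply: le_trans (hC k).
  have -> : nz (Y a b) = nz ((k.+1%:R *: (h k - 1%:M) - Y) a b).
    have ab' : (a == b) = false by apply/negbTE; exact: ab.
    have h0 : h k a b = 0 by rewrite /h /tor mxE ab'.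
    have h1 : (1%:M : M3) a b = 0 by rewrite mxE ab'.
    by rewrite !(mxB_E, h0, h1) mxE mxB_E h0 h1 subrr mulr0 sub0r normcN.
  exact: normc_le_mxnorm1.
have hadj : adj Y + Y = 0.
  apply: tangent_cst1.
  have tadj : tangent (fun k => adj (h k)) (adj Y).
    apply: eq_approx (approx_adj th) => k.
    rewrite adjZ adjD adjN trmx1 map_mx1; congr (_ *: _); exact: conjc_nat.
  apply: eq_approx (tangentM tadj th) => k.
  rewrite SU3_adj; last exact: tor_SU3.
  by rewrite SU3_mulVmx//; exact: tor_SU3.
(* The trace is the derivative of the product of the three diagonal entries, which is identically
   1. *)
have htr : \tr Y = 0.
  have := tangentM (tangentM (tangent_entry 0 th) (tangent_entry 1 th)) (tangent_entry 2%:R th).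
  have e k : (h k 0 0)%:M *m (h k 1 1)%:M *m (h k 2%:R 2%:R)%:M = 1%:M :> 'M[R[i]]_1.
    rewrite -!scalar_mxM /h /tor !mxE /= !mulr1n -!cisD -cis0.
    by congr (cis _)%:M; ring.
  have {}e := eq_approx (fun k => congr1 (fun w => k.+1%:R *: (w - 1%:M)) (e k)).
  move=> /e /tangent_cst1 /matrixP/(_ 0 0); rewrite !mxE /= !mulr1n => <-.
  by rewrite /mxtrace sum_ord3.
have YY : su3 (diag_mx (\row_j Y j j)).
  rewrite -diag_mx_diagonal//; split=> //; by apply/eqP; rewrite -addr_eq0 hadj.
have [s [t e]] := diag_ltor YY; exists s, t.
rewrite -e -diag_mx_diagonal// YE !mulmxA SU3_mulmxV// mul1mx -mulmxA SU3_mulmxV//.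
by rewrite mulmx1.
Qed.

End MatrixExponential.

(** * Roots and dominant weights *)

Section TorusRoots.
Variables (R : realType) (T : set 'M[R[i]]_3).
Local Notation M3 := 'M[R[i]]_3.
Implicit Types (u : M3) (H : Lie T) (y z : R * R).

(** A basis in which [T] is the diagonal torus. Permuting it gives another frame, a freedom used to
    adapt it to the positive system. *)
Definition frame u := SU3 u /\ T = range (ctor u).

Definition angle u (j : 'I_3) H : R := complex.Im ((invmx u *m \val H *m u) j j).

(* The coordinates are with respect to the fundamental weights, whose values
   are the first diagonal entry and minus the last one. *)
Definition dynkin u y : functional T :=
  fun H => 0 +i* (y.1 * angle u 0 H - y.2 * angle u 2%:R H).

Definition root u (j k : 'I_3) : functional T :=
  fun H => 0 +i* (angle u j H - angle u k H).

Lemma ltor_linear (a b s t s' t' : R) :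
  ltor (a * s + b * s') (a * t + b * t') = a%:C *: ltor s t + b%:C *: ltor s' t'.
Proof.
rewrite /ltor -!linearZ -raddfD /=; congr diag_mx; apply/rowP => j; rewrite !mxE.
by case: j => [[|[|[|//]]] h] /=; apply/eqP; rewrite eq_complex /=; apply/andP; split; apply/eqP; ring.
Qed.

Lemma angle_conj u H s t : SU3 u -> \val H = u *m ltor s t *m invmx u ->
  [/\ angle u 0 H = s, angle u 1 H = t - s & angle u 2%:R H = - t].
Proof. by move=> hu e; rewrite /angle e SU3_conjK// /ltor !mxE. Qed.

Lemma frame_elt u s t : frame u -> exists H, \val H = u *m ltor s t *m invmx u.
Proof.
move=> [hu TE]; have h : Lie T (u *m ltor s t *m invmx u).
  by rewrite TE; apply/Lie_ctor => //; exists s, t.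
by exists (SigSub (mem_set h)).
Qed.

Lemma frame_val u H : frame u ->
  \val H = u *m ltor (angle u 0 H) (- angle u 2%:R H) *m invmx u.
Proof.
move=> [hu TE]; have : Lie T (\val H) := set_valP H.
rewrite {1}TE => /(Lie_ctor _ hu)[s [t e]].
by have [-> _ ->] := angle_conj hu e; rewrite opprK.
Qed.

Lemma frame_exp u H : frame u ->
  expmx (\val H) = ctor u (angle u 0 H, - angle u 2%:R H).
Proof. by move=> hu; rewrite (frame_val H hu) expmx_ltor//; case: hu. Qed.

Lemma angleE u j H : frame u ->
  angle u j H = (wt R j).1 * angle u 0 H - (wt R j).2 * angle u 2%:R H.
Proof.
move=> hu; have [h0 h1 h2] := angle_conj (proj1 hu) (frame_val H hu).
case: j => [[|[|[|//]]] h]; rewrite /wt /=.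
- rewrite mul1r mul0r subr0; congr angle; exact: val_inj.
- rewrite -[LHS](_ : angle u 1 H = _); first by rewrite h1; ring.
  congr angle; exact: val_inj.
- rewrite mul0r mulN1r sub0r opprK; congr angle; exact: val_inj.
Qed.

Lemma rootE u j k : frame u ->
  root u j k = dynkin u ((wt R j).1 - (wt R k).1, (wt R j).2 - (wt R k).2).
Proof.
move=> hu; apply/funext => H; rewrite /root /dynkin /= angleE// (angleE k)//.
congr (_ +i* _); ring.
Qed.

Lemma angle_linear u j (a b : R) (H1 H2 H3 : Lie T) :
  \val H3 = a%:C *: \val H1 + b%:C *: \val H2 ->
  angle u j H3 = a * angle u j H1 + b * angle u j H2.
Proof.
move=> e; rewrite /angle e mulmxDr mulmxDl -!scalemxAr -!scalemxAl.
set A := _ *m \val H1 *m _; set B := _ *m \val H2 *m _.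
have -> : (a%:C *: A + b%:C *: B) j j = a%:C * A j j + b%:C * B j j by rewrite !mxE.
by move: (A j j) (B j j) => [? ?] [? ?] /=; ring.
Qed.

Lemma dynkin_it_dual u y : it_dual (dynkin u y).
Proof.
split=> [//|a b H1 H2 H3 e]; rewrite /dynkin !(angle_linear _ _ e).
move: (angle u 0 H1) (angle u 0 H2) (angle u 2%:R H1) (angle u 2%:R H2) => ? ? ? ?.
by apply/eqP; rewrite eq_complex /=; apply/andP; split; apply/eqP; ring.
Qed.

Lemma it_dual_dynkin u (l : functional T) : frame u -> it_dual l ->
  exists y, l = dynkin u y.
Proof.
move=> hu [l0 lL]; have [H1 e1] := frame_elt 1 0 hu; have [H2 e2] := frame_elt 0 1 hu.
exists (complex.Im (l H1), complex.Im (l H2)); apply/funext => H.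
rewrite (lL (angle u 0 H) (- angle u 2%:R H) H1 H2); last first.
  rewrite e1 e2 (scalemxAl _ (u *m ltor 1 0)) (scalemxAl _ (u *m ltor 0 1)).
  rewrite (scalemxAr _ u (ltor 1 0)) (scalemxAr _ u (ltor 0 1)) -mulmxDl -mulmxDr.
  by rewrite -ltor_linear !mulr1 !mulr0 addr0 add0r; exact: frame_val.
move: (l0 H1) (l0 H2); rewrite /dynkin; case: (l H1) (l H2) => a b [c d] /= -> ->.
by apply/eqP; rewrite eq_complex /=; apply/andP; split; apply/eqP; ring.
Qed.

Lemma dynkin_inj u : frame u -> injective (dynkin u).
Proof.
move=> hu [p q] [p' q'] e.
have [H1 /(angle_conj (proj1 hu))[a1 _ c1]] := frame_elt 1 0 hu.
have [H2 /(angle_conj (proj1 hu))[a2 _ c2]] := frame_elt 0 1 hu.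
have aux H : p * angle u 0 H - q * angle u 2%:R H = p' * angle u 0 H - q' * angle u 2%:R H.
  by have := congr1 (fun f : functional T => complex.Im (f H)) e.
have := aux H1; have := aux H2.
by rewrite a1 a2 c1 c2 => e2 e1; clear -e1 e2; congr (_, _); lra.
Qed.

Lemma ltor_angle u H : frame u ->
  ltor (angle u 0 H) (- angle u 2%:R H) = diag_mx (\row_j (0 +i* angle u j H)).
Proof.
move=> hu; congr diag_mx; apply/rowP => i; rewrite !mxE (angleE i)//.
case: i => [[|[|[|//]]] h]; rewrite /wt /=; congr (_ +i* _); ring.
Qed.

Lemma ltor_comm u H (Y : M3) j k : frame u ->
  let D := ltor (angle u 0 H) (- angle u 2%:R H) in
  (D *m Y - Y *m D) j k = root u j k H * Y j k.
Proof.
move=> hu D; rewrite /D ltor_angle// mxB_E mul_diag_mx mul_mx_diag !mxE mulrC -mulrBr mulrC; congr (_ * _).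
by rewrite /root; apply/eqP; rewrite eq_complex /= subrr !eqxx.
Qed.

(** The root vector is the matrix unit [delta_mx j k] transported by [u]. *)
Lemma is_root_root u j k : frame u -> j != k -> is_root (root u j k).
Proof.
move=> hu jk; have huS := proj1 hu; split.
- by rewrite rootE//; exact: dynkin_it_dual.
- rewrite rootE// => e.
  have /(dynkin_inj hu) : dynkin u ((wt R j).1 - (wt R k).1, (wt R j).2 - (wt R k).2)
      = dynkin u (0, 0).
    by rewrite e; apply/funext => H; rewrite /dynkin /= !mul0r subrr.
  move: jk; case: j {e} => [[|[|[|//]]] h]; case: k => [[|[|[|//]]] h'];
    by rewrite -?val_eqE //= /wt /= => _ [] *; exfalso; lra.
- exists (u *m delta_mx j k *m invmx u); split.
  + apply: contraNneq (oner_neq0 R[i]) => e.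
    have {}e : delta_mx j k = 0 :> M3 by rewrite -(SU3_conjK (delta_mx j k) huS) e mulmx0 mul0mx.
    by have := congr1 (fun A : M3 => A j k) e; rewrite !mxE !eqxx => /eqP.
  + rewrite mxtrace_mulC mulmxA SU3_mulVmx// mul1mx /mxtrace big1// => i _.
    rewrite mxE; case: eqP => // ->; by rewrite (negbTE jk).
  + move=> H; have vH := frame_val H hu.
    rewrite {1 2}vH !(SU3_conjM _ _ huS) -mulmxBl -mulmxBr scalemxAl scalemxAr.
    congr (_ *m _ *m _).
    apply/matrixP => a b; rewrite ltor_comm// [RHS]mxE [delta_mx _ _ _ _]mxE.
    by have [/andP[/eqP -> /eqP ->]//|_] := boolP ((a == j) && (b == k)); rewrite !mulr0.
Qed.

Lemma frame_val_diag u H : frame u ->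
  \val H = u *m diag_mx (\row_j (0 +i* angle u j H)) *m invmx u.
Proof.
by move=> hu; rewrite -ltor_angle//; exact: frame_val.
Qed.

Lemma wpermV (s : {perm 'I_3}) : invmx (wperm R s) = wperm R s^-1%g.
Proof.
have h : wperm R s^-1%g *m wperm R s = 1%:M.
  rewrite /wperm -scalemxAl -scalemxAr scalerA odd_permV -perm_mxM (mulVg s) perm_mx1.
  by rewrite -exprMn mulrNN mulr1 expr1n scale1r.
by rewrite -(mulmxK (SU3_unit (wperm_SU3 R s)) (wperm R s^-1%g)) h mul1mx.
Qed.

Lemma wperm_tor (s : {perm 'I_3}) (x : R * R) :
  exists y, wperm R s *m tor x.1 x.2 *m invmx (wperm R s) = tor y.1 y.2.
Proof.
have := SU3_conj (wperm_SU3 R s) (tor_SU3 x.1 x.2).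
by rewrite /tor wperm_conj => /SU3_diag_tor[a [b [e _ _]]]; exists (a, b).
Qed.

Lemma frame_perm u (s : {perm 'I_3}) : frame u -> frame (u *m invmx (wperm R s)).
Proof.
move=> [hu TE]; have wS := wperm_SU3 R s; have wU := SU3_unit wS.
have uwS : SU3 (u *m invmx (wperm R s)) by apply: SU3_M => //; exact: SU3_V.
have uwV : invmx (u *m invmx (wperm R s)) = wperm R s *m invmx u.
  by rewrite (SU3_invM hu (SU3_V wS)) invmxK.
split=> //; rewrite TE; apply/seteqP; split=> _ [x _ <-].
- have [y e] := wperm_tor s x; exists y => //.
  by rewrite /ctor uwV -e !mulmxA (mulmxKV wU) (mulmxKV wU).
- have [y e] := wperm_tor s^-1%g x; exists y => //.
  by rewrite /ctor uwV -e -(wpermV s) invmxK !mulmxA.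
Qed.

Lemma angle_perm u (s : {perm 'I_3}) j H : frame u ->
  angle (u *m invmx (wperm R s)) j H = angle u (s j) H.
Proof.
move=> hu; have vH := frame_val_diag H hu; have huS := proj1 hu.
have wS := wperm_SU3 R s; have wU := SU3_unit wS.
rewrite {1}/angle vH.
have -> : invmx (u *m invmx (wperm R s)) = wperm R s *m invmx u.
  by rewrite (SU3_invM huS (SU3_V wS)) invmxK.
have -> (A : M3) : wperm R s *m invmx u *m (u *m A *m invmx u) *m (u *m invmx (wperm R s)) =
    wperm R s *m A *m invmx (wperm R s).
  rewrite !mulmxA -(mulmxA (wperm R s)) (SU3_mulVmx huS) mulmx1.
  by rewrite (mulmxKV (SU3_unit huS)).
by rewrite wperm_conj !mxE eqxx.
Qed.

Definition posroot (i : 'I_3) : R * R := [:: (2, -1); (-1, 2); (1, 1)]`_i.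

Lemma posroot_inj : injective posroot.
Proof.
move=> i j; case: i => [[|[|[|//]]] hi]; case: j => [[|[|[|//]]] hj]; rewrite /posroot /=;
  move=> e; first [exact: val_inj | exfalso; case: e => *; lra].
Qed.

(** Applied to the relation that the root [(j, k)] is positive: a positive system is a linear order
    on the three diagonal positions. *)
Lemma transitive_tournament (P : 'I_3 -> 'I_3 -> Prop) :
  (forall j k, j != k -> P j k \/ P k j) ->
  (forall j k, P j k -> P k j -> False) ->
  (forall i j k, P i j -> P j k -> P i k) ->
  exists s : {perm 'I_3}, [/\ P (s 0) (s 1), P (s 1) (s 2%:R) & P (s 0) (s 2%:R)].
Proof.
move=> tot asym trans.
have mk i j k : uniq [:: i; j; k] -> P i j -> P j k ->
    exists s : {perm 'I_3}, [/\ P (s 0) (s 1), P (s 1) (s 2%:R) & P (s 0) (s 2%:R)].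
  move=> u hij hjk; have inj : injective (fun x : 'I_3 => [:: i; j; k]`_x).
    by move=> x y /eqP; rewrite nth_uniq// => /eqP/val_inj.
  by exists (perm inj); rewrite !permE /=; split=> //; exact: trans hij hjk.
have [h01|h10] := tot 0 1 isT; have [h12|h21] := tot 1 2%:R isT;
  have [h02|h20] := tot 0 2%:R isT.
- exact: mk h01 h12.
- by case: (asym _ _ h20); exact: trans h01 h12.
- exact: mk h02 h21.
- exact: mk h20 h01.
- exact: mk h10 h02.
- exact: mk h12 h20.
- by case: (asym _ _ h02); exact: trans h21 h10.
- exact: mk h21 h10.
Qed.

Lemma positive_system_frame u (a : 'I_3 -> functional T) :
  frame u -> positive_system a ->
  exists v, frame v /\ exists s : {perm 'I_3}, forall i, a i = dynkin v (posroot (s i)).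
Proof.
move=> hu [a_inj _ a_sign a_add]; pose P j k := j != k /\ range a (root u j k).
have rootN j k : root u k j = lopp (root u j k).
  apply/funext => H; rewrite /root /lopp; apply/eqP.
  by rewrite eq_complex /= oppr0 opprB !eqxx.
have rootD i j k : root u i k = ladd (root u i j) (root u j k).
  apply/funext => H; rewrite /root /ladd; apply/eqP.
  by rewrite eq_complex /= addr0 eqxx /=; apply/eqP; ring.
have asym j k : P j k -> P k j -> False.
  move=> [jk h1] [_ h2]; have [_] := a_sign _ (is_root_root hu jk).
  by rewrite -rootN; apply.
have [| |s [h01 h12 h02]] := @transitive_tournament P _ asym.
- move=> j k jk; have [[h|h] _] := a_sign _ (is_root_root hu jk); [left|right] => //.
  by split; [rewrite eq_sym | rewrite rootN].
- move=> i j k Pij Pjk; have ik : i != k.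
    by apply: contraPneq Pjk => <- /(asym _ _ Pij).
  split=> //; case: Pij Pjk => [_ [x _ ex]] [_ [y _ ey]].
  by have := a_add x y; rewrite ex ey -rootD; apply; exact: is_root_root.
pose v := u *m invmx (wperm R s); have hv : frame v by exact: frame_perm.
have rv j k : root v j k = root u (s j) (s k).
  by apply/funext => H; rewrite /root !angle_perm.
have surj i : exists j, a j = dynkin v (posroot i).
  have [_ [x0 _ e0]] := h01; have [_ [x1 _ e1]] := h12; have [_ [x2 _ e2]] := h02.
  case: i => [[|[|[|//]]] hi]; [exists x0; rewrite e0|exists x1; rewrite e1|exists x2; rewrite e2];
    rewrite -rv rootE//; congr dynkin; rewrite /wt /posroot /=; congr (_, _); ring.
have [f hf] := choice surj.
(* The three standard roots all occur among the values of [a]; by counting, [f] is a permutation and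
   there is no room for other values. *)
have f_inj : injective f.
  by move=> i j e; apply: posroot_inj; apply: (dynkin_inj hv); rewrite -!hf e.
exists v; split=> //; exists (perm f_inj)^-1%g => i.
by rewrite -hf -[f _](permE f_inj) permKV.
Qed.

Lemma angle_conj_perm u (s : {perm 'I_3}) j (H H' : Lie T) : frame u ->
  \val H' = u *m wperm R s *m invmx u *m \val H *m invmx (u *m wperm R s *m invmx u) ->
  angle u j H' = angle u (s j) H.
Proof.
move=> hu; have vH := frame_val_diag H hu; have huS := proj1 hu.
have wS := wperm_SU3 R s; have wU := SU3_unit wS; have uU := SU3_unit huS.
have -> : invmx (u *m wperm R s *m invmx u) = u *m invmx (wperm R s) *m invmx u.
  by rewrite (SU3_invM (SU3_M huS wS) (SU3_V huS)) (SU3_invM huS wS) invmxK mulmxA.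
move=> vH'; rewrite {1}/angle vH' {1}vH.
rewrite (SU3_conjM _ _ huS) (SU3_conjM _ _ huS).
by rewrite wperm_conj SU3_conjK// !mxE eqxx.
Qed.

(** Signed permutation matrices in the frame represent the Weyl group; these are the elements to
    which the invariance of the inner product is applied. *)
Lemma normalizes_perm u (s : {perm 'I_3}) : frame u ->
  normalizes T (u *m wperm R s *m invmx u).
Proof.
move=> [hu TE]; have wS := wperm_SU3 R s; have wU := SU3_unit wS; have uU := SU3_unit hu.
have nE r : invmx (u *m wperm R r *m invmx u) = u *m wperm R r^-1%g *m invmx u.
  by rewrite (SU3_invM (SU3_M hu (wperm_SU3 R r)) (SU3_V hu)) (SU3_invM hu (wperm_SU3 R r)) invmxK wpermV mulmxA.
have fwd r g : T g -> T (u *m wperm R r *m invmx u *m g *m invmx (u *m wperm R r *m invmx u)).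
  rewrite TE => -[x _ <-]; have [y e] := wperm_tor r x; exists y => //.
  by rewrite nE /ctor -e -wpermV !(SU3_conjM _ _ hu).
have nS : SU3 (u *m wperm R s *m invmx u) by exact: SU3_conj.
split=> // g; split; last exact: fwd.
move=> h; have := fwd s^-1%g _ h; rewrite -(nE s).
move: (u *m wperm R s *m invmx u) nS => n nS; rewrite (_ : invmx (invmx n) = n); last exact: invmxK.
by rewrite !mulmxA (SU3_mulVmx nS) mul1mx (mulmxKV (SU3_unit nS)).
Qed.

Lemma weyl_image_refl u (y : R * R) : frame u ->
  weyl_image (u *m wperm R (tperm 0 1) *m invmx u) (dynkin u y) (dynkin u (refl1 y)) /\
  weyl_image (u *m wperm R (tperm 1 2%:R) *m invmx u) (dynkin u y) (dynkin u (refl2 y)).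
Proof.
move=> hu; have a1 H : angle u 1 H = - angle u 0 H - angle u 2%:R H.
  by rewrite (angleE 1 H hu) /wt /=; move: (angle _ _ _) (angle _ _ _) => ? ?; ring.
split=> H H' e; rewrite /dynkin (angle_conj_perm 0 hu e) (angle_conj_perm 2%:R hu e).
  rewrite tpermL tpermD// a1; congr (_ +i* _); rewrite /refl1 /=.
  by move: (angle _ _ _) (angle _ _ _) => ? ?; ring.
rewrite tpermR tpermD// a1; congr (_ +i* _); rewrite /refl2 /=.
by move: (angle _ _ _) (angle _ _ _) => ? ?; ring.
Qed.

Lemma dynkin_lin u c (y z : R * R) :
  dynkin u (c * y.1 + z.1, c * y.2 + z.2) = ladd (lscale c (dynkin u y)) (dynkin u z).
Proof.
apply/funext => H; rewrite /ladd /lscale /dynkin /=.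
move: (angle _ _ _) (angle _ _ _) => ? ?.
by apply/eqP; rewrite eq_complex /=; apply/andP; split; apply/eqP; ring.
Qed.

(* Invariance under the two simple reflections determines the form up to scale. *)
Lemma ip_dynkin u ip : frame u -> inner_product ip -> weyl_invariant ip ->
  exists2 b : R, 0 < b & forall p q p' q' : R,
    ip (dynkin u (p, q)) (dynkin u (p', q')) =
    b * (2 * p * p' + p * q' + q * p' + 2 * q * q').
Proof.
move=> hu [ip_sym ip_lin ip_pos] inv; pose B y z := ip (dynkin u y) (dynkin u z).
have D := dynkin_it_dual u.
have Bs y z : B y z = B z y by exact: ip_sym.
have Bl c y z w : B (c * y.1 + z.1, c * y.2 + z.2) w = c * B y w + B z w.
  by rewrite /B dynkin_lin ip_lin.
have B0 w : B (0, 0) w = 0.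
  by have := Bl 1 (0, 0) (0, 0) w; rewrite /= !mulr0 !addr0; lra.
have Bexp p q w : B (p, q) w = p * B (1, 0) w + q * B (0, 1) w.
  have := Bl p (1, 0) (0, q) w; rewrite /= mulr1 mulr0 addr0 add0r => ->.
  have := Bl q (0, 1) (0, 0) w; rewrite /= mulr1 mulr0 !addr0 => ->.
  by rewrite B0 addr0.
have r1 y z : B (refl1 y) (refl1 z) = B y z.
  have [hy _] := weyl_image_refl y hu; have [hz _] := weyl_image_refl z hu.
  exact: (inv _ _ _ _ _ (normalizes_perm _ hu) (D _) (D _) (D _) (D _) hy hz).
have r2 y z : B (refl2 y) (refl2 z) = B y z.
  have [_ hy] := weyl_image_refl y hu; have [_ hz] := weyl_image_refl z hu.
  exact: (inv _ _ _ _ _ (normalizes_perm _ hu) (D _) (D _) (D _) (D _) hy hz).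
have [b bE] : exists b, b = B (1, 0) (0, 1) by eexists.
have Bfull p q p' q' : B (p, q) (p', q') =
    p * p' * B (1, 0) (1, 0) + (p * q' + q * p') * b + q * q' * B (0, 1) (0, 1).
  rewrite Bexp (Bs (1, 0)) (Bs (0, 1)) (Bexp p' q') (Bexp p' q') (Bs (0, 1) (1, 0)) -bE.
  by move: (B (1, 0) (1, 0)) (B (0, 1) (0, 1)) => ? ?; clear; ring.
(* [(0, 1)] and its reflection [(1, -1)] have the same length, so B(1,0)(1,0) - 2 b = 0; [eD] is
   symmetric. *)
have eA : B (1, 0) (1, 0) = 2 * b.
  have := r2 (0, 1) (0, 1); clear -Bfull; rewrite /refl2 /= Bfull.
  by move: (B (1, 0) (1, 0)) (B (0, 1) (0, 1)) => ? ?; lra.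
have eD : B (0, 1) (0, 1) = 2 * b.
  have := r1 (1, 0) (1, 0); clear -Bfull; rewrite /refl1 /= Bfull.
  by move: (B (1, 0) (1, 0)) (B (0, 1) (0, 1)) => ? ?; lra.
have b0 : 0 < b.
  have : 0 < B (1, 0) (1, 0).
    apply: ip_pos => // e; have /(dynkin_inj hu)[/eqP] : dynkin u (1, 0) = dynkin u (0, 0).
      by rewrite e; apply/funext => H; rewrite /dynkin /= !mul0r subrr.
    by rewrite oner_eq0.
  by rewrite eA; clear; lra.
exists b => // p q p' q'; rewrite -/(B _ _) Bfull eA eD.
by clear; ring.
Qed.

(** * The estimate in a positive frame *)

(** With 2 pi for one of [s], [t] and 0 for the other, these are the simple coroots scaled into the
    kernel of the exponential; a weight takes its Dynkin coordinates there, up to the factor 2 pi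
    i. *)
Lemma frame_period u s t : frame u -> cis s = 1 -> cis t = 1 ->
  exists H, [/\ expmx (\val H) = 1%:M, angle u 0 H = s & angle u 2%:R H = - t].
Proof.
move=> hu hs ht; have [H e] := frame_elt s t hu; exists H.
have [a0 _ a2] := angle_conj (proj1 hu) e; split=> //.
rewrite (frame_exp H hu) a0 a2 opprK /ctor /= /tor cisD !cisN hs ht !rmorph1 mul1r.
by rewrite diag_row3_1 mulmx1 SU3_mulmxV//; case: hu.
Qed.

Lemma sin_half_eq0 (x : R) : sin (x / 2) = 0 -> cis x = 1.
Proof.
move=> h; have -> : x = x / 2 + x / 2 by field.
have := cos2Dsin2 (x / 2); rewrite cisD /cis h expr0n /= addr0 => c2.
by apply/eqP; rewrite eq_complex /= !mulr0 mul0r subr0 addr0 -expr2 c2 !eqxx.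
Qed.

Definition root_sine (s t : R) (i : 'I_3) : R :=
  `|sin (((posroot i).1 * s + (posroot i).2 * t) / 2)|.

Lemma ord3P (i : 'I_3) : [\/ i = 0, i = 1 | i = 2%:R].
Proof.
by case: i => [[|[|[|//]]] h]; [constructor 1 | constructor 2 | constructor 3]; apply: val_inj.
Qed.

Lemma central_scalar (c : R[i]) : @central_in_SU3 R (c%:M).
Proof. by move=> h _; rewrite scalar_mxC. Qed.

(** A vanishing sine identifies two diagonal entries, and two different positive roots identify all
    three. *)
Lemma two_sines_vanish (s t : R) i j : i != j -> root_sine s t i = 0 -> root_sine s t j = 0 ->
  tor s t = (cis s)%:M.
Proof.
pose e k := [:: s; t - s; - t]`_(k : 'I_3).
have cE : tor s t = diag_mx (\row_k cis (e k)).
  by congr diag_mx; apply/rowP => k; rewrite !mxE; case: k => [[|[|[|//]]] h].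
have r k : root_sine s t k = 0 -> cis (((posroot k).1 * s + (posroot k).2 * t)) = 1.
  by move=> /normr0P/eqP; exact: sin_half_eq0.
have r0 : root_sine s t 0 = 0 -> cis (t - s) = cis s.
  move=> /r; rewrite /posroot /= => h.
  rewrite -[LHS]mul1r -h -cisD; congr cis; ring.
have r1 : root_sine s t 1 = 0 -> cis (t - s) = cis (- t).
  move=> /r; rewrite /posroot /= => h.
  rewrite -[RHS]mul1r -h -cisD; congr cis; ring.
have r2 : root_sine s t 2%:R = 0 -> cis (- t) = cis s.
  move=> /r; rewrite /posroot /= => h.
  rewrite -[LHS]mul1r -h -cisD; congr cis; ring.
move=> ij hi hj.
have [h1 h2] : cis (t - s) = cis s /\ cis (- t) = cis s.
  case: (ord3P i) ij hi => ->; case: (ord3P j) hj => -> hj ij hi; try by [];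
    try have A := r0 hi; try have A := r1 hi; try have A := r2 hi;
    try have B := r0 hj; try have B := r1 hj; try have B := r2 hj; split; congruence.
rewrite cE -diag_const_mx; congr diag_mx; apply/rowP => k; rewrite !mxE /e.
by case: k => [[|[|[|//]]] h].
Qed.

(** Sorting indices rather than values keeps track of which roots carry the largest sines, also when
    values coincide. *)
Lemma sort3 (f : 'I_3 -> R) (s : {perm 'I_3}) : exists i j k,
  [/\ uniq [:: i; j; k], sort >=%R [seq f (s i) | i <- enum 'I_3] = [:: f i; f j; f k],
    f j <= f i & f k <= f j].
Proof.
set l := sort (relpre f >=%R) [seq s i | i <- enum 'I_3].
have lE : sort >=%R [seq f (s i) | i <- enum 'I_3] = map f l.
  by rewrite (map_comp f s) sort_map.
have lU : uniq l by rewrite sort_uniq map_inj_uniq ?enum_uniq//; exact: perm_inj.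
have lS : size l = 3%N by rewrite size_sort size_map size_enum_ord.
have : sorted (relpre f >=%R) l by apply: sort_sorted => x y; exact: le_total.
rewrite lE; move: l lS lU {lE} => [|i [|j [|k [|//]]]] //= _ lU /and3P[h1 h2 _].
by exists i, j, k.
Qed.

Section PositiveFrame.
Variables (u : M3) (a : 'I_3 -> functional T) (idx : {perm 'I_3}).
Hypothesis hu : frame u.
Hypothesis aE : forall i, a i = dynkin u (posroot (idx i)).
Variables (ip : functional T -> functional T -> R) (b : R).
Hypothesis b0 : 0 < b.
Hypothesis ipE : forall p q p' q' : R, ip (dynkin u (p, q)) (dynkin u (p', q')) =
    b * (2 * p * p' + p * q' + q * p' + 2 * q * q').

Lemma ip_posroot p q i : ip (dynkin u (p, q)) (a i) = 3 * b * [:: p; q; p + q]`_(idx i).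
Proof.
rewrite aE; case: (idx i) => [[|[|[|//]]] h]; rewrite /posroot /= ipE; ring.
Qed.

(** Integrality comes from the two simple periods, non-negativity from pairing with the simple
    roots. *)
Lemma dominant_dynkin mu : dominant_weight a ip mu ->
  exists k l : nat, mu = dynkin u (k%:R, l%:R).
Proof.
move=> [mu_it mu_int mu_dom]; have [[p q] muE] := it_dual_dynkin hu mu_it.
have cis2pi' : cis (2 * pi) = 1 :> R[i] by rewrite mulr_natl cis2pi.
have pi0 : (2 * pi : R) != 0 by rewrite mulf_neq0// gt_eqF// pi_gt0.
have nonneg (x : R) i : (idx i == 0 /\ x = p) \/ (idx i == 1 /\ x = q) -> 0 <= x.
  have := mu_dom i; rewrite muE ip_posroot pmulr_rge0 ?mulr_gt0// => h.
  by case=> -[/eqP e ->]; move: h; rewrite e.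
have natE (x : R) (z : int) : 0 <= x -> x = z%:~R -> exists k : nat, x = k%:R.
  by move=> x0 e; move: x0; rewrite e ler0z; case: z {e} => // k _; exists k.
have [k pk] : exists k : nat, p = k%:R.
  have [H [/mu_int[z]]] := frame_period hu cis2pi' (cis0 R).
  rewrite muE /dynkin /= => e e0 e2; apply: (natE p z).
    by apply: (nonneg p (idx^-1%g 0)); left; rewrite permKV.
  by move: e => [] /=; rewrite e0 e2 oppr0 mulr0 subr0 mulrC => /(mulfI pi0).
have [l ql] : exists l : nat, q = l%:R.
  have [H [/mu_int[z]]] := frame_period hu (cis0 R) cis2pi'.
  rewrite muE /dynkin /= => e e0 e2; apply: (natE q z).
    by apply: (nonneg q (idx^-1%g 1)); right; rewrite permKV.
  by move: e => [] /=; rewrite e0 e2 mulr0 sub0r mulrN opprK mulrC => /(mulfI pi0).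
by exists k, l; rewrite muE pk ql.
Qed.

Lemma rho_dynkin : rho a = dynkin u (1, 1).
Proof.
apply/funext => H; rewrite /rho.
rewrite (reindex_inj (@perm_inj _ idx^-1%g)) /=.
under eq_bigr => i _ do rewrite aE permKV.
rewrite sum_ord3 /dynkin /posroot /=.
move: (angle _ _ _) (angle _ _ _) => x y.
by apply/eqP; rewrite eq_complex /=; apply/andP; split; apply/eqP; field.
Qed.

(** With p = k + 1 and q = l + 1 the extremes are at most 3 b (p + q) and 3 b min(p, q). Since p + q
    is at most twice the maximum, the constant is 9 times 2. *)
Lemma upper_lower_le (k l : nat) mu : mu = dynkin u (k%:R, l%:R) ->
  0 < upper_mu a ip mu * lower_mu a ip mu <= 18 * b ^+ 2 * (k.+1%:R * l.+1%:R).
Proof.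
move=> ->; have muE : ladd (dynkin u (k%:R, l%:R)) (rho a) = dynkin u (k.+1%:R, l.+1%:R).
  rewrite rho_dynkin; apply/funext => H; rewrite /ladd /dynkin /= -!natr1.
  move: (angle _ _ _) (angle _ _ _) => x y.
  by apply/eqP; rewrite eq_complex /=; apply/andP; split; apply/eqP; ring.
rewrite /upper_mu /lower_mu muE; set p : R := k.+1%:R; set q : R := l.+1%:R.
have p0 : 0 < p by rewrite /p ltr0n.
have q0 : 0 < q by rewrite /q ltr0n.
have ipp i : 0 < ip (dynkin u (p, q)) (a i) by
  rewrite ip_posroot mulr_gt0 ?mulr_gt0//; case: (idx i) => [[|[|[|//]]] h] //=; rewrite addr_gt0.
have ub i : ip (dynkin u (p, q)) (a i) <= 3 * b * (p + q).
  rewrite ip_posroot ler_wpM2l//; first by rewrite mulr_ge0// ltW.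
  by clear -p0 q0; case: (idx i) => [[|[|[|//]]] h] /=; lra.
set U := \big[_/_]_(i < 3) _; set L := \big[_/_]_(i < 3) _.
have Uub : U <= 3 * b * (p + q) by apply: bigmax_le => [|i _]; exact: ub.
have U0 : 0 < U by apply: lt_le_trans (ipp 0) _; exact: le_bigmax.
have L0 : 0 < L by apply: lt_bigmin => [|i _]; exact: ipp.
have Lp : L <= 3 * b * p.
  have := ip_posroot p q (idx^-1%g 0); rewrite permKV /= => <-; exact: bigmin_le.
have Lq : L <= 3 * b * q.
  have := ip_posroot p q (idx^-1%g 1); rewrite permKV /= => <-; exact: bigmin_le.
rewrite mulr_gt0//=; clearbody U L p q.
apply: le_trans (_ : 3 * b * (p + q) * L <= _); first by rewrite ler_wpM2r// ltW.
have [pq|qp] := leP p q.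
  apply: le_trans (_ : 3 * b * (p + q) * (3 * b * p) <= _).
    by rewrite ler_wpM2l// !mulr_ge0// ?addr_ge0 ?ltW.
  have : 0 <= b ^+ 2 * p * (q - p) by rewrite !mulr_ge0 ?subr_ge0 ?sqr_ge0// ltW.
  lra.
apply: le_trans (_ : 3 * b * (p + q) * (3 * b * q) <= _).
  by rewrite ler_wpM2l// !mulr_ge0// ?addr_ge0 ?ltW.
have : 0 <= b ^+ 2 * q * (p - q) by rewrite !mulr_ge0 ?subr_ge0 ?sqr_ge0// ltW.
lra.
Qed.

(** If the product of the two largest sines is 0, then so are the second and the third, and the
    exponential is scalar. Hence [c_of] is positive at non-central points. *)
Lemma c_ofE H : exists i j, [/\ i != j,
  c_of a H = root_sine (angle u 0 H) (- angle u 2%:R H) i * root_sine (angle u 0 H) (- angle u 2%:R H) j &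
  c_of a H = 0 -> central_in_SU3 (expmx (\val H))].
Proof.
set s := angle u 0 H; set t := - angle u 2%:R H.
have fE : [seq `|sin (complex.Im (a i H) / 2)| | i <- enum 'I_3] =
    [seq root_sine s t (idx i) | i <- enum 'I_3].
  apply: eq_map => i; rewrite aE /dynkin /root_sine /s /t /=; congr (`|sin (_ / 2)|).
  by rewrite mulrN.
have [i [j [k [ijk srt ji kj]]]] := sort3 (root_sine s t) idx.
have cE : c_of a H = root_sine s t i * root_sine s t j by rewrite /c_of fE srt.
move: ijk; rewrite /= !inE negb_or andbT => /andP[/andP[ij ik] jk].
exists i, j; split=> //; rewrite cE => /eqP c0.
have rs0 m : 0 <= root_sine s t m by exact: normr_ge0.
have j0 : root_sine s t j = 0.
  move: c0; rewrite mulf_eq0 => /orP[/eqP h|/eqP//].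
  by apply/eqP; rewrite eq_le rs0 andbT -h.
have k0 : root_sine s t k = 0 by apply/eqP; rewrite eq_le rs0 andbT -j0.
rewrite (frame_exp H hu) /ctor /= (two_sines_vanish jk j0 k0).
have -> : u *m (cis s)%:M *m invmx u = (cis s)%:M.
  by rewrite scalar_mxC -mulmxA SU3_mulmxV ?mulmx1//; case: hu.
exact: central_scalar.
Qed.

(** * Weights of the representation in the coordinates of the frame *)

Section ConjugateRepresentation.
Variables (d : nat) (p : M3 -> 'M[R[i]]_d).
Hypothesis p_rep : representation p.
Hypothesis p_irr : irreducible p.

Definition conj_rep (g : M3) := p (u *m g *m invmx u).

Let huS : SU3 u := proj1 hu.

Lemma conj_rep1 : conj_rep 1%:M = 1%:M.
Proof. by rewrite /conj_rep mulmx1 (SU3_mulmxV huS); case: p_rep. Qed.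

Lemma conj_repM g h : SU3 g -> SU3 h -> conj_rep (g *m h) = conj_rep g *m conj_rep h.
Proof.
case: p_rep => _ pM _ hg hh; rewrite /conj_rep -pM; try exact: SU3_conj.
by rewrite !mulmxA (mulmxKV (SU3_unit huS)).
Qed.

Lemma conj_rep_continuous1 (e : R) : 0 < e -> exists2 r : R, 0 < r &
  forall g, SU3 g -> mxnorm1 (g - 1%:M) < r -> mxnorm1 (conj_rep g - 1%:M) < e.
Proof.
move=> e0; have [r r0 hr] := representation_continuous1 p_rep e0.
exists (r / 81); first by rewrite divr_gt0.
move=> g hg; rewrite ltr_pdivlMr// => gr; apply: hr; first exact: SU3_conj.
have -> : u *m g *m invmx u - 1%:M = u *m (g - 1%:M) *m invmx u.
  by rewrite mulmxBr mulmxBl mulmx1 (SU3_mulmxV huS).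
by apply: le_lt_trans (SU3_conj_norm _ huS) _; rewrite mulrC.
Qed.

Lemma conj_rep_irr : irreducible conj_rep.
Proof.
case: p_irr => d0 irr; split=> // V hV; apply: irr => g v hg vV.
have := hV (invmx u *m g *m u) v; rewrite /conj_rep SU3_conjVK//; apply=> //.
have := SU3_conj (SU3_V huS) hg; rewrite (_ : invmx (invmx u) = u)//; exact: invmxK.
Qed.

Lemma cexp_dynkin y H :
  cexp (dynkin u y H) = cis (y.1 * angle u 0 H + y.2 * - angle u 2%:R H).
Proof. by rewrite /dynkin cexp_cis mulrN. Qed.

Lemma conj_rep_exp H :
  p (expmx (\val H)) = conj_rep (tor (angle u 0 H) (- angle u 2%:R H)).
Proof. by rewrite (frame_exp H hu). Qed.

Variables (P : 'M[R[i]]_d) (x : 'I_d -> R * R).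
Hypothesis Pu : P \in unitmx.
Hypothesis Px : forall s t, P *m conj_rep (tor s t) *m invmx P =
    diag_mx (\row_c cis ((x c).1 * s + (x c).2 * t)).

Lemma has_weight_coord c : has_weight p (dynkin u (x c)).
Proof.
split; first exact: dynkin_it_dual.
exists (col c (invmx P)); split.
  apply: contraNneq (oner_neq0 R[i]) => h.
  have : (P *m col c (invmx P)) c 0 = 0 by rewrite h mulmx0 mxE.
  by rewrite colE mulmxA (mulmxV Pu) mul1mx mxE !eqxx => /eqP.
move=> H; rewrite conj_rep_exp cexp_dynkin.
set s := angle u 0 H; set t := - angle u 2%:R H.
have e : conj_rep (tor s t) *m invmx P =
    invmx P *m diag_mx (\row_c cis ((x c).1 * s + (x c).2 * t)).
  by rewrite -Px !mulmxA (mulVmx Pu) mul1mx.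
rewrite colE mulmxA e -mulmxA mul_diag_mx scalemxAr; congr (_ *m _).
apply/matrixP => i j; rewrite !mxE; case: eqP => [->//|_]; by rewrite !mulr0.
Qed.

(** A non-zero component of the weight vector in the basis given by [P] transforms by some [x c] and
    by [y] at once. *)
Lemma has_weightP y : has_weight p (dynkin u y) -> exists c, x c = y.
Proof.
move=> [_ [v [v0 hv]]]; pose w := P *m v.
have w0 : exists c, w c 0 != 0.
  apply: contrapT => /forallNP h; move/eqP: v0; apply.
  rewrite -[v](mulKmx Pu) (_ : P *m v = 0) ?mulmx0//; apply/matrixP => i j.
  by rewrite [RHS]mxE (ord1 j); apply/eqP/negPn/negP; exact: h.
have [c wc] := w0; exists c.
have e s t : cis (((x c).1 - y.1) * s + ((x c).2 - y.2) * t) = 1.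
  have [H eH] := frame_elt s t hu; have [a0 _ a2] := angle_conj huS eH.
  have := hv H; rewrite conj_rep_exp cexp_dynkin a0 a2 opprK => hH.
  have : diag_mx (\row_c cis ((x c).1 * s + (x c).2 * t)) *m w =
      cis (y.1 * s + y.2 * t) *: w.
    by rewrite -Px /w -!mulmxA (mulKmx Pu) hH scalemxAr.
  move=> /(congr1 (fun A : 'cV[R[i]]_d => A c 0)).
  rewrite mul_diag_mx mxE [in RHS]mxE mxE => /(mulIf wc) h.
  have -> : ((x c).1 - y.1) * s + ((x c).2 - y.2) * t =
    ((x c).1 * s + (x c).2 * t) + - (y.1 * s + y.2 * t) by ring.
  by rewrite cisD h -cisD subrr cis0.
have [e1 e2] := cis_linear_eq1 e.
by rewrite (surjective_pairing y) (surjective_pairing (x c)); congr (_, _); apply/eqP;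
  rewrite -subr_eq0 ?e1 ?e2.
Qed.

Lemma highest_weight_top (k l : nat) : highest_weight p a (dynkin u (k%:R, l%:R)) ->
  top_weight k l x.
Proof.
move=> [/has_weightP hmu hall]; split=> // c.
have [m muE] := hall _ (has_weight_coord c).
pose n j : R := (m (idx^-1%g j))%:R.
(* The third positive root is the sum of the simple ones, so its coefficient is added to both of
   theirs. *)
exists (n 0 + n 2%:R), (n 1 + n 2%:R); rewrite /n !addr_ge0//; split=> //.
have : dynkin u (k%:R, l%:R) = dynkin u (
   (x c).1 + 2 * (n 0 + n 2%:R) - (n 1 + n 2%:R),
   (x c).2 - (n 0 + n 2%:R) + 2 * (n 1 + n 2%:R)).
  rewrite muE; apply/funext => H; rewrite /ladd.
  rewrite (reindex_inj (@perm_inj _ idx^-1%g)) /=.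
  under eq_bigr => i _ do rewrite aE permKV.
  rewrite sum_ord3 /dynkin /posroot /=.
  have nE j : (m (idx^-1%g j))%:R = (n j)%:C by rewrite /n rmorph_nat.
  rewrite !nE.
  move: (angle _ _ _) (angle _ _ _) => X Y; move: (n _) (n _) (n _) (x c) => n0 n1 n2 [x1 x2].
  by apply/eqP; rewrite eq_complex /=; apply/andP; split; apply/eqP; ring.
by move=> /(dynkin_inj hu); rewrite /n.
Qed.

End ConjugateRepresentation.

Lemma chi_bound mu d (p : M3 -> 'M[R[i]]_d) H : dominant_weight a ip mu ->
  representation p -> irreducible p -> highest_weight p a mu ->
  ~ central_in_SU3 (expmx (\val H)) ->
  Normc.normc (chi p H) / d%:R
    <= 64 * 18 * b ^+ 2 * (c_of a H)^-1 * (upper_mu a ip mu * lower_mu a ip mu)^-1.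
Proof.
move=> mu_dom p_rep p_irr mu_high H_nc.
have [k [l muE]] := dominant_dynkin mu_dom.
have /andP[UL0 UL] := upper_lower_le muE.
have [P [x [Pu Px bound]]] := irreducible_character_bound (conj_rep1 p_rep)
  (conj_repM p_rep) (conj_rep_continuous1 p_rep) (conj_rep_irr p_irr).
have d0 : 0 < d%:R :> R by rewrite ltr0n; case: p_irr.
have top : top_weight k l x.
  by apply: (highest_weight_top Pu Px); rewrite -muE.
set s := angle u 0 H; set t := - angle u 2%:R H.
have chiE : chi p H = \tr (conj_rep p (tor s t)) by rewrite /chi conj_rep_exp.
have [i [j [ij cE c0]]] := c_ofE H.
have cpos : 0 < c_of a H.
  rewrite lt_def; apply/andP; split; first by apply/eqP => /c0.
  by rewrite cE mulr_ge0// normr_ge0.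
have {bound} := bound k l top s t; rewrite -chiE => bound.
have {bound} : Normc.normc (chi p H) * c_of a H <= 64 * d%:R / (k.+1%:R * l.+1%:R).
  rewrite cE -/s -/t.
  have r0 : root_sine s t 0 = `|sin ((2 * s - t) / 2)|.
    by rewrite /root_sine /posroot /=; congr (`|sin (_ / 2)|); ring.
  have r1 : root_sine s t 1 = `|sin ((2 * t - s) / 2)|.
    by rewrite /root_sine /posroot /=; congr (`|sin (_ / 2)|); ring.
  have r2 : root_sine s t 2%:R = `|sin ((s + t) / 2)|.
    by rewrite /root_sine /posroot /=; congr (`|sin (_ / 2)|); ring.
  rewrite mulrA; move: bound; rewrite -r0 -r1 -r2 => bound.
  have b12 := bound (root_sine s t 1) (root_sine s t 2%:R).
  have b02 := bound (root_sine s t 0) (root_sine s t 2%:R).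
  have b01 := bound (root_sine s t 0) (root_sine s t 1).
  (* [bound] covers three pairs of roots; the other three arise by exchanging the factors. *)
  case: (ord3P i) ij => ->; case: (ord3P j) => -> // _;
    by [apply: b12; rewrite !inE eqxx ?orbT | apply: b02; rewrite !inE eqxx ?orbT
      | apply: b01; rewrite !inE eqxx ?orbT | rewrite mulrAC; apply: b12; rewrite !inE eqxx ?orbT
      | rewrite mulrAC; apply: b02; rewrite !inE eqxx ?orbT
      | rewrite mulrAC; apply: b01; rewrite !inE eqxx ?orbT].
move: (Normc.normc _) (c_of a H) cpos (upper_mu _ _ _ * _) UL0 UL => X c c_gt0 U U0 UL.
set m : R := k.+1%:R * l.+1%:R in UL * => h; have m0 : 0 < m by rewrite mulr_gt0.
rewrite ler_pdivrMr//; move: d0 h; set D : R := d%:R => d0 h.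
rewrite -ler_pdivlMr// in h; apply: le_trans h _.
rewrite ler_pdivrMr//.
have -> : 64 * 18 * b ^+ 2 * c^-1 * U^-1 * D * c = 64 * D * (18 * b ^+ 2 / U).
  by field; rewrite !gt_eqF.
rewrite ler_pM2l ?mulr_gt0// -(ler_pM2l m0) mulfV ?gt_eqF//.
by rewrite mulrA ler_pdivlMr// mul1r mulrC.
Qed.

End PositiveFrame.
End TorusRoots.

Theorem theorem1p3 (R : realType) (T : set 'M[R[i]]_3)
  (T_max : maximal_torus T)
  (a : 'I_3 -> functional T) (a_pos : positive_system a)
  (ip : functional T -> functional T -> R)
  (ip_inner : inner_product ip) (ip_inv : weyl_invariant ip) :
  exists2 C : R, 0 < C &
    forall mu : functional T, dominant_weight a ip mu ->
    forall (d : nat) (p : 'M[R[i]]_3 -> 'M[R[i]]_d),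
      representation p -> irreducible p -> highest_weight p a mu ->
    forall H : Lie T, ~ central_in_SU3 (expmx (\val H)) ->
      Normc.normc (chi p H) / d%:R
        <= C * (c_of a H)^-1 * (upper_mu a ip mu * lower_mu a ip mu)^-1.
Proof.
have [u0 hu0 TE] := maximal_torus_conj T_max.
have [u [hu [s aE]]] := positive_system_frame (conj hu0 TE) a_pos.
have [b b0 ipE] := ip_dynkin hu ip_inner ip_inv.
(* 64 comes from the character estimate and 18 b^2 from the extreme inner products. *)
exists (64 * 18 * b ^+ 2); first by rewrite !mulr_gt0// exprn_gt0.
by move=> mu mu_dom d p p_rep p_irr mu_high H H_nc; exact: (chi_bound hu aE b0 ipE).
Qed.
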